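(* Let $\alpha : G \curvearrowright H$, $\alpha_g(\xi) = \pi(g)\xi + c(g)$, be an affine isometric action of a countable group $G$ on a real Hilbert space $H$. Fix $a > 0$ and consider the probability measure preserving skew product action $$\beta' : G \curvearrowright \widehat{H}\times\mathbb{R}/a\mathbb{Z}, \quad \beta'_g(\omega,t) = (\widehat{\pi}(g)\omega,\, t + \langle\omega,c(g^{-1})\rangle).$$ The following statements are equivalent. 1. The skew product $\beta'$ is weakly mixing. 2. The skew product $\beta'$ is ergodic. 3. The representation $\pi$ is weakly mixing and $c$ is not a coboundary.
   Context: All Hilbert spaces are separable. Here $\pi$ is an orthogonal representation of $G$ and $c$ is a $1$-cocycle ($c(gh)=c(g)+\pi(g)c(h)$); $c$ is a coboundary if $c(g)=\xi-\pi(g)\xi$ for some $\xi\in H$ and all $g$. Gaussian construction: $(\widehat H,\mu)$ is the (essentially unique) standard probability space equipped with a linear map $\xi\mapsto\langle\,\cdot\,,\xi\rangle$ from $H$ to real random variables such that each $\langle\,\cdot\,,\xi\rangle$ is centered Gaussian with variance $\|\xi\|^2$ and these generate the $\sigma$-algebra. $\widehat\pi(g)$ is the $\mu$-preserving automorphism of $\widehat H$ with $\langle\widehat\pi(g)\omega,\pi(g)\xi\rangle=\langle\omega,\xi\rangle$ a.e. for all $\xi$. $\widehat H\times\mathbb R/a\mathbb Z$ is equipped with the product of $\mu$ and the normalized Lebesgue measure. $\pi$ is weakly mixing if it has no nonzero finite-dimensional subrepresentation. An action is weakly mixing if its diagonal product with every ergodic probability measure preserving action of $G$ is ergodic. *)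

(* Defs.v *)
From HB Require Import structures.
From mathcomp Require Import all_boot all_order all_algebra.
From mathcomp Require Import all_classical all_reals all_analysis.
From mathcomp Require Import ring_quotient sesquilinear.

Set Implicit Arguments.
Unset Strict Implicit.
Unset Printing Implicit Defensive.

Import Order.TTheory GRing.Theory Num.Theory.
Import numFieldNormedType.Exports.

Local Open Scope classical_set_scope.
Local Open Scope ring_scope.

Definition separable (T : topologicalType) : Prop :=
  exists2 S : set T, countable S & dense S.

(* With completeness on the type, this says that [H] is a real Hilbert space
   with inner product [dot]. *)
Definition norm_from_dot (R : realType) (H : completeNormedModType R)
    (dot : {dot H for idfun}) : Prop :=
  forall x : H, `|x| ^+ 2 = dot x x.

Section affine_actions.
Context {R : realType} {G : groupType} {H : completeNormedModType R}.
Implicit Types (dot : {dot H for idfun}) (pi : G -> {linear H -> H}).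
Implicit Types (c : G -> H) (V : set H).

Definition orthogonal_representation dot pi : Prop :=
  [/\ forall x, pi 1%g x = x,
      forall g h x, pi (g * h)%g x = pi g (pi h x) &
      forall g x y, dot (pi g x) (pi g y) = dot x y].

Definition cocycle pi c : Prop :=
  forall g h, c (g * h)%g = c g + pi g (c h).

(* Equivalently, xi |-> pi g xi + c g defines an action of G on H by affine
   isometries with linear part pi. *)
Definition affine_isometric_action dot pi c : Prop :=
  orthogonal_representation dot pi /\ cocycle pi c.

Definition coboundary pi c : Prop :=
  exists xi : H, forall g, c g = xi - pi g xi.

Definition linear_span n (v : 'I_n -> H) : set H :=
  [set x | exists k : 'I_n -> R, x = \sum_(i < n) k i *: v i].

Definition finite_dimensional V : Prop :=
  exists n (v : 'I_n -> H), V = linear_span v.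

(* Closedness is not required: it is automatic in finite dimension, the only
   case used below. *)
Definition subrepresentation pi V : Prop :=
  [/\ V 0,
      forall (k : R) x y, V x -> V y -> V (k *: x + y) &
      forall g x, V x -> V (pi g x)].

Definition weakly_mixing_representation pi : Prop :=
  forall V, subrepresentation pi V -> finite_dimensional V -> V = [set 0].

End affine_actions.

Section pmp_actions.
Context {R : realType} {G : groupType}.

Definition measure_preserving d (T : measurableType d) (mu : probability T R)
    (f : T -> T) : Prop :=
  measurable_fun setT f /\ forall A, measurable A -> mu (f @^-1` A) = mu A.

Definition pmp_automorphism d (T : measurableType d) (mu : probability T R)
    (f : T -> T) : Prop :=
  measure_preserving mu f /\
  exists2 f' : T -> T, measure_preserving mu f' &
    {ae mu, forall w, f' (f w) = w} /\ {ae mu, forall w, f (f' w) = w}.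

(* Automorphisms of a probability space are considered modulo null sets, hence
   the group law is only required almost everywhere. *)
Definition pmp_action d (T : measurableType d) (mu : probability T R)
    (s : G -> T -> T) : Prop :=
  [/\ forall g, measure_preserving mu (s g),
      {ae mu, forall w, s 1%g w = w} &
      forall g h, {ae mu, forall w, s (g * h)%g w = s g (s h w)}].

Definition ergodic d (T : measurableType d) (mu : probability T R)
    (s : G -> T -> T) : Prop :=
  forall A : set T, measurable A ->
    (forall g, mu ((s g @^-1` A) `+` A) = 0%E) -> mu A = 0%E \/ mu A = 1%E.

Definition diagonal_product (T Y : Type) (s : G -> T -> T) (s' : G -> Y -> Y)
    (g : G) (p : T * Y) : T * Y := (s g p.1, s' g p.2).

Definition weakly_mixing_action d (T : measurableType d) (mu : probability T R)
    (s : G -> T -> T) : Prop :=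
  forall (d' : measure_display) (Y : measurableType d') (nu : probability Y R)
    (s' : G -> Y -> Y),
    pmp_action nu s' -> ergodic nu s' ->
    ergodic (mu \x nu)%E (diagonal_product s s').

End pmp_actions.

Section gaussian_construction.
Context {R : realType}.

Definition standard_borel d (T : measurableType d) : Prop :=
  exists P : completePseudoMetricType R,
    [/\ hausdorff_space P, separable P &
        exists2 f : T -> P, bijective f &
          forall A : set T, measurable A <-> <<s open >> (f @` A)].

(* [normal_prob 0 0] is not the point mass at 0 (the library uses a junk value
   for null deviation), hence the case distinction. *)
Definition centered_gaussian (v : R) : set R -> \bar R :=
  if v == 0 then \d_(0 : R) else normal_prob 0 (Num.sqrt v).

(* [Z xi] is a representative of the random variable <.,xi>, so the linearity of
   [Z] and the generation of the sigma-algebra hold modulo null sets. *)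
Record gaussian_space (H : completeNormedModType R) d (T : measurableType d)
    (mu : probability T R) (Z : H -> {RV mu >-> R}) : Prop := GaussianSpace {
  gaussian_standard : standard_borel T ;
  gaussian_linear : forall (k : R) (x y : H),
    {ae mu, forall w, Z (k *: x + y) w = k * Z x w + Z y w} ;
  gaussian_law : forall (x : H) (A : set R), measurable A ->
    distribution mu (Z x) A = centered_gaussian (`|x| ^+ 2) A ;
  gaussian_generated : forall A : set T, measurable A ->
    exists2 B : set T,
      <<s \bigcup_(x in [set: H]) preimage_set_system setT (Z x) measurable >> B
      & mu (A `+` B) = 0%E }.

Definition gaussian_lift (G : groupType) (H : completeNormedModType R) d
    (T : measurableType d) (mu : probability T R) (Z : H -> {RV mu >-> R})
    (pi : G -> {linear H -> H}) (pihat : G -> T -> T) : Prop :=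
  forall g, pmp_automorphism mu (pihat g) /\
    forall x : H, {ae mu, forall w, Z (pi g x) (pihat g w) = Z x w}.

End gaussian_construction.

Section circle.
Context {R : realType} (a : R).

Definition multiples : {pred R} :=
  fun x => `[< exists k : int, x = a * k%:~R >].

Lemma multiples_zmod_closed : zmod_closed multiples.
Proof.
split; first by apply/asboolP; exists 0; rewrite mulr0.
move=> x y /asboolP[k ->] /asboolP[l ->]; apply/asboolP.
by exists (k - l); rewrite intrB mulrBr.
Qed.

HB.instance Definition _ := GRing.isZmodClosed.Build R multiples
  multiples_zmod_closed.

Definition circle : Type := {ideal_quot multiples}.

HB.instance Definition _ := GRing.Zmodule.on circle.
HB.instance Definition _ := isPointed.Build circle 0.

(* The domain is [R], under the alias that carries the Lebesgue measure of the
   library. *)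
Definition circle_proj (t : measurableTypeR R) : circle :=
  \pi_({ideal_quot multiples})%qT t.

(* The quotient sigma-algebra, which is the Borel sigma-algebra of R/aZ. *)
Definition circle_measurable : set (set circle) :=
  [set A | measurable (circle_proj @^-1` A)].

Lemma circle_measurable0 : circle_measurable set0.
Proof. by rewrite /circle_measurable /= preimage_set0. Qed.

Lemma circle_measurableC A : circle_measurable A -> circle_measurable (~` A).
Proof. by rewrite /circle_measurable /= preimage_setC; exact: measurableC. Qed.

Lemma circle_measurable_bigcup (F : (set circle)^nat) :
  (forall i, circle_measurable (F i)) -> circle_measurable (\bigcup_i F i).
Proof.
move=> mF; rewrite /circle_measurable /= preimage_bigcup.
exact: bigcupT_measurable.
Qed.

HB.instance Definition _ := isMeasurable.Build default_measure_display circle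
  circle_measurable0 circle_measurableC circle_measurable_bigcup.

Lemma measurable_circle_proj : measurable_fun setT circle_proj.
Proof. by move=> _ A mA; rewrite setTI. Qed.

HB.instance Definition _ :=
  isMeasurableFun.Build _ _ _ _ circle_proj measurable_circle_proj.

(* Normalized Lebesgue measure, as the image of the uniform probability on
   [0, a]. *)
Definition circle_prob (a0 : 0 < a) : probability circle R :=
  distribution (uniform_prob a0) circle_proj.

End circle.

Definition skew_product (R : realType) (G : groupType)
    (H : completeNormedModType R) d (T : measurableType d)
    (mu : probability T R) (Z : H -> {RV mu >-> R}) (c : G -> H)
    (pihat : G -> T -> T) (a : R) (g : G) (p : T * circle a) : T * circle a :=
  (pihat g p.1, p.2 + circle_proj a (Z (c g^-1%g) p.1)).

(* Main.v *)
Require Import Defs.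
From mathcomp Require Import all_boot all_order all_algebra.
From mathcomp Require Import all_classical all_reals all_analysis.
From mathcomp Require Import ring_quotient sesquilinear.
From mathcomp Require Import measurable_realfun ring lra.

Set Implicit Arguments.
Unset Strict Implicit.
Unset Printing Implicit Defensive.

Import Order.TTheory GRing.Theory Num.Theory.
Import numFieldNormedType.Exports.

Local Open Scope classical_set_scope.
Local Open Scope ring_scope.

(* Put W(xi, k, th)(w, t) = cos (<w, xi> + 2 pi k t / a + th). The
   transformation beta'_g sends W(xi, k, th) to W(xi', k, th), where
   xi' = pi(g^-1) xi + (2 pi k / a) c(g^-1), and these functions span an algebra
   whose L2-closure contains all indicators. The correlations of the
   W(xi, k, th) are explicit in the norms of the vectors xi +- eta. If pi is
   weakly mixing then, given finitely many vectors, some g makes all the products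
   <pi(g) x, y> small; since a bounded cocycle is a coboundary, c can moreover be
   made large at g when it is not one. Along such g all correlations of the
   W(xi, k, th) factor, which yields 3 => 1. Conversely c(g) = xi - pi(g) xi makes
   t + <w, xi> mod a invariant, and an orthonormal basis e_i of a
   finite-dimensional subrepresentation makes sum <w, e_i>^2 invariant; neither
   function is constant. *)

(** * Finite-rank and compact forms *)

(** One group element per precision is enough; no sequence going to infinity in [G] is needed. Let B
    be invariant in the product with an ergodic action on Y, let f be its indicator and b its
    measure, and let P be a finite sum of waves times indicators on Y, close to f in L2. For a
    suitable g the correlation of P with its translate by g is nearly that of M with its translate,
    where M(y) is the mean of P(., y). Now M is close to the slice measure of B, which is invariant
    on Y and hence the constant b. So b, the correlation of f with itself, is as close as desired to
    b^2, and b is 0 or 1. Producing a finite-dimensional invariant subspace takes a spectral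
    theorem. It is proved for bilinear forms: compactness means approximation by finite-rank forms,
    which are lists of weighted vectors, so that neither operators nor tensor products have to be
    constructed. *)

Section hilbert.
Context {R : realType} {H : completeNormedModType R} (dot : {dot H for idfun}).
Context (normH : norm_from_dot dot).

Lemma dotC x y : dot x y = dot y x.
Proof. by rewrite hermC mul1r. Qed.

Lemma dotDl x y z : dot (x + y) z = dot x z + dot y z.
Proof. by rewrite linearDl. Qed.

Lemma dotDr x y z : dot x (y + z) = dot x y + dot x z.
Proof. by rewrite linearD. Qed.

Lemma dotZl k x y : dot (k *: x) y = k * dot x y.
Proof. by rewrite linearZl_LR. Qed.

Lemma dotZr k x y : dot x (k *: y) = k * dot x y.
Proof. by rewrite linearZ. Qed.

Lemma dotNl x y : dot (- x) y = - dot x y.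
Proof. by rewrite -scaleN1r dotZl mulN1r. Qed.

Lemma dotNr x y : dot x (- y) = - dot x y.
Proof. by rewrite -scaleN1r dotZr mulN1r. Qed.

Definition dotE := (dotDl, dotDr, dotNl, dotNr, dotZl, dotZr).

Lemma dot0l x : dot 0 x = 0.
Proof. by rewrite -(scale0r 0) dotZl mul0r. Qed.

Lemma dot_suml (I : Type) (r : seq I) (F : I -> H) y :
  dot (\sum_(i <- r) F i) y = \sum_(i <- r) dot (F i) y.
Proof. by elim/big_rec2: _ => [|i u v _ <-]; rewrite ?dot0l ?dotDl. Qed.

Lemma normD_sqr x y : `|x + y| ^+ 2 = `|x| ^+ 2 + 2 * dot x y + `|y| ^+ 2.
Proof. by rewrite !normH !dotE (dotC y x); ring. Qed.

Lemma normB_sqr x y : `|x - y| ^+ 2 = `|x| ^+ 2 - 2 * dot x y + `|y| ^+ 2.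
Proof. by rewrite normD_sqr dotNr normrN; ring. Qed.

Lemma dot_eq0 x : dot x x = 0 -> x = 0.
Proof. by rewrite -normH => /eqP; rewrite sqrf_eq0 normr_eq0 => /eqP. Qed.

Lemma dot_cauchy_schwarz x y : `|dot x y| <= `|x| * `|y|.
Proof.
have [->|y0] := eqVneq y 0; first by rewrite dotC dot0l !normr0 mulr0.
rewrite -(@ler_pXn2r _ 2)// ?nnegrE ?mulr_ge0// real_normK ?num_real//.
have yp : 0 < `|y| ^+ 2 by rewrite exprn_gt0// normr_gt0.
(* The component of [x] orthogonal to [y], scaled by |y|^2 so that nothing is divided. *)
have := sqr_ge0 `|(`|y| ^+ 2) *: x - dot x y *: y|.
rewrite normB_sqr !normrZ !dotE !exprMn.
rewrite ger0_norm ?sqr_ge0// real_normK ?num_real// => h.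
by rewrite -(ler_pM2l yp); nra.
Qed.

Definition orthonormal n (e : nat -> H) :=
  forall i j, (i < n)%N -> (j < n)%N -> dot (e i) (e j) = (i == j)%:R.

Definition expansion n (e : nat -> H) x := \sum_(i < n) dot x (e i) *: e i.

Definition subspace (V : set H) :=
  V 0 /\ forall (k : R) x y, V x -> V y -> V (k *: x + y).

Lemma subspace_sum V n (k : nat -> R) (e : nat -> H) : subspace V ->
  (forall i, (i < n)%N -> V (e i)) -> V (\sum_(i < n) k i *: e i).
Proof.
move=> [V0 VD]; elim: n => [|n IH] Ve; first by rewrite big_ord0.
rewrite big_ord_recr /= addrC; apply: VD; first exact: Ve.
by apply: IH => i /ltnW; exact: Ve.
Qed.

Lemma dot_expansion n e x j : orthonormal n e -> (j < n)%N ->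
  dot (expansion n e x) (e j) = dot x (e j).
Proof.
move=> one jn; rewrite /expansion dot_suml (bigD1 (Ordinal jn))//=.
rewrite dotZl one// eqxx mulr1 big1 ?addr0// => i ij.
by rewrite dotZl one// -[_ == j]/(i == Ordinal jn :> 'I_n) (negbTE ij) mulr0.
Qed.

(* Finitely many functionals separating the points of V bound its dimension. *)
Lemma orthonormal_basis N (w : nat -> H) (V : set H) : subspace V ->
  (forall x, V x -> (forall i, (i < N)%N -> dot x (w i) = 0) -> x = 0) ->
  exists n e, [/\ orthonormal n e, forall i, (i < n)%N -> V (e i) &
                  forall x, V x -> x = expansion n e x].
Proof.
elim: N V => [|N IH] V sV sepV.
  exists 0%N, w; split => // x Vx.
  by rewrite /expansion big_ord0; apply: sepV.
have [V0 VD] := sV.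
(* Induct on the number of functionals: if [w N] does not vanish on [V], its kernel has codimension
   one in [V], and a basis of the kernel is completed by a single vector. *)
pose V' := V `&` [set x | dot x (w N) = 0].
have [||n [e [one Ve ex]]] := IH V'.
- split=> [|k x y [Vx /= x0] [Vy /= y0]]; first by split => //=; exact: dot0l.
  by split => /=; [exact: VD|rewrite !dotE x0 y0 mulr0 addr0].
- move=> x [Vx xN] x0; apply: sepV => // i; rewrite ltnS leq_eqVlt.
  by move=> /predU1P[->//|]; exact: x0.
have [VV'|] := pselect (forall x, V x -> dot x (w N) = 0).
  exists n, e; split => // [i /Ve[]//|x Vx]; apply: ex; split => //.
  exact: VV'.
move=> /existsNP[x0] /not_implyP[Vx0 x0N].
pose x1 := x0 - expansion n e x0.
have Vx1 : V x1.
  rewrite /x1 addrC -scaleN1r; apply: VD => //.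
  by apply: (@subspace_sum V n (fun i => dot x0 (e i)) e sV) => i /Ve[].
have x1e j : (j < n)%N -> dot x1 (e j) = 0.
  by move=> jn; rewrite /x1 !dotE dot_expansion// subrr.
have x1N : dot x1 (w N) = dot x0 (w N).
  rewrite !dotE /expansion dot_suml big1 ?subr0// => i _.
  by rewrite dotZl; have [_ /= ->] := Ve i (ltn_ord i); rewrite mulr0.
have x1n : `|x1| != 0.
  rewrite normr_eq0; apply/eqP => x10; apply: x0N.
  by rewrite -x1N x10 dot0l.
pose u := `|x1|^-1 *: x1.
have uu : dot u u = 1.
  by rewrite /u dotZl dotZr -normH expr2; field.
have ue j : (j < n)%N -> dot u (e j) = 0.
  by move=> jn; rewrite dotZl x1e// mulr0.
have Vu : V u by rewrite -[u]addr0; apply: VD.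
pose e' i := if (i < n)%N then e i else u.
have e'E (i : 'I_n) : e' i = e i by rewrite /e' ltn_ord.
have e'n : e' n = u by rewrite /e' ltnn.
exists n.+1, e'; split.
- move=> i j; rewrite !ltnS /e' (leq_eqVlt i) (leq_eqVlt j).
  move=> /predU1P[->|lin] /predU1P[->|ljn].
  + by rewrite ltnn uu eqxx.
  + by rewrite ltnn ljn ue// gtn_eqF.
  + by rewrite ltnn lin dotC ue// ltn_eqF.
  + by rewrite lin ljn one.
- by move=> i _; rewrite /e'; case: ifP => // /Ve[].
- move=> x Vx; rewrite /expansion big_ord_recr /= e'n.
  under eq_bigr => i _ do rewrite e'E.
  (* Subtracting [t *: x1] brings [x] into the kernel of [w N], where the expansion is already
     known. *)
  pose t := dot x (w N) / dot x1 (w N).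
  have x1N0 : dot x1 (w N) != 0 by rewrite x1N; apply/eqP.
  have Vt : V' (x - t *: x1).
    split=> /=; last by rewrite dotDl dotNl dotZl divfK// subrr.
    by rewrite addrC -scaleNr; apply: VD.
  have -> : x = (x - t *: x1) + (t * `|x1|) *: u.
    by rewrite /u scalerA mulfK// subrK.
  move: (x - t *: x1) Vt => y Vy.
  have yu : dot y u = 0.
    rewrite (ex _ Vy) /expansion dot_suml big1// => i _.
    by rewrite dotZl (dotC _ u) ue// mulr0.
  rewrite dotDl dotZl uu mulr1 yu add0r {1}(ex _ Vy) /expansion.
  congr (_ + _); apply: eq_bigr => i _.
  by rewrite [in RHS]dotDl dotZl ue// mulr0 addr0.
Qed.

(** A vector in the span of [s] that is orthogonal to every element of [s] is orthogonal to itself,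
    so these products separate points. The result gives coordinates in which a computation with
    finitely many vectors becomes one with matrices. *)
Lemma orthonormal_span (s : seq H) : exists n e, orthonormal n e /\
  forall x, x \in s -> x = expansion n e x.
Proof.
pose V := [set x | exists k : nat -> R,
  x = \sum_(i < size s) k i *: nth 0 s i].
have [||n [e [one _ ex]]] := @orthonormal_basis (size s) (nth 0 s) V.
- split=> [|k x y [a ->] [b ->]].
    by exists (fun=> 0); rewrite big1// => i _; rewrite scale0r.
  exists (fun i => k * a i + b i); rewrite scaler_sumr -big_split/=.
  by apply: eq_bigr => i _; rewrite scalerDl scalerA.
- move=> x [k xk] x0; apply: dot_eq0; rewrite {1}xk dot_suml big1// => i _.
  by rewrite dotZl dotC x0// mulr0.
exists n, e; split => // x xs; apply: ex.
have xn : (index x s < size s)%N by rewrite index_mem.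
exists (fun i => (i == index x s)%:R); rewrite (bigD1 (Ordinal xn))//= eqxx.
rewrite scale1r nth_index// big1 ?addr0// => i.
by rewrite -val_eqE /= => /negbTE ->; rewrite scale0r.
Qed.

Lemma dot_parseval n e x y : x = expansion n e x ->
  dot x y = \sum_(i < n) dot x (e i) * dot y (e i).
Proof.
move=> {1}->; rewrite /expansion dot_suml; apply: eq_bigr => i _.
by rewrite dotZl (dotC y).
Qed.

Lemma sum_cauchy_schwarz (I : finType) (a b : I -> R) :
  (\sum_i a i * b i) ^+ 2 <= (\sum_i a i ^+ 2) * (\sum_i b i ^+ 2).
Proof.
set A := \sum_i a i ^+ 2; set B := \sum_i b i ^+ 2; set C := \sum_i a i * b i.
(* The factor [B] turns the difference into the sum of the squares of [B * a i - C * b i]; the case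
   [B = 0] is settled apart. *)
have : 0 <= B * (A * B - C ^+ 2).
  have -> : B * (A * B - C ^+ 2) = \sum_i (B * a i - C * b i) ^+ 2.
    transitivity (\sum_i (B ^+ 2 * (a i ^+ 2) - 2 * B * C * (a i * b i) +
      C ^+ 2 * (b i ^+ 2))); last by apply: eq_bigr => i _; ring.
    by rewrite big_split /= sumrB -!mulr_sumr -/A -/B -/C; ring.
  by apply: sumr_ge0 => i _; exact: sqr_ge0.
have [B0 _|B0] := eqVneq B 0.
  have b0 i : b i = 0.
    apply/eqP; rewrite -sqrf_eq0; apply/eqP.
    exact: (psumr_eq0P (fun j _ => sqr_ge0 (b j)) B0).
  by rewrite B0 mulr0 /C big1 ?expr0n// => i _; rewrite b0 mulr0.
have Bp : 0 < B by rewrite lt_def B0 sumr_ge0// => i _; exact: sqr_ge0.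
by rewrite pmulr_rge0// subr_ge0.
Qed.

(* A list of pairs (k, v) stands for the finite-rank operator sum k v (x) v;
   [tensor_form] is its quadratic form and [hs] the Hilbert-Schmidt inner
   product. *)
Definition tensor_form (w : seq (R * H)) x y :=
  \sum_(p <- w) p.1 * (dot p.2 x * dot p.2 y).

Definition hs (w w' : seq (R * H)) := \sum_(p <- w) p.1 * tensor_form w' p.2 p.2.

Definition tscale (k : R) (w : seq (R * H)) := [seq (k * p.1, p.2) | p <- w].

Lemma tensor_form_cat w w' x y :
  tensor_form (w ++ w') x y = tensor_form w x y + tensor_form w' x y.
Proof. by rewrite /tensor_form big_cat. Qed.

Lemma tensor_form_scale k w x y :
  tensor_form (tscale k w) x y = k * tensor_form w x y.
Proof.
rewrite /tensor_form big_map mulr_sumr; apply: eq_bigr => p _ /=.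
by rewrite mulrA.
Qed.

Lemma tensor_formC w x y : tensor_form w x y = tensor_form w y x.
Proof. by apply: eq_bigr => p _; congr *%R; rewrite mulrC. Qed.

Lemma tensor_form_linear w k x y z :
  tensor_form w (k *: x + y) z = k * tensor_form w x z + tensor_form w y z.
Proof.
rewrite /tensor_form mulr_sumr -big_split /=; apply: eq_bigr => p _.
by rewrite !dotE; ring.
Qed.

Lemma hs_catl w1 w2 w : hs (w1 ++ w2) w = hs w1 w + hs w2 w.
Proof. by rewrite /hs big_cat. Qed.

Lemma hs_scalel k w1 w : hs (tscale k w1) w = k * hs w1 w.
Proof. by rewrite /hs big_map mulr_sumr; apply: eq_bigr => p _ /=; rewrite mulrA. Qed.

Lemma hsC w w' : hs w w' = hs w' w.
Proof.
rewrite /hs /tensor_form; under eq_bigr do rewrite mulr_sumr.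
rewrite exchange_big /=; apply: eq_bigr => p _.
rewrite mulr_sumr; apply: eq_bigr => q _.
by rewrite (dotC q.2); ring.
Qed.

Lemma hs_catr w1 w2 w : hs w (w1 ++ w2) = hs w w1 + hs w w2.
Proof. by rewrite hsC hs_catl !(hsC w). Qed.

Lemma hs_scaler k w1 w : hs w (tscale k w1) = k * hs w w1.
Proof. by rewrite hsC hs_scalel hsC. Qed.

Definition hsE := (hs_catl, hs_catr, hs_scalel, hs_scaler).

(** In an orthonormal family that expands all the vectors involved, [hs w w] is the sum of the
    squares of the matrix entries; its sign is not visible in the definition because the weights may
    be negative. The second part says that the Hilbert-Schmidt norm dominates the operator norm. *)
Lemma tensor_form_hs w x y :
  0 <= hs w w /\ tensor_form w x y ^+ 2 <= hs w w * (`|x| ^+ 2 * `|y| ^+ 2).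
Proof.
have [n [e [one ex]]] := orthonormal_span [:: x, y & unzip2 w].
pose W (ij : 'I_n * 'I_n) :=
  \sum_(p <- w) p.1 * (dot p.2 (e ij.1) * dot p.2 (e ij.2)).
have wE p u v : p \in w -> dot p.2 u * dot p.2 v =
    \sum_(ij : 'I_n * 'I_n) (dot p.2 (e ij.1) * dot p.2 (e ij.2)) *
      (dot u (e ij.1) * dot v (e ij.2)).
  move=> pw; have pe : p.2 = expansion n e p.2.
    by apply: ex; rewrite !inE map_f ?orbT.
  rewrite (dot_parseval u pe) (dot_parseval v pe) big_distrlr/= pair_bigA /=.
  by apply: eq_bigr => -[i j] _ /=; ring.
have tE u v : tensor_form w u v =
    \sum_ij W ij * (dot u (e ij.1) * dot v (e ij.2)).
  transitivity (\sum_(p <- w) \sum_(ij : 'I_n * 'I_n) p.1 *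
      (dot p.2 (e ij.1) * dot p.2 (e ij.2) * (dot u (e ij.1) * dot v (e ij.2)))).
    by apply: eq_big_seq => p pw; rewrite (wE p u v pw) mulr_sumr.
  rewrite exchange_big /=; apply: eq_bigr => ij _.
  by rewrite /W mulr_suml; apply: eq_bigr => p _; ring.
have hE : hs w w = \sum_ij W ij ^+ 2.
  rewrite /hs; under eq_bigr => p _ do rewrite tE mulr_sumr.
  rewrite exchange_big /=; apply: eq_bigr => ij _.
  rewrite expr2 [X in _ = _ * X]/W mulr_sumr; apply: eq_bigr => p _; ring.
split; first by rewrite hE; apply: sumr_ge0 => ? _; exact: sqr_ge0.
rewrite tE hE (le_trans (sum_cauchy_schwarz _ _))//.
apply: ler_wpM2l; first by apply: sumr_ge0 => ? _; exact: sqr_ge0.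
have xe : x = expansion n e x by apply: ex; rewrite !inE eqxx.
have ye : y = expansion n e y by apply: ex; rewrite !inE eqxx orbT.
rewrite !normH (dot_parseval x xe) (dot_parseval y ye) big_distrlr/= pair_bigA.
by apply: ler_sum => -[i j] _ /=; rewrite exprMn !expr2.
Qed.

Lemma tensor_form_bound w : exists2 C, 0 <= C &
  forall x y, `|tensor_form w x y| <= C * (`|x| * `|y|).
Proof.
have [h0 _] := tensor_form_hs w 0 0.
exists (Num.sqrt (hs w w)) => [|x y]; first exact: sqrtr_ge0.
rewrite -(@ler_pXn2r _ 2)// ?nnegrE ?mulr_ge0// real_normK ?num_real//.
by rewrite !exprMn sqr_sqrtr//; have [] := tensor_form_hs w x y.
Qed.

End hilbert.

(** * Limits with an explicit rate, and ultrafilters *)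

Lemma natSinv_lt {R : realType} (e : R) : 0 < e -> exists n : nat, n.+1%:R^-1 < e.
Proof.
move=> e0; have [N _ HN] := near_infty_natSinv_lt (PosNum e0).
by exists N; exact: (HN N (leqnn N)).
Qed.

(** The rate survives in the limit, so that an identity for the limit can be proved by comparison
    with the [n]-th approximation, the error being killed by [le_natSinv_eq0]. *)
Lemma cauchy_rate {R : realType} {V : completeNormedModType R} (u : nat -> V) (C : R) :
  (forall N n m, (N <= n)%N -> (N <= m)%N -> `|u n - u m| <= C / N.+1%:R) ->
  exists l, forall n, `|l - u n| <= C / n.+1%:R.
Proof.
move=> uC.
have C0 : 0 <= C.
  by have := uC 0%N 0%N 0%N isT isT; rewrite subrr normr0 divr1.
have small e : 0 < e -> exists N : nat, C / N.+1%:R < e.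
  move=> e0; have [N HN] := natSinv_lt (divr_gt0 e0 (ltr_wpDl C0 ltr01)).
  exists N; have h : 0 < C + 1 by lra.
  apply: (@le_lt_trans _ _ ((C + 1) / N.+1%:R)).
    by rewrite ler_wpM2r ?invr_ge0// lerDl.
  by rewrite -ltr_pdivlMl// mulrC.
have cu : cvg (u @ \oo).
  apply/cauchy_cvgP/cauchy_exP => e e0 /=.
  have [N HN] := small e e0.
  exists (u N); exists N => // n /= Nn; rewrite -ball_normE /ball_ /=.
  exact: le_lt_trans (uC N N n (leqnn _) Nn) _.
exists (lim (u @ \oo)) => n; apply/ler_addgt0Pr => e e0.
have /cvgrPdist_lt/(_ e e0)[M _ HM] := cu.
have := HM (maxn M n) (leq_maxl _ _).
have := uC n (maxn M n) n (leq_maxr _ _) (leqnn _).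
set m := u (maxn M n); move=> h1 h2.
rewrite (_ : _ - u n = (lim (u @ \oo) - m) + (m - u n)); last by rewrite addrA subrK.
by rewrite (le_trans (ler_normD _ _))// addrC lerD// ltW.
Qed.

(** Bisection: an ultrafilter always picks one half of the current interval. A single ultrafilter
    thus does the work of successive extractions of subsequences, for all bounded sequences at
    once. *)
Lemma ultra_small {R : realType} (U : set_system nat) (u : nat -> R) (M e : R) :
  UltraFilter U -> (forall k, `|u k| <= M) -> 0 < e ->
  exists2 S, U S & forall k l, S k -> S l -> `|u k - u l| < e.
Proof.
move=> UU uM e0; have FU := ultra_proper (F := U).
have M0 : 0 <= M by exact: le_trans (normr_ge0 _) (uM 0%N).
have H n : exists2 S, U S & exists c, forall k, S k -> `|u k - c| <= M / 2 ^+ n.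
  elim: n => [|n [S US [c Sc]]].
    exists setT; first exact: filterT.
    by exists 0 => k _; rewrite subr0 expr0 divr1.
  pose d := M / 2 ^+ n.+1.
  have dE : M / 2 ^+ n = 2 * d by rewrite /d exprS; field.
  have [UA|UA] := in_ultra_setVsetC [set k | u k <= c] UU.
  - exists (S `&` [set k | u k <= c]); first exact: filterI.
    exists (c - d) => k [/Sc] /=; rewrite dE -/d !ler_norml => /andP[? ?] ?.
    by apply/andP; split; lra.
  - exists (S `&` ~` [set k | u k <= c]); first exact: filterI.
    exists (c + d) => k [/Sc] /=; rewrite dE -/d !ler_norml => /andP[? ?] /negP.
    by rewrite -ltNge => ?; apply/andP; split; lra.
have [N HN] : exists n : nat, 2 * (M / 2 ^+ n) < e.
  have [N HN] := natSinv_lt (divr_gt0 e0 (ltr_wpDl (mulr_ge0 (ler0n R 2) M0) ltr01)).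
  exists N; rewrite mulrA; have h : 0 < 2 * M + 1 by lra.
  apply: (@le_lt_trans _ _ ((2 * M + 1) / N.+1%:R)); last first.
    by rewrite -ltr_pdivlMl// mulrC.
  apply: ler_pM; rewrite ?invr_ge0 ?exprn_ge0 ?mulr_ge0 ?lerDl//.
  rewrite lef_pV2 ?posrE ?exprn_gt0//.
  by rewrite -natrX ler_nat ltn_expl.
have [S US [c Sc]] := H N.
exists S => // k l /Sc kc /Sc lc; apply: le_lt_trans HN.
rewrite (_ : u k - u l = (u k - c) - (u l - c)); last by ring.
by rewrite (le_trans (ler_normB _ _))// (_ : 2 * _ = M / 2 ^+ N + M / 2 ^+ N)// ?lerD//; ring.
Qed.

(** * Spectral theory of compact forms *)

Section compact_form.
Context {R : realType} {H : completeNormedModType R} (dot : {dot H for idfun}).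
Context (normH : norm_from_dot dot).

(** Compactness of the self-adjoint operator with form [q], as a norm limit of finite-rank ones.
    Stating it on the form spares the construction of the operator. *)
Definition finite_rank_approximable (q : H -> H -> R) := forall e, 0 < e ->
  exists w, forall x y, `|q x y - tensor_form dot w x y| <= e * (`|x| * `|y|).

Lemma psd_cauchy_schwarz (B : H -> H -> R) : (forall x y, B x y = B y x) ->
  (forall k x y z, B (k *: x + y) z = k * B x z + B y z) ->
  (forall x, 0 <= B x x) -> forall x y, B x y ^+ 2 <= B x x * B y y.
Proof.
move=> BC Bl B0 x y.
have q k l : 0 <= k ^+ 2 * B x x + 2 * k * l * B x y + l ^+ 2 * B y y.
  have BlZ a u v : B (a *: u) v = a * B u v.
    have := Bl 1 0 0 v; rewrite scale1r addr0 => h.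
    have := Bl a u 0 v; rewrite addr0 => ->; nra.
  have := B0 (k *: x + l *: y).
  by rewrite Bl BlZ (BC x (_ + _)) (BC y (_ + _)) !Bl !BlZ (BC y x); nra.
have [By0|By0] := eqVneq (B y y) 0.
  have [->|Bxy0] := eqVneq (B x y) 0; first by rewrite By0 expr0n mulr0.
  (* Since [B y y = 0], the quadratic form at [x + l *: y] is affine in [l]; this [l] gives it the
     value -1. *)
  have := q 1 (- (B x x + 1) / (2 * B x y)).
  rewrite By0 (_ : _ + _ + _ = -1); last by field.
  by rewrite ler0N1.
have Byp : 0 < B y y by rewrite lt_def By0 B0.
(* Positivity at [B y y *: x - B x y *: y] is the claim multiplied by [B y y]. *)
have := q (B y y) (- B x y) => h.
by rewrite -(ler_pM2l Byp); nra.
Qed.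

(** The eigenvalue [l] is the supremum of [q] on the unit sphere. Then [l * dot - q] is positive
    semidefinite and tends to 0 on the diagonal along a maximizing sequence, hence, by
    Cauchy-Schwarz, also against bounded vectors. Compactness makes the sequence converge along an
    ultrafilter, and its limit lies in the kernel of [l * dot - q]. *)
Lemma compact_form_eigenvector (q : H -> H -> R) x0 :
  (forall x y, q x y = q y x) ->
  (forall k x y z, q (k *: x + y) z = k * q x z + q y z) ->
  finite_rank_approximable q -> 0 < q x0 x0 ->
  exists2 l, 0 < l & exists2 x, x != 0 & forall y, q x y = l * dot x y.
Proof.
move=> qC ql qa qx0.
have qlZ a u v : q (a *: u) v = a * q u v.
  have := ql 1 0 0 v; rewrite scale1r addr0 => h.
  have := ql a u 0 v; rewrite addr0 => ->; nra.
have [C C0 qC0] : exists2 C, 0 <= C & forall x y, `|q x y| <= C * (`|x| * `|y|).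
  have [w wq] := qa 1 ltr01.
  have [C C0 wC] := tensor_form_bound normH w.
  exists (1 + C) => [|x y]; first by rewrite addr_ge0.
  rewrite -[q x y](subrK (tensor_form dot w x y)) mulrDl.
  by rewrite (le_trans (ler_normD _ _))// lerD.
pose S := [set r | exists2 x, `|x| = 1 & r = q x x].
have x00 : 0 < `|x0|.
  rewrite normr_gt0; apply/eqP => x00; move: qx0.
  by rewrite -(scale0r x0) in x00; rewrite x00 qlZ mul0r ltxx.
pose u0 := `|x0|^-1 *: x0.
have u01 : `|u0| = 1.
  by rewrite normrZ gtr0_norm ?invr_gt0// mulVf// gt_eqF.
have Su0 : S (q u0 u0) by exists u0.
have qu0 : 0 < q u0 u0.
  by rewrite /u0 qlZ qC qlZ mulrA pmulr_rgt0// mulr_gt0// invr_gt0.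
have hS : has_sup S.
  split; first by exists (q u0 u0).
  exists C => _ [x x1 ->]; have := qC0 x x; rewrite x1 !mulr1.
  by apply: le_trans; exact: ler_norm.
pose l := sup S.
have l0 : 0 < l by apply: lt_le_trans qu0 _; apply: ub_le_sup => //; case: hS.
pose B x y := l * dot x y - q x y.
have BC x y : B x y = B y x by rewrite /B dotC qC.
have Bl k x y z : B (k *: x + y) z = k * B x z + B y z.
  by rewrite /B ql !dotE; ring.
have qle x : q x x <= l * `|x| ^+ 2.
  have [->|x0n] := eqVneq x 0.
    by rewrite -(scale0r 0) qlZ normrZ normr0 !mul0r expr0n mulr0.
  have xp : 0 < `|x| by rewrite normr_gt0.
  have : S (q (`|x|^-1 *: x) (`|x|^-1 *: x)).
    exists (`|x|^-1 *: x) => //.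
    by rewrite normrZ gtr0_norm ?invr_gt0// mulVf// gt_eqF.
  move=> /(ub_le_sup (proj2 hS)); rewrite -/l qlZ qC qlZ mulrA -expr2 exprVn.
  by rewrite mulrC ler_pdivrMr// exprn_gt0.
have B0 x : 0 <= B x x by rewrite /B -normH subr_ge0.
have /choice[y Hy] k : exists y, `|y| = 1 /\ B y y < k.+1%:R^-1.
  have kp : 0 < k.+1%:R^-1 :> R by [].
  have [_ [y y1 ->] yl] := sup_adherent kp hS.
  by exists y; split => //; rewrite /B -normH y1 expr1n mulr1 ltrBlDl -ltrBlDr.
have y1 k : `|y k| = 1 by case: (Hy k).
have Byk k : B (y k) (y k) < k.+1%:R^-1 by case: (Hy k).
have CB x z : `|B x z| <= (l + C) * (`|x| * `|z|).
  rewrite /B mulrDl (le_trans (ler_normB _ _))// lerD//.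
  by rewrite normrM gtr0_norm// ler_pM2l// dot_cauchy_schwarz.
(* The bound 2 is meant for differences of unit vectors. *)
have Bykz e : 0 < e -> exists N, forall k z, (N <= k)%N -> `|z| <= 2 ->
    `|B (y k) z| < e.
  move=> e0; have lCp : 0 < 4 * (l + C) by nra.
  have [N HN] := natSinv_lt (divr_gt0 (exprn_gt0 2 e0) lCp).
  exists N => k z Nk z2.
  rewrite -(@ltr_pXn2r _ 2)// ?nnegrE//; last exact: ltW.
  rewrite real_normK ?num_real//.
  apply: le_lt_trans (psd_cauchy_schwarz BC Bl B0 _ _) _.
  apply: (@le_lt_trans _ _ (k.+1%:R^-1 * (4 * (l + C)))).
    apply: ler_pM => //; first exact/ltW/Byk.
    apply: le_trans (ler_norm _) (le_trans (CB _ _) _).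
    rewrite mulrC ler_wpM2r//; first by lra.
    by rewrite (_ : 4 = 2 * 2) ?ler_pM//; ring.
  rewrite -ltr_pdivlMr//; apply: le_lt_trans HN.
  by rewrite lef_pV2 ?posrE// ler_nat ltnS.
have [U [UU ooU]] := @ultraFilterLemma nat \oo _.
have FU := ultra_proper (F := U).
(* Along the ultrafilter the finitely many products [dot p.2 (y k)] are Cauchy, and a finite-rank
   form sees nothing else. *)
have small w e : 0 < e -> exists2 S, U S & forall k l, S k -> S l ->
    `|tensor_form dot w (y k - y l) (y k - y l)| < e.
  elim: w e => [|p w IH] e e0.
    exists setT; first exact: filterT.
    by move=> *; rewrite /tensor_form big_nil normr0.
  have e20 : 0 < e / 2 by rewrite divr_gt0.
  have [S1 US1 HS1] := IH _ e20.
  pose d := Num.min 1 (e / 2 / (`|p.1| + 1)).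
  have p0 : 0 < `|p.1| + 1 by rewrite ltr_wpDl.
  have d0 : 0 < d by rewrite lt_min ltr01 divr_gt0.
  have [k|S2 US2 HS2] := @ultra_small R U (fun k => dot p.2 (y k)) `|p.2| d UU _ d0.
    by rewrite (le_trans (dot_cauchy_schwarz normH _ _))// y1 mulr1.
  exists (S1 `&` S2); first exact: filterI.
  move=> k m [k1 k2] [m1 m2]; rewrite /tensor_form big_cons -/(tensor_form _ _ _ _).
  rewrite (splitr e) (le_lt_trans (ler_normD _ _))// ltr_leD//; last exact/ltW/HS1.
  have := HS2 _ _ k2 m2; rewrite -dotNr -dotDr lt_min => /andP[h1 h2].
  rewrite !normrM; set t := `|dot _ _| in h1 h2 *.
  rewrite (@le_lt_trans _ _ ((`|p.1| + 1) * t))//; last by rewrite -ltr_pdivlMl// mulrC.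
  have t0 : 0 <= t by exact: normr_ge0.
  have : 0 <= `|p.1| * t * (1 - t) by rewrite !mulr_ge0// subr_ge0 ltW.
  by lra.
have cy : cvg (y @ U).
  apply/cauchy_cvgP/cauchy_exP => e e0 /=.
  (* In [zE] below, l |z|^2 is bounded by four errors of size [d]: two from [B], one from the
     approximation of [q] and one from the approximating form. Their sum 4 d is less than l e^2 = 8
     d. *)
  pose d := l * e ^+ 2 / 8.
  have d0 : 0 < d by rewrite divr_gt0// mulr_gt0// exprn_gt0.
  have [N HN] := Bykz d d0.
  have [w wq] := qa (d / 4) (divr_gt0 d0 (ltr0n _ 4)).
  have [S1 US1 HS1] := small w d d0.
  have US : U (S1 `&` [set k | (N <= k)%N]).
    by apply: filterI => //; apply: ooU; exists N.
  have [k0 [k01 k0N]] := filter_ex US.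
  exists (y k0); apply: filterS US => k [k1 kN] /=; rewrite -ball_normE /ball_ /=.
  set z := y k0 - y k.
  have z2 : `|z| <= 2 by rewrite (le_trans (ler_normB _ _))// !y1.
  have zE : l * `|z| ^+ 2 = B (y k0) z - B (y k) z + q z z.
    have BB u v t : B (u - v) t = B u t - B v t.
      by rewrite -scaleN1r addrC Bl; ring.
    rewrite -BB -/z.
    by rewrite normH /B; ring.
  have h1 := HN k0 z k0N z2.
  have h2 := HN k z kN z2.
  have h3 := HS1 _ _ k01 k1; rewrite -/z in h3.
  have h4 : `|q z z - tensor_form dot w z z| <= d.
    apply: le_trans (wq _ _) _.
    rewrite -[leRHS](divfK (_ : 4 != 0 :> R))// ler_wpM2l//; first by rewrite divr_ge0// ltW.
    by rewrite (_ : 4 = 2 * 2) ?ler_pM//; ring.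
  rewrite -(@ltr_pXn2r _ 2)// ?nnegrE//; last exact: ltW.
  rewrite -(ltr_pM2l l0) zE (_ : l * e ^+ 2 = 8 * d); last by rewrite /d; field.
  move: h1 h2 h3 h4; rewrite !ltr_norml ler_norml.
  by move=> /andP[? ?] /andP[? ?] /andP[? ?] /andP[? ?]; lra.
exists l => //; exists (lim (y @ U)).
  (* The limit is not 0 because every [y k] has norm 1. *)
  apply/eqP => y0; have /cvgrPdist_lt/(_ 1 ltr01) := cy.
  rewrite y0 => /filter_ex[k]; rewrite sub0r normrN y1.
  by rewrite ltxx.
set x := lim _ => z.
suff : B x z = 0 by rewrite /B => /subr0_eq.
have [->|z0] := eqVneq z 0.
  by rewrite BC; have := Bl 1 0 0 x; rewrite scale1r addr0; lra.
suff : `|B x z| <= 0 by rewrite normr_le0 => /eqP.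
apply/ler_addgt0Pr => e e0; rewrite add0r.
have zp : 0 < `|z| by rewrite normr_gt0.
have BZr a u v : B u (a *: v) = a * B u v.
  have := Bl 1 0 0 u; rewrite scale1r addr0 => h.
  by rewrite BC; have := Bl a v 0 u; rewrite addr0 => ->; rewrite (BC v); nra.
have [N HN] := Bykz (e / 2 / `|z|) (divr_gt0 (divr_gt0 e0 (ltr0n _ 2)) zp).
have d0 : 0 < e / 2 / ((l + C) * `|z|).
  by rewrite divr_gt0 ?divr_gt0// mulr_gt0//; lra.
have /cvgrPdist_lt/(_ _ d0) := cy.
move=> h; have : U ([set k | (N <= k)%N] `&` [set k | `|x - y k| < e / 2 / ((l + C) * `|z|)]).
  by apply: filterI => //; apply: ooU; exists N.
move=> /filter_ex[k [/= Nk xy]].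
have -> : B x z = B (x - y k) z + B (y k) z.
  by rewrite -{1}(subrK (y k) x) -[x - y k]scale1r Bl mul1r scale1r.
rewrite (splitr e) (le_trans (ler_normD _ _))// lerD//.
  rewrite (le_trans (CB _ _))// mulrCA -ler_pdivlMr; first exact: ltW.
  by rewrite mulr_gt0//; lra.
have := HN k (`|z|^-1 *: z) Nk _; rewrite BZr normrM normrZ gtr0_norm ?invr_gt0//.
rewrite mulVf ?gt_eqF// mulrC => /(_ (ler1n _ 2)).
by rewrite ltr_pM2r ?invr_gt0// => /ltW.
Qed.

(** Take a finite-rank form within [l / 2] of [q]. An eigenvector orthogonal to all its vectors
    would satisfy l |x|^2 <= (l / 2) |x|^2, so these vectors separate the points of the
    eigenspace. *)
Lemma eigenspace_orthonormal_basis (q : H -> H -> R) (l : R) : 0 < l ->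
  finite_rank_approximable q ->
  (forall k x y z, q (k *: x + y) z = k * q x z + q y z) ->
  let E := [set x | forall y, q x y = l * dot x y] in
  subspace E /\ exists n e, [/\ orthonormal dot n e, forall i, (i < n)%N -> E (e i) &
                  forall x, E x -> x = expansion dot n e x].
Proof.
move=> l0 qa ql E.
have sE : subspace E.
  split=> [y|k x y Ex Ey z].
    by have := ql 1 0 0 y; rewrite scale1r addr0 dot0l; lra.
  by rewrite ql Ex Ey !dotE; ring.
split => //.
have [w wq] := qa (l / 2) (divr_gt0 l0 (ltr0n _ 2)).
apply: (orthonormal_basis normH (N := size w) (w := fun i => (nth (0, 0) w i).2)) => //.
move=> x Ex x0; apply/eqP/negPn; rewrite -normr_eq0; apply/negP => xn0.
have := wq x x; rewrite /tensor_form (big_nth (0, 0)) big_mkord big1 => [|i _].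
  rewrite subr0 Ex -normH -expr2 normrM !gtr0_norm// ?exprn_even_gt0//.
  rewrite ler_pM2r ?exprn_even_gt0//; lra.
by rewrite dotC x0// mul0r mulr0.
Qed.

End compact_form.

(** * Orthogonal representations and their cocycles *)

Lemma le_natSinv_eq0 {R : realType} (a C : R) :
  (forall n : nat, `|a| <= C / n.+1%:R) -> a = 0.
Proof.
move=> aC; apply/eqP; rewrite -normr_le0; apply/ler_addgt0Pr => e e0.
have C0 : 0 <= C.
  by have := le_trans (normr_ge0 _) (aC 0%N); rewrite divr1.
have C1 : 0 < C + 1 by rewrite ltr_wpDl.
have [n Hn] := natSinv_lt (divr_gt0 e0 C1).
rewrite add0r (le_trans (aC n))//.
apply: (@le_trans _ _ ((C + 1) / n.+1%:R)).
  by rewrite ler_wpM2r ?invr_ge0// lerDl.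
by rewrite mulrC -ler_pdivlMr// ltW.
Qed.

Section representation.
Context {R : realType} {G : groupType} {H : completeNormedModType R}.
Context (dot : {dot H for idfun}) (normH : norm_from_dot dot).
Context (pi : G -> {linear H -> H}) (opi : orthogonal_representation dot pi).

Local Notation hs := (hs dot).
Local Notation form := (tensor_form dot).

Lemma rep1 x : pi 1%g x = x. Proof. by case: opi. Qed.

Lemma repM g h x : pi (g * h)%g x = pi g (pi h x). Proof. by case: opi. Qed.

Lemma rep_dot g x y : dot (pi g x) (pi g y) = dot x y. Proof. by case: opi. Qed.

Lemma repK g x : pi g^-1%g (pi g x) = x.
Proof. by rewrite -repM mulVg rep1. Qed.

Lemma repVK g x : pi g (pi g^-1%g x) = x.
Proof. by rewrite -repM mulgV rep1. Qed.

Lemma rep_dotl g x y : dot (pi g x) y = dot x (pi g^-1%g y).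
Proof. by rewrite -{1}(repVK g y) rep_dot. Qed.

Lemma rep_norm g x : `|pi g x| = `|x|.
Proof.
by apply/eqP; rewrite -(@eqrXn2 _ 2)// !normH rep_dot.
Qed.

(** Conjugation of the finite-rank operator by [pi g]. *)
Definition tensor_act g (w : seq (R * H)) := [seq (p.1, pi g p.2) | p <- w].

Lemma tensor_form_act g w x y :
  form (tensor_act g w) x y = form w (pi g^-1%g x) (pi g^-1%g y).
Proof. by rewrite /tensor_form big_map; apply: eq_bigr => p _; rewrite !rep_dotl. Qed.

Lemma hs_act g w w' : hs (tensor_act g w) (tensor_act g w') = hs w w'.
Proof.
rewrite /hs big_map; apply: eq_bigr => p _.
by rewrite tensor_form_act !repK.
Qed.

(** A convex hull of the orbit with midpoints only: they are all that the parallelogram identity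
    uses, and the limit is taken later, on the forms. *)
Inductive tensor_hull (w0 : seq (R * H)) : seq (R * H) -> Prop :=
| tensor_hull_base : tensor_hull w0 w0
| tensor_hull_act g w : tensor_hull w0 w -> tensor_hull w0 (tensor_act g w)
| tensor_hull_mid w w' : tensor_hull w0 w -> tensor_hull w0 w' ->
    tensor_hull w0 (tscale 2^-1 (w ++ w')).

(** The bound is a half-space condition. It is proved for all translates of [w] at once, so that the
    induction passes through [tensor_act]. It keeps the minimizer of the hull away from 0. *)
Lemma tensor_hull_lower_bound w0 C :
  (forall g, C <= hs (tensor_act g w0) w0) ->
  forall w, tensor_hull w0 w -> C <= hs w w0.
Proof.
move=> w0C w hw; suff : forall g, C <= hs (tensor_act g w) w0.
  move/(_ 1%g); rewrite (_ : tensor_act _ w = w)//.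
  by rewrite -[RHS]map_id; apply: eq_map => -[k x] /=; rewrite rep1.
elim: hw => [//|h {}w _ IH g|w1 w2 _ IH1 _ IH2 g].
  rewrite (_ : tensor_act g _ = tensor_act (g * h)%g w)//.
  by rewrite /tensor_act -map_comp; apply: eq_map => p /=; rewrite repM.
rewrite (_ : tensor_act _ _ =
    tscale 2^-1 (tensor_act g w1 ++ tensor_act g w2)); last first.
  rewrite /tensor_act /tscale -map_cat -!map_comp; exact: eq_map.
by rewrite hs_scalel hs_catl; have := IH1 g; have := IH2 g; lra.
Qed.

(** Parallelogram identity: the squared distance of [w] and [w'] is twice the sum of their squared
    norms minus four times that of their midpoint, which is at least [rho]. Two almost minimal
    elements are thus within [r] of each other, and so are their forms. *)
Lemma tensor_hull_close w0 rho r w w' :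
  (forall w, tensor_hull w0 w -> rho <= hs w w) -> 0 <= r ->
  tensor_hull w0 w -> tensor_hull w0 w' ->
  hs w w <= rho + r ^+ 2 / 4 -> hs w' w' <= rho + r ^+ 2 / 4 ->
  forall x y, `|form w x y - form w' x y| <= r * (`|x| * `|y|).
Proof.
move=> lb r0 hw hw' wr w'r x y.
rewrite -(@ler_pXn2r _ 2)// ?nnegrE ?mulr_ge0// real_normK ?num_real//.
have [_] := tensor_form_hs normH (w ++ tscale (-1) w') x y.
rewrite tensor_form_cat tensor_form_scale mulN1r => /le_trans; apply.
rewrite !exprMn ler_wpM2r ?mulr_ge0 ?sqr_ge0//.
have := lb _ (tensor_hull_mid hw hw').
rewrite !(hsE dot) (hsC dot w' w); lra.
Qed.

(** A minimizing sequence of the hull is Cauchy, and [q] is the limit of its forms. It is invariant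
    because conjugation by [pi g] preserves the hull and the norm, so that a translate of an almost
    minimal element is again almost minimal and hence close to it. *)
Lemma invariant_compact_form w0 C : 0 < C ->
  (forall g, C <= hs (tensor_act g w0) w0) ->
  exists q : H -> H -> R, [/\ forall x y, q x y = q y x,
    forall k x y z, q (k *: x + y) z = k * q x z + q y z,
    finite_rank_approximable dot q,
    forall g x y, q (pi g x) (pi g y) = q x y &
    C <= \sum_(p <- w0) p.1 * q p.2 p.2].
Proof.
move=> C0 w0C.
pose S := [set hs w w | w in tensor_hull w0].
have hS : has_inf S.
  split; first by exists (hs w0 w0), w0 => //; exact: tensor_hull_base.
  exists 0 => _ [w _ <-].
  by have [] := tensor_form_hs normH w 0 0.
pose rho := inf S.
have lb w : tensor_hull w0 w -> rho <= hs w w.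
  by move=> hw; apply: ge_inf; [case: hS|exists w].
pose r n : R := n.+1%:R^-1.
have r0 n : 0 < r n by rewrite /r invr_gt0.
have /choice[w Hw] n : exists w, tensor_hull w0 w /\ hs w w <= rho + r n ^+ 2 / 4.
  have e0 : 0 < r n ^+ 2 / 4 by rewrite divr_gt0 ?exprn_gt0.
  by have [_ [w hw <-] /ltW] := inf_adherent e0 hS; exists w.
have hw n : tensor_hull w0 (w n) by case: (Hw n).
have wr N n : (N <= n)%N -> hs (w n) (w n) <= rho + r N ^+ 2 / 4.
  move=> Nn; apply: (le_trans (proj2 (Hw n))).
  rewrite lerD2l ler_wpM2r// ler_pXn2r ?nnegrE ?(ltW (r0 _))//.
  by rewrite lef_pV2 ?posrE// ler_nat ltnS.
have /choice[q Hq] (p : H * H) : exists l, forall n,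
    `|l - form (w n) p.1 p.2| <= (`|p.1| * `|p.2|) / n.+1%:R.
  apply: cauchy_rate => N n m Nn Nm; rewrite mulrC.
  by apply: (tensor_hull_close lb (ltW (r0 N))) => //; exact: wr.
have {}Hq x y n : `|q (x, y) - form (w n) x y| <= (`|x| * `|y|) / n.+1%:R.
  exact: Hq (x, y) n.
exists (fun x y => q (x, y)); split.
- move=> x y; apply/eqP; rewrite -subr_eq0; apply/eqP.
  apply: (@le_natSinv_eq0 _ _ (2 * (`|x| * `|y|))) => n.
  have := Hq x y n; have := Hq y x n; rewrite (tensor_formC _ _ y x).
  rewrite (mulrC `|y|) -[2 * _ / _]mulrA.
  move: (_ / _) => t.
  by rewrite !ler_norml => /andP[? ?] /andP[? ?]; apply/andP; split; lra.
- move=> k x y z; apply/eqP; rewrite -subr_eq0; apply/eqP.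
  apply: (@le_natSinv_eq0 _ _ (`|k *: x + y| * `|z| +
    (`|k| * (`|x| * `|z|) + `|y| * `|z|))) => n.
  have -> : q (k *: x + y, z) - (k * q (x, z) + q (y, z)) =
      (q (k *: x + y, z) - form (w n) (k *: x + y) z) -
      (k * (q (x, z) - form (w n) x z) + (q (y, z) - form (w n) y z)).
    by rewrite tensor_form_linear; ring.
  rewrite !mulrDl (le_trans (ler_normB _ _))// lerD//.
  rewrite (le_trans (ler_normD _ _))// lerD//.
  by rewrite normrM -[leRHS]mulrA ler_wpM2l.
- move=> e e0; have [n /ltW Hn] := natSinv_lt e0.
  exists (w n) => x y; apply: le_trans (Hq x y n) _.
  by rewrite mulrC ler_wpM2r// mulr_ge0.
- move=> g x y; apply/eqP; rewrite -subr_eq0; apply/eqP.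
  apply: (@le_natSinv_eq0 _ _ (3 * (`|x| * `|y|))) => n.
  have h1 := Hq (pi g x) (pi g y) n; rewrite !rep_norm in h1.
  have h2 := Hq x y n.
  have h3 : `|form (w n) (pi g x) (pi g y) - form (w n) x y| <=
      r n * (`|x| * `|y|).
    have -> : form (w n) (pi g x) (pi g y) = form (tensor_act g^-1%g (w n)) x y.
      by rewrite tensor_form_act invgK.
    apply: (tensor_hull_close lb (ltW (r0 n))) => //.
    + exact: tensor_hull_act.
    + by rewrite hs_act; exact: wr.
    + exact: wr.
  rewrite /r mulrC in h3; rewrite -[3 * _ / _]mulrA.
  move: (_ / _) h1 h2 h3 => t.
  by rewrite !ler_norml => /andP[? ?] /andP[? ?] /andP[? ?];
    apply/andP; split; lra.
- apply/ler_addgt0Pr => e e0.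
  pose K := \sum_(p <- w0) `|p.1| * (`|p.2| * `|p.2|).
  have K1 : 0 < K + 1.
    by rewrite ltr_wpDl// sumr_ge0// => p _; rewrite !mulr_ge0.
  have [n Hn] := natSinv_lt (divr_gt0 e0 K1).
  apply: (le_trans (tensor_hull_lower_bound w0C (hw n))).
  rewrite hsC /hs -lerBlDl -sumrB.
  apply: (@le_trans _ _ (K / n.+1%:R)).
    rewrite /K mulr_suml; apply: ler_sum => p _; rewrite -mulrBr -mulrA.
    apply: le_trans (ler_norm _) _; rewrite normrM ler_wpM2l// distrC.
    exact: Hq.
  apply: (@le_trans _ _ ((K + 1) / n.+1%:R)).
    by rewrite ler_wpM2r// lerDl.
  by rewrite mulrC -ler_pdivlMr// ltW.
Qed.

Lemma subspace_linear_span n (v : 'I_n -> H) (V : set H) : subspace V ->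
  (forall i, V (v i)) -> linear_span v `<=` V.
Proof.
move=> [V0 VD] Vv _ [k ->]; apply: big_ind => //.
  by move=> x y Vx Vy; rewrite -[x]scale1r; exact: VD.
by move=> i _; rewrite -[_ *: _]addr0; exact: VD.
Qed.

(* The orbit of the finite-rank operator sum_(x in F) x (x) x under conjugation
   stays away from its orthogonal, so that the element of least Hilbert-Schmidt
   norm of its closed convex hull is a nonzero compact operator commuting with
   pi. *)
Lemma weakly_mixing_small (F : seq H) e :
  weakly_mixing_representation pi -> 0 < e ->
  exists g, forall x y, x \in F -> y \in F -> `|dot (pi g x) y| < e.
Proof.
move=> wm e0; apply: contrapT => /forallNP nsmall.
pose w0 := [seq (1 : R, x) | x <- F].
(* A pair [x], [y] that violates the conclusion for [g] contributes at least [e ^+ 2], and all other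
   terms are squares. *)
have w0C g : e ^+ 2 <= hs (tensor_act g w0) w0.
  have /existsNP[x /existsNP[y]] := nsmall g.
  move=> /not_implyP[xF /not_implyP[yF /negP]]; rewrite -leNgt => exy.
  rewrite /hs /tensor_act /w0 -map_comp big_map.
  have tE z : form w0 z z = \sum_(y <- F) dot y z ^+ 2.
    by rewrite /tensor_form big_map; apply: eq_bigr => p _; rewrite mul1r -expr2.
  rewrite (big_rem x)//= mul1r tE (big_rem y)//=.
  rewrite -addrA ler_wpDr//.
    rewrite addr_ge0// sumr_ge0// => z _; rewrite ?sqr_ge0// mul1r tE.
    by rewrite sumr_ge0// => ? _; rewrite sqr_ge0.
  by rewrite -[leRHS]real_normK ?num_real// (dotC dot y) ler_pXn2r ?nnegrE// ltW.
have [q [qC ql qa qpi qw0]] := invariant_compact_form (exprn_gt0 2 e0) w0C.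
have [x0 qx0] : exists x, 0 < q x x.
  apply: contrapT => /forallNP q0.
  suff : e ^+ 2 <= 0 by rewrite leNgt exprn_gt0.
  apply: le_trans qw0 _.
  rewrite /w0 big_map sumr_le0// => x _; rewrite mul1r leNgt; apply/negP.
  exact: q0.
have [l l0 [x x_neq0 Ex]] := compact_form_eigenvector normH qC ql qa qx0.
have [sE [n [v [_ Ev vE]]]] := eigenspace_orthonormal_basis normH l0 qa ql.
have : [set x | forall y, q x y = l * dot x y] = [set 0].
  (* The eigenspace is invariant because [q] and [dot] both are. *)
  apply: wm.
    split; [by case: sE|by case: sE|move=> g y Ey z].
    by rewrite -[z](repVK g) qpi Ey rep_dot.
  exists n, (fun i : 'I_n => v i); apply/seteqP; split.
    by move=> y /vE ->; exists (fun i => dot y (v i)).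
  by apply: subspace_linear_span => // i; exact: Ev.
move=> /seteqP[/(_ x Ex) /= x0E _].
by move: x_neq0; rewrite x0E eqxx.
Qed.

Context (c : G -> H) (cc : cocycle pi c).

(* The fixed point is the Chebyshev center of the orbit of 0. *)
Lemma bounded_cocycle_coboundary M : (forall g, `|c g| <= M) -> coboundary pi c.
Proof.
move=> cM.
pose S x := [set `|x - c g| ^+ 2 | g in [set: G]].
have S0 x : S x !=set0 by exists (`|x - c 1%g| ^+ 2), 1%g.
have hS x : has_sup (S x).
  split => //; exists ((`|x| + M) ^+ 2) => _ [g _ <-].
  have h := le_trans (ler_normB x (c g)) (lerD (lexx _) (cM g)).
  by rewrite ler_pXn2r ?nnegrE// (le_trans _ h).
pose r x := sup (S x).
have rS x g : `|x - c g| ^+ 2 <= r x.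
  by apply: ub_le_sup; [case: (hS x)|exists g].
have rle x C : (forall g, `|x - c g| ^+ 2 <= C) -> r x <= C.
  by move=> xC; apply: ge_sup => // _ [g _ <-].
pose I := [set r x | x in [set: H]].
have hI : has_inf I.
  split; first by exists (r 0), 0.
  by exists 0 => _ [x _ <-]; apply: le_trans (rS x 1%g); rewrite sqr_ge0.
pose rho := inf I.
have rhor x : rho <= r x by apply: ge_inf; [case: hI|exists x].
have close x y t : 0 <= t -> r x <= rho + t ^+ 2 / 4 -> r y <= rho + t ^+ 2 / 4 ->
    `|x - y| <= t.
  move=> t0 rx ry; rewrite -(@ler_pXn2r _ 2)// ?nnegrE//.
  (* The parallelogram identity at every point of the orbit: were two near-minimizers far apart,
     their midpoint would have too small a radius. *)
  have : r (2^-1 *: (x + y)) <= (r x + r y) / 2 - `|x - y| ^+ 2 / 4.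
    apply: rle => g; have := rS x g; have := rS y g.
    rewrite !(normB_sqr normH) normrZ exprMn (normD_sqr normH) !dotE.
    by rewrite ger0_norm ?invr_ge0//; lra.
  by have := rhor (2^-1 *: (x + y)); lra.
pose s n : R := n.+1%:R^-1.
have s0 n : 0 < s n by rewrite /s invr_gt0.
have /choice[u Hu] n : exists x, r x <= rho + s n ^+ 2 / 4.
  have e0 : 0 < s n ^+ 2 / 4 by rewrite divr_gt0 ?exprn_gt0.
  by have [_ [x _ <-] /ltW] := inf_adherent e0 hI; exists x.
have us N n : (N <= n)%N -> r (u n) <= rho + s N ^+ 2 / 4.
  move=> Nn; apply: (le_trans (Hu n)).
  rewrite lerD2l ler_wpM2r// ler_pXn2r ?nnegrE ?(ltW (s0 _))//.
  by rewrite lef_pV2 ?posrE// ler_nat ltnS.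
have [|xi Hxi] := @cauchy_rate R H u 1.
  move=> N n m Nn Nm; rewrite mul1r.
  by apply: close (ltW (s0 N)) _ _; exact: us.
(* The affine action permutes the points [c g], which form the orbit of 0, so moving the centre
   along it does not increase the radius. *)
have ralpha h x : r (pi h x + c h) <= r x.
  apply: rle => g; rewrite (_ : _ - c g = pi h (x - c (h^-1 * g)%g)).
    by rewrite rep_norm.
  have cg : c g = c h + pi h (c (h^-1 * g)%g) by rewrite -cc mulgA mulgV mul1g.
  by rewrite linearB /= cg opprD addrA addrK.
exists xi => h; apply/eqP; rewrite eq_sym subr_eq addrC eq_sym -subr_eq0 -normr_eq0.
apply/eqP; apply: (@le_natSinv_eq0 _ _ 3) => n; rewrite normr_id.
have h1 := Hxi n.
have h2 : `|(pi h (u n) + c h) - u n| <= s n.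
  by apply: close (ltW (s0 n)) _ (us _ _ (leqnn n)); rewrite (le_trans (ralpha h _))// us.
have h3 : `|pi h (xi - u n)| <= 1 / n.+1%:R by rewrite rep_norm.
have -> : pi h xi + c h - xi =
    pi h (xi - u n) + ((pi h (u n) + c h - u n) - (xi - u n)).
  rewrite linearB /= opprB (addrA _ (u n)) subrK -(addrA (pi h (u n))).
  by rewrite (addrA (pi h xi - _)) subrK addrA.
apply: le_trans (ler_normD _ _) _.
apply: le_trans (lerD h3 (ler_normB _ _)) _.
apply: le_trans (lerD (lexx _) (lerD h2 h1)) _.
by rewrite /s !mul1r; move: (_^-1) => t; lra.
Qed.

(** Suppose |c| <= M at every element that makes the products over [F] small. Given [h], choose [g]
    for [F] together with its image under [pi h]: then [g] and [g * h] are both such elements, and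
    [pi g (c h) = c (g * h) - c g] gives |c h| <= 2 M. So [c] would be bounded. *)
Lemma weakly_mixing_small_unbounded (F : seq H) e M :
  weakly_mixing_representation pi -> ~ coboundary pi c -> 0 < e ->
  exists g, (forall x y, x \in F -> y \in F -> `|dot (pi g x) y| < e) /\
    M < `|c g|.
Proof.
move=> wm ncb e0; apply: contrapT => /forallNP nex; apply: ncb.
have small g : (forall x y, x \in F -> y \in F -> `|dot (pi g x) y| < e) ->
    `|c g| <= M.
  by move=> gF; rewrite leNgt; apply/negP => Mg; apply: (nex g).
apply: (@bounded_cocycle_coboundary (2 * M)) => h.
have [g gF] := weakly_mixing_small (F ++ map (pi h) F) wm e0.
have h1 : `|c g| <= M.
  by apply: small => x y xF yF; apply: gF; rewrite mem_cat ?xF ?yF.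
have h2 : `|c (g * h)%g| <= M.
  apply: small => x y xF yF; rewrite repM; apply: gF; rewrite mem_cat ?yF//.
  by rewrite map_f ?orbT.
rewrite -(rep_norm g) (_ : pi g (c h) = c (g * h)%g - c g); last first.
  by rewrite cc addrC addKr.
by rewrite (le_trans (ler_normB _ _))//; lra.
Qed.

End representation.

(** * Means of bounded functions *)

Section bounded_measurable.
Context d {X : measurableType d} {R : realType}.

(** The bound holds at every point. Such functions form an algebra and are integrable for every
    probability, so that means can be handled as real numbers. *)
Definition bounded_measurable (f : X -> R) :=
  measurable_fun setT f /\ exists M, forall x, `|f x| <= M.

Lemma bounded_measurable_cst k : bounded_measurable (fun=> k).
Proof. by split => //; exists `|k|. Qed.

Lemma bounded_measurableD f g : bounded_measurable f -> bounded_measurable g ->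
  bounded_measurable (fun x => f x + g x).
Proof.
move=> [mf [M fM]] [mg [N gN]]; split; first exact: measurable_funD.
by exists (M + N) => x; rewrite (le_trans (ler_normD _ _))// lerD.
Qed.

Lemma bounded_measurableM f g : bounded_measurable f -> bounded_measurable g ->
  bounded_measurable (fun x => f x * g x).
Proof.
move=> [mf [M fM]] [mg [N gN]]; split; first exact: measurable_funM.
by exists (M * N) => x; rewrite normrM ler_pM.
Qed.

Lemma bounded_measurableZ k f : bounded_measurable f ->
  bounded_measurable (fun x => k * f x).
Proof. by move=> ?; apply: bounded_measurableM => //; exact: bounded_measurable_cst. Qed.

Lemma bounded_measurableN f : bounded_measurable f ->
  bounded_measurable (fun x => - f x).
Proof.
move=> /(bounded_measurableZ (-1)).
by rewrite (_ : (fun x => -1 * f x) = fun x => - f x)//; apply/funext => x; rewrite mulN1r.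
Qed.

Lemma bounded_measurableB f g : bounded_measurable f -> bounded_measurable g ->
  bounded_measurable (fun x => f x - g x).
Proof. by move=> bf /bounded_measurableN; exact: bounded_measurableD. Qed.

Lemma bounded_measurable_sum n (f : 'I_n -> X -> R) :
  (forall i, bounded_measurable (f i)) ->
  bounded_measurable (fun x => \sum_(i < n) f i x).
Proof.
elim: n f => [|n IH] f bf.
  by under eq_fun do rewrite big_ord0; exact: bounded_measurable_cst.
by under eq_fun do rewrite big_ord_recr; apply: bounded_measurableD => //; exact: IH.
Qed.

Lemma bounded_measurableX f n : bounded_measurable f ->
  bounded_measurable (fun x => f x ^+ n).
Proof.
move=> bf; elim: n => [|n IH]; first exact: bounded_measurable_cst.
by under eq_fun do rewrite exprS; exact: bounded_measurableM.
Qed.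

Lemma bounded_measurable_norm f : bounded_measurable f ->
  bounded_measurable (fun x => `|f x|).
Proof.
move=> [mf [M fM]]; split; first exact: measurableT_comp.
by exists M => x; rewrite normr_id.
Qed.

Lemma bounded_measurable_indic A : measurable A -> bounded_measurable (\1_A : X -> R).
Proof.
move=> mA; split; first exact: measurable_indic.
by exists 1 => x; rewrite indicE; case: (_ \in _); rewrite ?normr1 ?normr0.
Qed.

(** The conclusion is [bounded_measurable] on [X'], spelled out because inside the section that
    notion is tied to [X]. *)
Lemma bounded_measurable_comp d' (X' : measurableType d') (u : X' -> X) f :
  measurable_fun setT u -> bounded_measurable f ->
  measurable_fun setT (f \o u) /\ exists M, forall x, `|(f \o u) x| <= M.
Proof.
move=> mu [mf [M fM]]; split; first exact: measurableT_comp.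
by exists M => x; exact: fM.
Qed.

Context (P : probability X R).

Lemma bounded_measurable_integrable f : bounded_measurable f ->
  P.-integrable setT (EFin \o f).
Proof.
move=> [mf [M fM]]; apply: measurable_bounded_integrable => //.
  by rewrite ltey_eq fin_num_measure.
by exists M; split; [exact: num_real|move=> r Mr x _; exact: le_trans (fM x) (ltW Mr)].
Qed.
Local Notation bmi := bounded_measurable_integrable.

Lemma mean_cst k : \int[P]_x k = k.
Proof. by rewrite Rintegral_cst// [X in fine X](probability_setT P) mulr1. Qed.

Lemma meanD f g : bounded_measurable f -> bounded_measurable g ->
  \int[P]_x (f x + g x) = \int[P]_x f x + \int[P]_x g x.
Proof. by move=> bf bg; rewrite RintegralD//; exact: bmi. Qed.

Lemma meanB f g : bounded_measurable f -> bounded_measurable g ->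
  \int[P]_x (f x - g x) = \int[P]_x f x - \int[P]_x g x.
Proof. by move=> bf bg; rewrite RintegralB//; exact: bmi. Qed.

Lemma meanZ k f : bounded_measurable f ->
  \int[P]_x (k * f x) = k * \int[P]_x f x.
Proof. by move=> bf; rewrite RintegralZl//; exact: bmi. Qed.

Lemma mean_sum n (f : 'I_n -> X -> R) : (forall i, bounded_measurable (f i)) ->
  \int[P]_x (\sum_(i < n) f i x) = \sum_(i < n) \int[P]_x f i x.
Proof.
elim: n f => [|n IH] f bf.
  rewrite big_ord0 -[RHS](mean_cst 0); apply: eq_Rintegral => x _.
  by rewrite big_ord0.
rewrite big_ord_recr /= -IH// -meanD//; last exact: bounded_measurable_sum.
by apply: eq_Rintegral => x _; rewrite big_ord_recr.
Qed.

Lemma le_mean f g : bounded_measurable f -> bounded_measurable g ->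
  (forall x, f x <= g x) -> \int[P]_x f x <= \int[P]_x g x.
Proof. by move=> bf bg fg; apply: le_Rintegral => //; exact: bmi. Qed.

Lemma mean_ge0 f : (forall x, 0 <= f x) -> 0 <= \int[P]_x f x.
Proof. by move=> f0; exact: Rintegral_ge0. Qed.

Lemma norm_mean_le f : bounded_measurable f ->
  `|\int[P]_x f x| <= \int[P]_x `|f x|.
Proof. by move=> bf; apply: le_normr_Rintegral => //; exact: bmi. Qed.

Lemma norm_mean_le_cst f M : bounded_measurable f -> (forall x, `|f x| <= M) ->
  `|\int[P]_x f x| <= M.
Proof.
move=> bf fM; rewrite (le_trans (norm_mean_le bf))// -[leRHS]mean_cst.
apply: le_mean => //; first exact: bounded_measurable_norm.
exact: bounded_measurable_cst.
Qed.

Lemma ae_eq_mean f g : bounded_measurable f -> bounded_measurable g ->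
  {ae P, forall x, f x = g x} -> \int[P]_x f x = \int[P]_x g x.
Proof.
move=> [mf _] [mg _] fg; congr fine; apply: ae_eq_integral => //.
- exact/measurable_EFinP.
- exact/measurable_EFinP.
- by apply: filterS fg => x -> _.
Qed.

Lemma mean_indic A : measurable A -> \int[P]_x \1_A x = fine (P A).
Proof. by move=> mA; rewrite /Rintegral integral_indic// setIT. Qed.

Lemma cvg_mean (f : nat -> X -> R) (g : X -> R) (M : R) :
  (forall n, measurable_fun setT (f n)) -> measurable_fun setT g ->
  (forall n x, `|f n x| <= M) -> (forall x, f n x @[n --> \oo] --> g x) ->
  \int[P]_x f n x @[n --> \oo] --> \int[P]_x g x.
Proof.
move=> mf mg fM fg; apply: fine_cvg.
have gM x : `|g x| <= M.
  have /cvg_norm cg := fg x.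
  rewrite -(cvg_lim _ cg)//; apply: limr_le; last exact: nearW.
  by apply/cvg_ex; exists (`|g x|).
rewrite /Rintegral fineK; last first.
  by apply: integrable_fin_num => //; apply: bmi; split => //; exists M.
have [|||||_ _] // := @dominated_convergence _ _ R P setT measurableT
    (fun n => EFin \o f n) (EFin \o g) (EFin \o cst M).
- by move=> n; exact/measurable_EFinP.
- exact/measurable_EFinP.
- by apply/aeW => x _; apply: cvg_EFin; [exact: nearW|exact: fg].
- by apply: bmi; exact: bounded_measurable_cst.
- by apply/aeW => x n _; rewrite lee_fin.
Qed.

(** Nonnegativity of the variance. *)
Lemma mean_sqr_le f : bounded_measurable f ->
  (\int[P]_x f x) ^+ 2 <= \int[P]_x f x ^+ 2.
Proof.
move=> bf; set m := \int[P]_x f x.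
have : 0 <= \int[P]_x (f x - m) ^+ 2 by apply: mean_ge0 => x; exact: sqr_ge0.
under eq_Rintegral do rewrite sqrrB -mulr_natr.
rewrite meanD; [|apply: bounded_measurableB|exact: bounded_measurable_cst].
- rewrite meanB; [|exact: bounded_measurableX|].
  + under [X in _ <= _ - X + _ -> _]eq_Rintegral do rewrite -mulrA mulrC.
    by rewrite meanZ// mean_cst -/m; lra.
  + do 2 (apply: bounded_measurableM; last exact: bounded_measurable_cst).
    exact: bf.
- exact: bounded_measurableX.
- do 2 (apply: bounded_measurableM; last exact: bounded_measurable_cst).
  exact: bf.
Qed.

End bounded_measurable.

(** * Image measures and product measures *)

Section image_measure.
Context d {X : measurableType d} d' {Y : measurableType d'} {R : realType}.
Context (P : probability X R) (Q : probability Y R) (u : X -> Y).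
Context (mu : measurable_fun setT u)
  (Pu : forall A, measurable A -> P (u @^-1` A) = Q A).

Lemma mean_comp f : bounded_measurable f ->
  \int[P]_x f (u x) = \int[Q]_y f y.
Proof.
move=> bf; congr fine.
have [mfu fuM] := bounded_measurable_comp mu bf.
rewrite [RHS](_ : _ = \int[pushforward P u]_y (f y)%:E)%E; last first.
  by apply: eq_measure_integral => A mA _; exact/esym/Pu.
rewrite integral_pushforward//=.
- by apply/measurable_EFinP; case: bf.
- by rewrite preimage_setT; apply: bounded_measurable_integrable.
Qed.

Lemma ae_comp (p : Y -> Prop) : {ae Q, forall y, p y} -> {ae P, forall x, p (u x)}.
Proof.
move=> [N [mN N0 pN]]; exists (u @^-1` N); split.
- by rewrite -[_ @^-1` _]setTI; exact: mu.
- by apply: etrans N0; exact: Pu.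
- by move=> x /= px; exact: pN.
Qed.

End image_measure.

Section product.
Context d {X : measurableType d} d' {Y : measurableType d'} {R : realType}.
Context (P : probability X R) (Q : probability Y R).

Lemma product_fst A : measurable A -> (P \x Q)%E (fst @^-1` A) = P A.
Proof.
move=> mA; rewrite (_ : _ @^-1` _ = A `*` setT); last by apply/seteqP; split => -[x y] /=; tauto.
by rewrite product_measure1E// [X in (_ * X)%E](probability_setT Q) mule1.
Qed.

Lemma bounded_measurable_fubini1 (f : X * Y -> R) : bounded_measurable f ->
  bounded_measurable (fun x => \int[Q]_y f (x, y)).
Proof.
move=> bf; have [mf [M fM]] := bf; split; last first.
  exists M => x; apply: norm_mean_le_cst => //; split; last by exists M.
  exact: measurableT_comp.
apply: measurableT_comp => //; apply: (@measurable_fubini_F _ _ _ _ _ P Q (EFin \o f)).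
exact: (bounded_measurable_integrable (P \x Q)%E).
Qed.

Lemma bounded_measurable_fubini2 (f : X * Y -> R) : bounded_measurable f ->
  bounded_measurable (fun y => \int[P]_x f (x, y)).
Proof.
move=> bf; have [mf [M fM]] := bf; split; last first.
  exists M => x; apply: norm_mean_le_cst => //; split; last by exists M.
  exact: measurableT_comp.
apply: measurableT_comp => //; apply: (@measurable_fubini_G _ _ _ _ _ P Q (EFin \o f)).
exact: (bounded_measurable_integrable (P \x Q)%E).
Qed.

Lemma mean_fubini1 (f : X * Y -> R) : bounded_measurable f ->
  \int[(P \x Q)%E]_z f z = \int[P]_x \int[Q]_y f (x, y).
Proof.
move=> bf; have [mf [M fM]] := bf; congr fine.
rewrite -(@integral12_prod_meas1 _ _ _ _ _ P Q (EFin \o f)).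
  apply: eq_integral => x _; rewrite fineK//; apply: integrable_fin_num => //.
  apply: bounded_measurable_integrable; split; last by exists M.
  exact: measurableT_comp.
exact: (bounded_measurable_integrable (P \x Q)%E).
Qed.

Lemma mean_fubini2 (f : X * Y -> R) : bounded_measurable f ->
  \int[(P \x Q)%E]_z f z = \int[Q]_y \int[P]_x f (x, y).
Proof.
move=> bf; have [mf [M fM]] := bf; congr fine.
rewrite -(@integral21_prod_meas1 _ _ _ _ _ P Q (EFin \o f)).
  apply: eq_integral => x _; rewrite fineK//; apply: integrable_fin_num => //.
  apply: bounded_measurable_integrable; split; last by exists M.
  exact: measurableT_comp.
exact: (bounded_measurable_integrable (P \x Q)%E).
Qed.

Lemma mean_prod (f : X -> R) (g : Y -> R) : bounded_measurable f ->
  bounded_measurable g ->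
  \int[(P \x Q)%E]_z (f z.1 * g z.2) = (\int[P]_x f x) * \int[Q]_y g y.
Proof.
move=> bf bg; rewrite mean_fubini1.
  transitivity (\int[P]_x ((\int[Q]_y g y) * f x)).
    by apply: eq_Rintegral => x _; rewrite mulrC -meanZ.
  by rewrite meanZ// mulrC.
apply: bounded_measurableM.
  exact: (bounded_measurable_comp measurable_fst bf).
exact: (bounded_measurable_comp measurable_snd bg).
Qed.

End product.

Lemma cvg_natSinv {R : realType} (u : nat -> R) l N :
  (forall n, (N <= n)%N -> `|u n - l| <= n.+1%:R^-1) -> u n @[n --> \oo] --> l.
Proof.
move=> ul; apply/cvgrPdist_lt => e e0.
have [M HM] := natSinv_lt e0.
exists (maxn N M) => // n /=; rewrite geq_max => /andP[Nn Mn].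
rewrite distrC (le_lt_trans (ul n Nn))//; apply: le_lt_trans HM.
by rewrite lef_pV2 ?posrE// ler_nat ltnS.
Qed.

(** * The L2-closure of an algebra of bounded functions *)

Section closed_algebra.
Context d {X : measurableType d} {R : realType} (P : probability X R).
Context (A : set (X -> R)).
Context (A_bm : forall f, A f -> bounded_measurable f)
  (A_cst : forall k, exists2 h, A h & {ae P, forall x, k = h x})
  (A_lin : forall (k : R) f g, A f -> A g -> A (fun x => k * f x + g x))
  (A_mul : forall f g, A f -> A g ->
     exists2 h, A h & {ae P, forall x, f x * g x = h x}).

(** Constants and products are only required to agree almost everywhere with elements of [A],
    because the Gaussian variables are linear only up to null sets; the L2-closure does not see the
    difference. *)
Definition L2_approximable (f : X -> R) := bounded_measurable f /\
  forall e, 0 < e -> exists2 p, A p & \int[P]_x (f x - p x) ^+ 2 < e.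

Lemma L2_approximable_closed f : bounded_measurable f ->
  (forall e, 0 < e -> exists2 g, L2_approximable g &
     \int[P]_x (f x - g x) ^+ 2 < e) -> L2_approximable f.
Proof.
move=> bf fg; split => // e e0.
have e4 : 0 < e / 4 by rewrite divr_gt0.
have [g [bg gA] fge] := fg _ e4.
have [p Ap gpe] := gA _ e4.
exists p => //.
have bp := A_bm Ap.
have b1 : bounded_measurable (fun x => (f x - g x) ^+ 2).
  by apply: bounded_measurableX; exact: bounded_measurableB.
have b2 : bounded_measurable (fun x => (g x - p x) ^+ 2).
  by apply: bounded_measurableX; exact: bounded_measurableB.
apply: (@le_lt_trans _ _ (\int[P]_x (2 * (f x - g x) ^+ 2 + 2 * (g x - p x) ^+ 2))).
  apply: le_mean.
  - by apply: bounded_measurableX; exact: bounded_measurableB.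
  - by apply: bounded_measurableD; exact: bounded_measurableZ.
  - move=> x; rewrite (_ : f x - p x = (f x - g x) + (g x - p x)); last by ring.
    by move: (f x - g x) (g x - p x) => u v; have := sqr_ge0 (u - v); nra.
rewrite meanD; [|exact: bounded_measurableZ..].
by rewrite !meanZ//; lra.
Qed.

Lemma L2_approximable_base f : A f -> L2_approximable f.
Proof.
move=> Af; split => [|e e0]; first exact: A_bm.
exists f => //; under eq_Rintegral do rewrite subrr expr0n.
by rewrite mean_cst.
Qed.

Lemma L2_approximable_ae f g : bounded_measurable f -> L2_approximable g ->
  {ae P, forall x, f x = g x} -> L2_approximable f.
Proof.
move=> bf ag fg; apply: L2_approximable_closed => // e e0; exists g => //.
have [bg _] := ag.
rewrite (@ae_eq_mean _ _ _ _ _ (fun=> 0)) ?mean_cst//.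
- by apply: bounded_measurableX; exact: bounded_measurableB.
- exact: bounded_measurable_cst.
- by apply: filterS fg => x ->; rewrite subrr expr0n.
Qed.

(** Dominated convergence. Exponentials, indicators of sublevel sets and countable unions are all
    reached through this closure under bounded pointwise limits. *)
Lemma L2_approximable_lim (f : nat -> X -> R) (g : X -> R) (M : R) :
  (forall n, L2_approximable (f n)) -> (forall n x, `|f n x| <= M) ->
  (forall x, f n x @[n --> \oo] --> g x) -> L2_approximable g.
Proof.
move=> af fM fg.
have mf n : measurable_fun setT (f n) by case: (af n) => -[].
have mg : measurable_fun setT g.
  by apply: (measurable_fun_cvg mf) => x _; exact: fg.
have gM x : `|g x| <= M.
  have /cvg_norm cg := fg x.
  rewrite -(cvg_lim _ cg)//; apply: limr_le; last exact: nearW.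
  by apply/cvg_ex; exists (`|g x|).
have bg : bounded_measurable g by split => //; exists M.
apply: L2_approximable_closed => // e e0.
have : \int[P]_x (g x - f n x) ^+ 2 @[n --> \oo] --> \int[P]_x (cst 0 x : R).
  apply: (@cvg_mean _ _ _ P (fun n x => (g x - f n x) ^+ 2) (cst 0) ((M + M) ^+ 2)).
  - by move=> n; apply: measurable_funX; exact: measurable_funB.
  - exact: measurable_cst.
  - move=> n x; rewrite normrX.
    have h : `|g x - f n x| <= M + M by rewrite (le_trans (ler_normB _ _))// lerD.
    by rewrite ler_pXn2r ?nnegrE// (le_trans _ h).
  - move=> x; have h : g x - f n x @[n --> \oo] --> (0 : R).
      by rewrite -(subrr (g x)); apply: cvgB; [exact: cvg_cst|exact: fg].
    by have := cvgM h h; rewrite mulr0; exact.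
rewrite mean_cst => /cvgrPdist_lt/(_ e e0)[N _ HN].
exists (f N) => //; have := HN N (leqnn N); rewrite sub0r normrN; apply: le_lt_trans.
exact: ler_norm.
Qed.

Lemma L2_approximable_cst k : L2_approximable (fun=> k).
Proof.
have [h Ah kh] := A_cst k.
apply: L2_approximable_ae kh; last exact: L2_approximable_base.
exact: bounded_measurable_cst.
Qed.

Lemma L2_approximable_lin k f g : L2_approximable f -> L2_approximable g ->
  L2_approximable (fun x => k * f x + g x).
Proof.
move=> [bf af] [bg ag]; split.
  by apply: bounded_measurableD => //; exact: bounded_measurableZ.
move=> e e0.
have k0 : 0 < 4 * k ^+ 2 + 4 by have := sqr_ge0 k; lra.
have e' : 0 < e / (4 * k ^+ 2 + 4) by rewrite divr_gt0.
have [p Ap fp] := af _ e'.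
have [q Aq gq] := ag _ e'.
exists (fun x => k * p x + q x); first exact: A_lin.
have [bp bq] := (A_bm Ap, A_bm Aq).
have b1 : bounded_measurable (fun x => (f x - p x) ^+ 2).
  by apply: bounded_measurableX; exact: bounded_measurableB.
have b2 : bounded_measurable (fun x => (g x - q x) ^+ 2).
  by apply: bounded_measurableX; exact: bounded_measurableB.
apply: (@le_lt_trans _ _ (\int[P]_x ((2 * k ^+ 2) * (f x - p x) ^+ 2 + 2 * (g x - q x) ^+ 2))).
  apply: le_mean.
  - apply: bounded_measurableX; apply: bounded_measurableB;
      by apply: bounded_measurableD => //; exact: bounded_measurableZ.
  - by apply: bounded_measurableD; exact: bounded_measurableZ.
  - move=> x; rewrite (_ : _ - _ = k * (f x - p x) + (g x - q x)); last by ring.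
    by move: (f x - p x) (g x - q x) => u v; have := sqr_ge0 (k * u - v); nra.
rewrite meanD; [|exact: bounded_measurableZ..].
rewrite !meanZ//.
set s := e / _ in fp gq; have eE : e = s * (4 * k ^+ 2 + 4) by rewrite /s divfK// gt_eqF.
have := sqr_ge0 k; move: fp gq; set u := \int[P]_x _; set v := \int[P]_x _.
move=> us vs k2; rewrite eE; nra.
Qed.

Lemma L2_approximableZ k f : L2_approximable f -> L2_approximable (fun x => k * f x).
Proof.
move=> af; have := L2_approximable_lin k af (L2_approximable_cst 0).
by under eq_fun do rewrite addr0.
Qed.

Lemma L2_approximableD f g : L2_approximable f -> L2_approximable g ->
  L2_approximable (fun x => f x + g x).
Proof.
by move=> af ag; have := L2_approximable_lin 1 af ag; under eq_fun do rewrite mul1r.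
Qed.

(** Here [main] reduces a product to the case where the first factor is in [A], the second being
    merely bounded. It is applied once to each factor, which leaves a product of two elements of
    [A]. *)
Lemma L2_approximableM f g : L2_approximable f -> L2_approximable g ->
  L2_approximable (fun x => f x * g x).
Proof.
have main f1 g1 : L2_approximable f1 -> bounded_measurable g1 ->
    (forall p, A p -> L2_approximable (fun x => p x * g1 x)) ->
    L2_approximable (fun x => f1 x * g1 x).
  move=> [bf af] bg pg; apply: L2_approximable_closed.
    exact: bounded_measurableM.
  have [mg [M gM]] := bg.
  (* Adding 1 makes a divisor of [M ^+ 2], which may be 0. *)
  move=> e e0; have M0 : 0 < M ^+ 2 + 1 by rewrite ltr_wpDl// sqr_ge0.
  have [p Ap fp] := af _ (divr_gt0 e0 M0).
  exists (fun x => p x * g1 x); first exact: pg.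
  have bp := A_bm Ap.
  have b1 : bounded_measurable (fun x => (f1 x - p x) ^+ 2).
    by apply: bounded_measurableX; exact: bounded_measurableB.
  apply: (@le_lt_trans _ _ (\int[P]_x ((M ^+ 2 + 1) * (f1 x - p x) ^+ 2))).
    apply: le_mean.
    + by apply: bounded_measurableX; apply: bounded_measurableB; exact: bounded_measurableM.
    + exact: bounded_measurableZ.
    + move=> x; rewrite -mulrBl exprMn mulrC ler_wpM2r ?sqr_ge0//.
      have gx := gM x; have Mge0 : 0 <= M by exact: le_trans (normr_ge0 _) gx.
      have : `|g1 x| ^+ 2 <= M ^+ 2 by rewrite ler_pXn2r ?nnegrE.
      by rewrite real_normK ?num_real//; lra.
  by rewrite meanZ// mulrC -ltr_pdivlMr.
move=> af ag; apply: (main f g) => //; first by case: ag.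
move=> p Ap; under eq_fun do rewrite mulrC.
apply: (main g p) => //; first exact: A_bm.
move=> q Aq; have [h Ah qph] := A_mul Aq Ap.
apply: L2_approximable_ae qph; last exact: L2_approximable_base.
by apply: bounded_measurableM; exact: A_bm.
Qed.

Lemma L2_approximableX f n : L2_approximable f ->
  L2_approximable (fun x => f x ^+ n).
Proof.
move=> af; elim: n => [|n IH]; first exact: L2_approximable_cst.
by under eq_fun do rewrite exprS; exact: L2_approximableM.
Qed.

(** The partial sums of the exponential series are polynomials in [f], uniformly bounded because [f]
    is. *)
Lemma L2_approximable_expR f : L2_approximable f ->
  L2_approximable (fun x => expR (f x)).
Proof.
move=> af; have [[mf [M fM]] _] := af.
apply: (@L2_approximable_lim (fun n x => series (exp_coeff (f x)) n) _ (expR `|M|)).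
- elim=> [|n IH].
    under eq_fun do rewrite /series /= big_geq//; exact: L2_approximable_cst.
  under eq_fun do rewrite seriesSr; apply: L2_approximableD => //.
  rewrite /exp_coeff /=; under eq_fun do rewrite mulrC.
  by apply: L2_approximableZ; exact: L2_approximableX.
- move=> n x; apply: (@le_trans _ _ (series (exp_coeff `|M|) n)).
    rewrite /series /=; apply: le_trans (ler_norm_sum _ _ _) _.
    apply: ler_sum => i _; rewrite /exp_coeff /= normrM normrX normfV.
    rewrite [`|_%:R|]ger0_norm// ler_wpM2r ?invr_ge0//.
    by rewrite lerXn2r ?nnegrE// (le_trans (fM x))// ler_norm.
  apply: nondecreasing_cvgn_le; last exact: is_cvg_series_exp_coeff.
  apply/nondecreasing_seqP => k; rewrite seriesSr lerDl.
  exact: exp_coeff_ge0.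
- by move=> x; exact: is_cvg_series_exp_coeff.
Qed.

(* exp (- exp (n (n t + 1))) tends to the indicator of t < 0. *)
Lemma L2_approximable_lt0 f : L2_approximable f ->
  L2_approximable (\1_[set x | f x < 0]).
Proof.
move=> af.
pose v n x := n%:R * (n%:R * f x + 1).
have av n : L2_approximable (v n).
  apply: L2_approximableZ; apply: L2_approximableD; last exact: L2_approximable_cst.
  exact: L2_approximableZ.
apply: (@L2_approximable_lim (fun n x => expR (- expR (v n x))) _ 1).
- move=> n; apply: L2_approximable_expR; under eq_fun do rewrite -mulN1r.
  by apply: L2_approximableZ; exact: L2_approximable_expR.
- by move=> n x; rewrite ger0_norm ?expR_ge0// -[leRHS]expR0 ler_expR oppr_le0 ?expR_ge0.
have expN (t : R) n : n%:R <= t -> expR (- t) <= n.+1%:R^-1.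
  move=> nt; rewrite expRN lef_pV2 ?posrE ?expR_gt0//.
  by apply: le_trans (expR_ge1Dx t); rewrite -natr1 addrC lerD2l.
move=> x; rewrite indicE; have [fx|fx] := ltP (f x) 0.
- rewrite mem_set//=.
  (* From this [N] on, [n%:R * f x + 1 <= -1], hence [v n x <= - n%:R]. *)
  have [N HN] : exists N : nat, 2 / - f x <= N%:R.
    exists (Num.trunc (2 / - f x)).+1; apply: ltW; exact: truncnS_gt.
  apply: (@cvg_natSinv _ _ _ N) => n Nn.
  have n2 : n%:R * f x + 1 <= -1.
    have : 2 <= n%:R * - f x.
      by rewrite -ler_pdivrMr ?oppr_gt0// (le_trans HN)// ler_nat.
    lra.
  have vn : v n x <= - n%:R.
    by rewrite /v; have : 0 <= n%:R :> R by []; nra.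
  have := @expN (- v n x) n; rewrite opprK lerNr => /(_ vn) => h.
  have := expR_ge1Dx (- expR (v n x)); have := expR_ge0 (v n x) => h1 h2.
  rewrite ler0_norm; last by rewrite subr_le0 -[leRHS]expR0 ler_expR oppr_le0.
  by move: (n.+1%:R^-1) h h1 => t; lra.
(* The summand 1 in [v] is for the boundary case: [v n x >= n%:R] even where [f x = 0]. *)
- rewrite memNset/=; last by move=> /=; rewrite ltNge fx.
  apply: (@cvg_natSinv _ _ _ 0%N) => n _.
  rewrite subr0 ger0_norm ?expR_ge0//; apply: expN.
  apply: le_trans (expR_ge1Dx _).
  have n0 : 0 <= n%:R :> R by [].
  have : 0 <= n%:R * f x :> R by rewrite mulr_ge0.
  by rewrite /v; nra.
Qed.

Definition L2_approximable_set (B : set X) := measurable B /\ L2_approximable (\1_B).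

Lemma L2_approximable_setC B : L2_approximable_set B -> L2_approximable_set (~` B).
Proof.
move=> [mB aB]; split; first exact: measurableC.
have := L2_approximable_lin (-1) aB (L2_approximable_cst 1).
congr L2_approximable; apply/funext => x.
by rewrite !indicE in_setC; case: (x \in B); rewrite /=; ring.
Qed.

Lemma L2_approximable_setU B C : L2_approximable_set B -> L2_approximable_set C ->
  L2_approximable_set (B `|` C).
Proof.
move=> [mB aB] [mC aC]; split; first exact: measurableU.
have := L2_approximable_lin (-1) (L2_approximableM aB aC) (L2_approximableD aB aC).
congr L2_approximable; apply/funext => x.
by rewrite !indicE in_setU; case: (x \in B); case: (x \in C); rewrite /=; ring.
Qed.

Lemma L2_approximable_sigma_algebra : sigma_algebra setT L2_approximable_set.
Proof.
have a0 : L2_approximable_set set0.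
  split => //; rewrite indic0; exact: L2_approximable_cst.
split => //; first by move=> B aB; rewrite setTD; exact: L2_approximable_setC.
move=> F aF; split; first by apply: bigcup_measurable => k _; case: (aF k).
have aU n : L2_approximable_set (\big[setU/set0]_(k < n) F k).
  elim: n => [|n IH]; first by rewrite big_ord0.
  by rewrite big_ord_recr; exact: L2_approximable_setU.
apply: (@L2_approximable_lim (fun n => \1_(\big[setU/set0]_(k < n) F k)) _ 1).
- by move=> n; case: (aU n).
- by move=> n x; rewrite indicE; case: (_ \in _); rewrite ?normr1 ?normr0.
- move=> x; rewrite indicE; case: (boolP (x \in \bigcup_k F k)).
    move=> /set_mem[k _ Fkx]; apply: (@cvg_natSinv _ _ _ k.+1) => n kn.
    rewrite indicE mem_set ?subrr ?normr0//.
    by rewrite -bigcup_mkord; exists k.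
  move=> /negP nF; apply: (@cvg_natSinv _ _ _ 0%N) => n _.
  rewrite indicE memNset ?subrr ?normr0//.
  rewrite -bigcup_mkord => -[k _ Fkx]; apply: nF; apply/mem_set.
  by exists k.
Qed.

End closed_algebra.

(** * Borel sets, the sine and translations of the line *)

(** An arbitrary sigma-algebra [S] on a bare type is allowed, since it will be instantiated by the
    sets approximable by waves. *)
Lemma borel_preimage_generated {R : realType} (X : Type) (S : set (set X)) (f : X -> R) :
  sigma_algebra setT S -> (forall r, S [set x | f x < r]) ->
  forall B : set (measurableTypeR R), measurable B -> S (f @^-1` B).
Proof.
move=> sS Sf B; rewrite -[measurable]/((ocitv (R := R)).-sigma.-measurable).
rewrite RGenInftyO.measurableE => mB.
have := sigma_algebra_image f sS; set S' := image_set_system _ _ _ => sS'.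
suff : S' B by rewrite /S' /image_set_system /= setTI.
apply: (smallest_sub sS') mB => _ [r ->].
by rewrite /S' /image_set_system /= setTI; exact: Sf.
Qed.

Lemma periodicz {U V : zmodType} (f : U -> V) (T : U) :
  periodic f T -> forall (m : int) x, f (x + T *~ m) = f x.
Proof.
move=> pf; case=> n x; first exact: periodicn.
rewrite NegzE mulrNz -(periodicn pf n.+1 (x - T *~ n.+1)).
by rewrite pmulrn subrK.
Qed.

(** The range is that of [2 * pi / a * (t - r)] for [t] in [0, a) and [r] in [0, a]. *)
Lemma sin_lt0 {R : realType} (z : R) : - (2 * pi) <= z < 2 * pi ->
  (sin z < 0) = ((- pi < z < 0) || (pi < z)).
Proof.
move=> /andP[z1 z2]; have pi0 := pi_gt0 R.
have [zp|zp] := ltP pi z.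
  rewrite orbT -[z](subrK pi) sinDpi oppr_lt0 sin_gt0_pi//.
  by apply/andP; split; lra.
rewrite orbF; have [z0|z0] := leP 0 z.
  rewrite andbF; apply/negbTE; rewrite -leNgt sin_ge0_pi//.
  by apply/andP; split.
rewrite andbT; have [zn|zn] := leP z (- pi).
  apply/negbTE; rewrite -leNgt -sinD2pi sin_ge0_pi//.
  by rewrite mulr2n; apply/andP; split; lra.
rewrite -[z]opprK sinN oppr_lt0 sin_gt0_pi//.
by apply/andP; split; lra.
Qed.

Lemma lebesgue_measure_shift {R : realType} (x : R) (A : set (measurableTypeR R)) :
  measurable A -> lebesgue_measure [set y | A (y + x)] = lebesgue_measure A.
Proof.
move=> mA.
pose f (y : measurableTypeR R) : measurableTypeR R := y + x.
have mf : measurable_fun setT f by exact: measurable_funD.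
rewrite [RHS](@lebesgue_measure_unique R (pushforward lebesgue_measure f)) => //.
move=> _ [[u v] _ <-]; rewrite /pushforward.
rewrite [X in _ = lebesgue_measure X](_ : _ = `]u - x, v - x]%classic); last first.
  by apply/seteqP; split => y; rewrite /f /= !in_itv /= ltrBlDr lerBrDr.
rewrite !lebesgue_measure_itv /= !lte_fin ltrD2r.
by case: ifP => // _; rewrite -!EFinB; congr EFin; ring.
Qed.

(** * The circle *)

Section circle_theory.
Context {R : realType} (a : R) (a0 : 0 < a).

(** The representative chosen by [repr] is arbitrary; subtracting the floor brings it to [0, a) and
    makes the composite with [circle_proj] an explicit function on the line, from which
    measurability follows. *)
Definition circle_section (t : circle a) : measurableTypeR R :=
  let r := repr t in r - a * (Num.floor (r / a))%:~R.

Lemma circle_projD x y :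
  circle_proj a (x + y) = circle_proj a x + circle_proj a y.
Proof. exact: raddfD. Qed.

Lemma circle_proj_eq x y :
  circle_proj a x = circle_proj a y <-> exists m : int, x = y + a * m%:~R.
Proof.
split=> [/eqP|[m ->]].
  rewrite /circle_proj -Quotient.idealrBE => /asboolP[m xy].
  by exists m; rewrite -xy addrC subrK.
apply/eqP; rewrite /circle_proj -Quotient.idealrBE; apply/asboolP; exists m.
by rewrite addrC addKr.
Qed.

Lemma circle_sectionK t : circle_proj a (circle_section t) = t.
Proof.
rewrite -[RHS]reprK; apply/circle_proj_eq.
by exists (- Num.floor (repr t / a)); rewrite mulrNz mulrN.
Qed.

Lemma circle_section_itv t : 0 <= circle_section t < a.
Proof.
rewrite /circle_section; set r := repr t.
have /andP[h1 h2] := floor_itv (r / a).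
move: h1 h2; rewrite ler_pdivlMr// ltr_pdivrMr// intrD mulrDl mul1r mulrC.
by move=> h1 h2; apply/andP; split; lra.
Qed.

Lemma circle_section_id x : 0 <= x < a -> circle_section (circle_proj a x) = x.
Proof.
move=> /andP[x0 xa]; have /andP[y0 ya] := circle_section_itv (circle_proj a x).
have [k yk] := (circle_proj_eq _ _).1 (circle_sectionK (circle_proj a x)).
move: y0 ya; rewrite yk => y0 ya.
suff -> : k = 0 by rewrite mulr0 addr0.
have k1 : k < 1.
  by rewrite -(ltr_int R) -(ltr_pM2l a0) mulr1; lra.
have k2 : -1 < k.
  by rewrite -(ltr_int R) -(ltr_pM2l a0) mulrN1; lra.
by case: k k1 k2 {yk y0 ya} => [[|n]|[|n]].
Qed.

Lemma circle_section_proj x : circle_section (circle_proj a x) =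
  x - a * (Num.floor (x / a))%:~R.
Proof.
rewrite -[RHS]circle_section_id.
  congr circle_section; apply/circle_proj_eq.
  by exists (Num.floor (x / a)); rewrite subrK.
have /andP[] := floor_itv (x / a).
rewrite ler_pdivlMr// ltr_pdivrMr// intrD mulrDl mul1r mulrC.
by move=> h1 h2; apply/andP; split; lra.
Qed.

Lemma measurable_circle_section : measurable_fun setT circle_section.
Proof.
move=> _ B mB; rewrite setTI.
apply: (@borel_preimage_generated R _ measurable circle_section) => // [|r].
  split; [exact: measurable0|by move=> A mA; rewrite setTD; exact: measurableC|].
  by move=> F mF; exact: bigcupT_measurable.
rewrite /measurable /= /circle_measurable /=.
(* Cut the line into periods: on [a m, a (m + 1)) the section of the projection is the translation
   by - a m. *)
rewrite (_ : _ @^-1` _ = \bigcup_(m : int) (`[a * m%:~R, a * (m + 1)%:~R[%classic `&`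
    `]-oo, r + a * m%:~R[%classic)).
  apply: countable_bigcupT_measurable => [|m]; first exact: countableP.
  by apply: measurableI; exact: measurable_itv.
apply/seteqP; split => x /=.
  rewrite circle_section_proj => xr; exists (Num.floor (x / a)) => //=.
  rewrite !in_itv /= -ltrBlDr xr; split => //.
  have /andP[] := floor_itv (x / a).
  by rewrite ler_pdivlMr// ltr_pdivrMr// mulrC => -> h; rewrite mulrC.
move=> [m _ /=]; rewrite !in_itv /= => -[/andP[h1 h2] h3].
rewrite circle_section_proj (_ : Num.floor _ = m) ?ltrBlDr//.
by apply/floor_def; rewrite ler_pdivlMr// ltr_pdivrMr// !(mulrC _ a) h1.
Qed.

(** The generators are the half-circles that end at [r], which is what the sign of a wave detects.
    Boolean combinations of them recover all initial segments of [0, a). *)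
Lemma circle_generated (S : set (set (circle a))) : sigma_algebra setT S ->
  (forall r, S [set t | sin (2 * pi / a * (circle_section t - r)) < 0]) ->
  forall C : set (circle a), measurable C -> S C.
Proof.
move=> sS Ssin C mC.
have [S0 SC SU] := sS.
have SCc A : S A -> S (~` A) by move=> /SC; rewrite setTD.
have SUU A B : S A -> S B -> S (A `|` B).
  move=> SA SB; rewrite -bigcup2E; apply: SU => -[|[|n]] //=.
have SDD A B : S A -> S B -> S (A `\` B).
  by move=> SA SB; rewrite setDE -[A]setCK -setCU; apply: (SCc _); apply: (SUU _ _) => //; exact: SCc.
rewrite (_ : C = circle_section @^-1` (circle_proj a @^-1` C)); last first.
  by apply/seteqP; split => t /=; rewrite circle_sectionK.
apply: borel_preimage_generated => // r.
pose N r := [set t | sin (2 * pi / a * (circle_section t - r)) < 0].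
have pi0 := pi_gt0 R.
have pin : pi != 0 :> R by rewrite gt_eqF.
have NE s t : 0 <= s <= a -> N s t <->
    (- (a / 2) < circle_section t - s < 0) \/ (a / 2 < circle_section t - s).
  move=> /andP[s0 sa]; rewrite /N /=.
  have /andP[y0 ya] := circle_section_itv t.
  have ap : 0 < 2 * pi / a by rewrite divr_gt0// mulr_gt0.
  have E b : (b < 2 * pi / a * (circle_section t - s)) = (b * a / (2 * pi) < circle_section t - s).
    by rewrite mulrC -ltr_pdivrMr// invf_div mulrA.
  rewrite sin_lt0; last first.
    have a_neq0 : a != 0 by rewrite gt_eqF.
    apply/andP; split.
      rewrite [leLHS](_ : _ = 2 * pi / a * - a); last by field.
      by rewrite ler_pM2l//; lra.
    rewrite [ltRHS](_ : _ = 2 * pi / a * a); last by field.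
    by rewrite ltr_pM2l//; lra.
  rewrite !E pmulr_rlt0//.
  have key (p : R) : p != 0 -> p * a / (2 * p) = a / 2 by move=> ?; field.
  rewrite !mulNr key//.
  by split => [/orP[]|[->|->]]; rewrite ?orbT; [left|right| |].
have lower s : 0 < s < a / 2 -> S [set t | circle_section t < s].
  move=> /andP[s0 sa].
  (* For [s < a / 2] the half-circle ending at [s] runs back past 0; removing the one that ends at 0
     leaves [0, s). *)
  rewrite (_ : [set t | _] = N s `\` N 0); first by apply: (SDD _ _); exact: Ssin.
  apply/seteqP; split => t /=; have /andP[y0 ya] := circle_section_itv t.
    move=> ts; split; first by apply/NE; lra.
    by move=> /NE; rewrite subr0 => /(_ _)[| |]; lra.
  move=> [/NE ts nt]; have {}ts := ts _.
  apply: contrapT => /negP; rewrite -leNgt => st; apply: nt; apply/NE; first by lra.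
  by rewrite subr0; right; case: ts; lra.
have [r0|r0] := leP r 0.
  rewrite (_ : [set x | _] = set0)//; apply/seteqP; split => // t /=.
  by have /andP[y0 ya] := circle_section_itv t; lra.
have [ra|ra] := leP a r.
  rewrite (_ : [set x | _] = setT); first by rewrite -setC0; exact: SCc.
  apply/seteqP; split => // t /= _.
  by have /andP[y0 ya] := circle_section_itv t; lra.
have [ra2|ra2] := ltP r (a / 2); first by apply: lower; lra.
(* For [a / 2 <= r < a] the half-circle is (r - a / 2, r). It contains [r / 2], so [0, r / 2) fills
   what is missing, and [r / 2 < a / 2] is covered by [lower]. *)
rewrite (_ : [set t | _] = N r `|` [set t | circle_section t < r / 2]).
  by apply: (SUU _ _); [exact: Ssin|apply: lower; lra].
apply/seteqP; split => t /=; have /andP[y0 ya] := circle_section_itv t.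
  move=> ts; have [?|?] := ltP (circle_section t) (r / 2); first by right.
  by left; apply/NE; lra.
move=> [/NE h|]; last by lra.
have := h _; lra.
Qed.

End circle_theory.

Section circle_probability.
Context {R : realType} (a : R) (a0 : 0 < a).

Local Notation leb := (@lebesgue_measure R).

(** The closed interval of [uniform_prob] is replaced by the fundamental domain [0, a), the endpoint
    being negligible. *)
Lemma circle_probE C : measurable C ->
  circle_prob a0 C = (a^-1%:E * leb ((circle_proj a @^-1` C) `&` `[0%R, a[%classic))%E.
Proof.
move=> mC; pose D : set (measurableTypeR R) := circle_proj a @^-1` C.
have mD : measurable D by exact: mC.
rewrite /circle_prob /distribution /pushforward /= -/D.
rewrite /uniform_prob integral_uniform_pdf.
rewrite (eq_integral (fun=> a^-1%:E)); last first.
  by move=> x; rewrite inE => -[_] /=; rewrite in_itv /= /uniform_pdf subr0 => ->.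
rewrite integral_cst //=; last exact: measurableI.
congr (_ * _)%E.
rewrite -(@integral_indic _ _ _ leb _ (measurable_itv `[0, a]) _ mD).
rewrite -(@integral_indic _ _ _ leb _ (measurable_itv `[0, a[) _ mD).
rewrite -integral_itv_bndo_bndc//.
by apply/measurable_EFinP; apply: measurable_funTS; exact: measurable_indic.
Qed.

Lemma circle_rotation_measurable x :
  measurable_fun setT (fun t : circle a => t + circle_proj a x).
Proof.
move=> _ C mC; rewrite setTI.
have mf : measurable_fun setT ((fun y => y + x) : measurableTypeR R -> measurableTypeR R).
  exact: measurable_funD.
have := mf measurableT _ mC; rewrite setTI => mC'.
rewrite /measurable /= /circle_measurable /=.
rewrite (_ : _ @^-1` _ = (fun y => y + x) @^-1` (circle_proj a @^-1` C))//.
by apply/seteqP; split => y /=; rewrite circle_projD.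
Qed.

(** For [x] in [0, a), the rotated domain [x, x + a) is cut at [a] and the part beyond is brought
    back by one period. *)
Lemma circle_prob_rotation x C : measurable C ->
  circle_prob a0 [set t | C (t + circle_proj a x)] = circle_prob a0 C.
Proof.
wlog /andP[x0 xa] : x / 0 <= x < a.
  move=> H mC; have <- := circle_sectionK (circle_proj a x).
  by apply: H => //; exact: (circle_section_itv a0).
move=> mC; rewrite !circle_probE//; last first.
  by have := circle_rotation_measurable x measurableT mC; rewrite setTI.
congr (_ * _)%E.
pose D : set (measurableTypeR R) := circle_proj a @^-1` C.
have mD : measurable D by exact: mC.
have mi (u v : R) : measurable (D `&` `[u, v[%classic).
  by apply: measurableI => //; exact: measurable_itv.
rewrite [X in leb X](_ : _ = [set y | (D `&` `[x, x + a[%classic) (y + x)]); last first.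
  apply/seteqP; split => y /=; rewrite !in_itv /= /D /= circle_projD.
    by move=> [? /andP[? ?]]; split => //; apply/andP; split; lra.
  by move=> [? /andP[? ?]]; split => //; apply/andP; split; lra.
rewrite lebesgue_measure_shift//.
have split3 (u v w : R) : u <= v -> v <= w ->
    leb (D `&` `[u, w[%classic) =
    (leb (D `&` `[u, v[%classic) + leb (D `&` `[v, w[%classic))%E.
  move=> uv vw; rewrite -measureU//.
    rewrite -setIUr; congr (leb (_ `&` _)); apply/seteqP; split => y /=.
      rewrite !in_itv /= => /andP[-> ->]; rewrite andbT.
      by have [|] := ltP y v; [left|right].
    by rewrite !in_itv /= => -[|] /andP[? ?]; apply/andP; split; lra.
  apply/seteqP; split => // y [[_ h1] [_ h2]]; move: h1 h2.
  by rewrite /= !in_itv /= => /andP[_ ?] /andP[? _]; lra.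
rewrite (split3 x a) ?(ltW xa)//; last by rewrite lerDr.
rewrite [RHS](split3 0 x) ?(ltW xa)// addeC; congr (_ + _)%E.
rewrite -(lebesgue_measure_shift a)//; congr leb; apply/seteqP.
split => y /=; rewrite !in_itv /= /D /=.
  rewrite (_ : circle_proj a (y + a) = circle_proj a y); last first.
    by apply/circle_proj_eq; exists 1; rewrite mulr1.
  by move=> [? /andP[? ?]]; split => //; apply/andP; split; lra.
rewrite (_ : circle_proj a (y + a) = circle_proj a y); last first.
  by apply/circle_proj_eq; exists 1; rewrite mulr1.
by move=> [? /andP[? ?]]; split => //; apply/andP; split; lra.
Qed.

(** The argument of the [k]-th character of R/aZ, read off the representative in [0, a). It follows
    rotations only modulo 2 pi, hence the integer in [phase_rotation]. *)
Definition phase (k : int) (t : circle a) : R := 2 * pi / a * k%:~R * circle_section t.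

Lemma measurable_phase k : measurable_fun setT (phase k).
Proof.
apply: measurable_funM => //; exact: (measurable_circle_section a0).
Qed.

Lemma phaseD k l t : phase (k + l) t = phase k t + phase l t.
Proof. by rewrite /phase intrD; ring. Qed.

Lemma phaseN k t : phase (- k) t = - phase k t.
Proof. by rewrite /phase intrN; ring. Qed.

Lemma phase0 t : phase 0 t = 0.
Proof. by rewrite /phase mulr0 mul0r. Qed.

Lemma phase_rotation k t y : exists m : int,
  phase k (t + circle_proj a y) = phase k t + 2 * pi / a * k%:~R * y + pi *+ 2 *~ m.
Proof.
have [m Hm] : exists m : int,
    circle_section (t + circle_proj a y) = circle_section t + y + a * m%:~R.
  by apply/circle_proj_eq; rewrite circle_projD !circle_sectionK.
exists (k * m); rewrite /phase Hm -[_ *~ (k * m)]mulrzr intrM -mulr_natl.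
have a_neq0 : a != 0 by rewrite gt_eqF.
by move: pi => p; field.
Qed.

Lemma cos_phase_rotation u k t y :
  cos (u + phase k (t + circle_proj a y)) = cos (u + 2 * pi / a * k%:~R * y + phase k t).
Proof.
have [m ->] := phase_rotation k t y.
rewrite !addrA (periodicz (@cosD2pi R)); congr cos; ring.
Qed.

Lemma measurable_cos_phase u k : measurable_fun setT (fun t => cos (u + phase k t)).
Proof.
apply: (measurableT_comp (f := @cos R)).
  by apply: continuous_measurable_fun; exact: continuous_cos.
by apply: measurable_funD => //; exact: measurable_phase.
Qed.

Lemma mean_cos_phase u k :
  \int[circle_prob a0]_t cos (u + phase k t) = if k == 0 then cos u else 0.
Proof.
have [->|k0] := eqVneq k 0.
  under eq_Rintegral do rewrite phase0 addr0.
  exact: mean_cst.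
have bc v : bounded_measurable (fun t => cos (v + phase k t)).
  split; first exact: measurable_cos_phase.
  exists 1 => t; rewrite ler_norml; apply/andP; split; [exact: cos_geN1|exact: cos_le1].
(* Rotation by half a wavelength adds [pi] to the phase and changes the sign of the cosine, so the
   mean is its own opposite. *)
pose y := a / (2 * k%:~R).
have := mean_comp (circle_rotation_measurable y) (circle_prob_rotation y) (bc u).
rewrite (_ : \int[_]_x _ = - \int[circle_prob a0]_t cos (u + phase k t)); first by lra.
rewrite -[RHS]mulN1r -meanZ//; apply: eq_Rintegral => t _.
rewrite cos_phase_rotation mulN1r (_ : u + _ + phase k t = u + phase k t + pi).
  by rewrite cosDpi.
rewrite /y addrAC; congr (_ + _).
have k0R : k%:~R != 0 :> R by rewrite intr_eq0.
have a_neq0 : a != 0 by rewrite gt_eqF.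
move: (k%:~R) k0R pi => q q0 p; field.
by rewrite q0 a_neq0.
Qed.

End circle_probability.

(** * The Fourier transform of the Gaussian law *)

Section gauss_fourier.
Context {R : realType}.
Local Notation leb := (@lebesgue_measure R).

Let gs (x : R) := expR (- (x ^+ 2 / 2)).

Let gs0 x : 0 < gs x. Proof. exact: expR_gt0. Qed.

Let measurable_gs : measurable_fun setT gs.
Proof.
apply: (measurableT_comp (f := @expR R)) => //.
by apply: measurableT_comp => //; apply: measurable_funM.
Qed.

(* The variance 2 leaves room for a polynomial factor. *)
Let G (x : R) := 2 / normal_peak (Num.sqrt 2) * normal_pdf 0 (Num.sqrt 2) x.

Let sqrt2_neq0 : Num.sqrt 2 != 0 :> R.
Proof. by rewrite gt_eqF// sqrtr_gt0. Qed.

Let GE x : G x = 2 * expR (- (x ^+ 2 / 4)).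
Proof.
rewrite /G normal_pdfE// /normal_fun subr0 sqr_sqrtr// mulrA divfK; last first.
  by rewrite gt_eqF// normal_peak_gt0.
by congr (_ * expR _); rewrite mulNr; congr (- (_ / _)); rewrite -mulr_natr -natrM.
Qed.

Let integrable_dominated (f : R -> R) : measurable_fun setT f ->
  (forall x, `|f x| <= (1 + `|x|) * gs x) -> leb.-integrable setT (EFin \o f).
Proof.
move=> mf fG; apply: (@le_integrable _ _ _ leb setT measurableT _ (EFin \o G)) => //.
- exact/measurable_EFinP.
- move=> x _; rewrite /= lee_fin (le_trans (fG x))// [leRHS]ger0_norm; last first.
    by rewrite GE mulr_ge0// expR_ge0.
  rewrite GE (_ : gs x = expR (- (x ^+ 2 / 4)) * expR (- (x ^+ 2 / 4))); last first.
    by rewrite -expRD; congr expR; field.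
  rewrite mulrA ler_wpM2r ?expR_ge0// expRN ler_pdivrMr ?expR_gt0//.
  (* 1 + |x| <= 2 (1 + x^2 / 4) <= 2 exp (x^2 / 4), the first inequality because (|x| - 1)^2 >=
     0. *)
  have := expR_ge1Dx (x ^+ 2 / 4); rewrite -(real_normK (num_real x)).
  by have := sqr_ge0 (`|x| - 1); nra.
- rewrite (_ : EFin \o G = fun x => (2 / normal_peak (Num.sqrt 2))%:E * (normal_pdf 0 (Num.sqrt 2) x)%:E)%E//.
  by apply: integrableZl => //; exact: integrable_normal_pdf.
Qed.

Lemma norm_sin_le1 (x : R) : `|sin x| <= 1.
Proof. by rewrite ler_norml sin_geN1 sin_le1. Qed.

Lemma norm_cos_le1 (x : R) : `|cos x| <= 1.
Proof. by rewrite ler_norml cos_geN1 cos_le1. Qed.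

Let is_derive_mul s (x : R) : is_derive x 1 (fun y : R => s * y) s.
Proof.
rewrite (_ : (fun y => s * y) = s \*: id)//.
by apply: is_derive_eq; rewrite scaler1.
Qed.

Let is_derive_gs (x : R) : is_derive x 1 gs (- x * gs x).
Proof.
have d : is_derive x 1 (fun y : R => - (y ^+ 2 / 2)) (- x).
  rewrite (_ : (fun y => _) = - (2^-1 \*: (id ^+ 2))); last first.
    by apply/funext => y /=; rewrite !fctE /= mulrC.
  by apply: is_derive_eq; rewrite /GRing.scale /=; field.
by have H := is_derive1_comp (is_derive_expR _) d; rewrite (mulrC (- x)); exact: H.
Qed.

Let is_derive_sin_mul s (x : R) : is_derive x 1 (fun y => sin (s * y)) (s * cos (s * x)).
Proof.
have H := is_derive1_comp (is_derive_sin _) (is_derive_mul s x).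
by rewrite (mulrC s); exact: H.
Qed.

Let is_derive_cos_mul s (x : R) : is_derive x 1 (fun y => cos (s * y)) (- (s * sin (s * x))).
Proof.
have H := is_derive1_comp (is_derive_cos _) (is_derive_mul s x).
by rewrite (mulrC s) -mulNr; exact: H.
Qed.

Let is_derive_sin_gs s (x : R) : is_derive x 1 (fun y => sin (s * y) * gs y)
  (s * cos (s * x) * gs x - x * sin (s * x) * gs x).
Proof.
have H := is_deriveM (is_derive_sin_mul s x) (is_derive_gs x).
rewrite (_ : _ - _ = sin (s * x) *: (- x * gs x) + gs x *: (s * cos (s * x))).
  exact: H.
by rewrite /GRing.scale /=; ring.
Qed.

Let measurable_trig_mul (f : R -> R) s : continuous f ->
  measurable_fun setT (fun x : R => f (s * x)).
Proof.
move=> cf; apply: measurableT_comp; first exact: continuous_measurable_fun.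
exact: measurable_funM.
Qed.

Let K s := \int[leb]_x (cos (s * x) * gs x).

Let integrable_K s : leb.-integrable setT (EFin \o (fun x => cos (s * x) * gs x)).
Proof.
apply: integrable_dominated.
  apply: measurable_funM => //; apply: measurable_trig_mul; exact: continuous_cos.
move=> x; rewrite normrM (gtr0_norm (gs0 x)) ler_wpM2r ?(ltW (gs0 x))//.
by rewrite (le_trans (norm_cos_le1 _))// lerDl.
Qed.

Let integrable_xsin s : leb.-integrable setT (EFin \o (fun x => x * sin (s * x) * gs x)).
Proof.
apply: integrable_dominated.
  apply: measurable_funM => //; apply: measurable_funM => //.
  by apply: measurable_trig_mul; exact: continuous_sin.
move=> x; rewrite normrM (gtr0_norm (gs0 x)) ler_wpM2r ?(ltW (gs0 x))//.
by rewrite normrM (@le_trans _ _ `|x|) ?lerDr// ler_piMr// norm_sin_le1.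
Qed.

Let is_derive_continuous (f f' : R -> R) :
  (forall x : R, is_derive x 1 f (f' x)) -> continuous f.
Proof.
move=> df x; apply/differentiable_continuous/derivable1_diffP.
exact: (@ex_derive _ _ _ _ _ _ _ (df x)).
Qed.

Let gs_le n : gs n%:R <= (1 + n%:R ^+ 2 / 2)^-1.
Proof.
rewrite /gs expRN lef_pV2 ?posrE ?expR_gt0//.
exact: expR_ge1Dx.
Qed.

(** The function [h'] is the derivative of [h]. Its integral over [-n - 1, n + 1] tends to the full
    integral by domination, and to 0 because the boundary terms do. *)
Let integral_by_parts s : \int[leb]_x (x * sin (s * x) * gs x) = s * K s.
Proof.
pose h (x : R) : R := sin (s * x) * gs x.
pose h' (x : R) : R := s * cos (s * x) * gs x - x * sin (s * x) * gs x.
have isK : leb.-integrable setT (EFin \o (fun x => s * cos (s * x) * gs x)).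
  rewrite (_ : _ \o _ = fun x => s%:E * (cos (s * x) * gs x)%:E)%E.
    by apply: integrableZl => //; exact: integrable_K.
  by apply/funext => x /=; rewrite -EFinM mulrA.
have ih' : leb.-integrable setT (EFin \o h').
  pose p x := s * cos (s * x) * gs x.
  pose q x := x * sin (s * x) * gs x.
  rewrite (_ : EFin \o h' = (EFin \o p) \- (EFin \o q))%E//.
  by apply: integrableB => //; exact: integrable_xsin.
suff : \int[leb]_x h' x = 0.
  rewrite /h' (RintegralB measurableT isK (integrable_xsin s)).
  under eq_Rintegral do rewrite -mulrA.
  rewrite (RintegralZl _ measurableT (integrable_K s)).
  by move=> /eqP; rewrite subr_eq0 => /eqP <-.
have cgs := is_derive_continuous is_derive_gs.
have ch' : continuous h'.
  move=> x; apply: cvgB; (apply: cvgM; last exact: cgs); apply: cvgM.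
  - exact: cvg_cst.
  - exact: (is_derive_continuous (is_derive_cos_mul s)).
  - exact: cvg_id.
  - exact: (is_derive_continuous (is_derive_sin_mul s)).
have ch := is_derive_continuous (is_derive_sin_gs s).
pose I n : set R := `[- n.+1%:R, n.+1%:R]%classic.
have IE n : \int[leb]_(x in I n) h' x = h n.+1%:R - h (- n.+1%:R).
  rewrite /Rintegral (@continuous_FTC2 R h' h)//.
  - by rewrite gtrN.
  - exact: continuous_subspaceT.
  - split.
    + by move=> x _; exact: (@ex_derive _ _ _ _ _ _ _ (is_derive_sin_gs s x)).
    + exact/cvg_at_right_filter/ch.
    + exact/cvg_at_left_filter/ch.
  - by move=> x _; rewrite derive1E; exact: (@derive_val _ _ _ _ _ _ _ (is_derive_sin_gs s x)).
have mI n : measurable (I n) by exact: measurable_itv.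
have lim0 : \int[leb]_(x in I n) h' x @[n --> \oo] --> (0 : R).
  (* From 5 on, 2 / (1 + m^2 / 2) <= 1 / m holds for [m = n.+1]. *)
  apply: (@cvg_natSinv _ _ _ 5) => n n5; rewrite subr0 IE.
  have hle : forall x : R, `|h x| <= gs x.
    by move=> x; rewrite normrM (gtr0_norm (gs0 x)) ler_piMl ?norm_sin_le1// ltW.
  apply: (@le_trans _ _ (2 * (1 + n.+1%:R ^+ 2 / 2)^-1)).
    apply: le_trans (ler_normB _ _) _; rewrite mulr_natl mulr2n.
    apply: lerD; apply: le_trans (hle _) _; rewrite /gs ?sqrrN; exact: gs_le.
  have n5' : 5 <= n%:R :> R by rewrite ler_nat.
  rewrite -[n.+1%:R]natr1; move: (n%:R) n5' => m m5.
  rewrite ler_pdivrMr; last by rewrite ltr_wpDr// divr_ge0// sqr_ge0.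
  rewrite mulrC ler_pdivlMr; last by lra.
  by nra.
have : \int[leb]_(x in I n) h' x @[n --> \oo] --> \int[leb]_x h' x.
  apply: fine_cvg; rewrite fineK; last exact: integrable_fin_num.
  have [|||||_ _] := @dominated_convergence _ _ R leb setT measurableT
    (fun n => EFin \o (h' \_ (I n))) (EFin \o h') (fun x => `|(EFin \o h') x|%E).
  - move=> n; apply/measurable_EFinP; apply/(measurable_restrictT _ (mI n)).
    apply: measurable_funTS; exact: continuous_measurable_fun.
  - exact: (measurable_int leb).
  - apply/aeW => x _; apply: cvg_EFin; first exact: nearW.
    have [N HN] : exists N : nat, `|x| <= N%:R.
      exists (Num.trunc `|x|).+1; apply: ltW; exact: truncnS_gt.
    apply: (@cvg_natSinv _ _ _ N) => n Nn.
    rewrite /= patchE mem_set ?subrr ?normr0// /I /= in_itv /= -ler_norml.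
    by rewrite (le_trans HN)// ler_nat ltnW.
  - exact: integrable_abse.
  - apply/aeW => x n _ /=; rewrite lee_fin patchE; case: ifPn => //.
    by rewrite normr0.
  apply: cvg_trans; apply: near_eq_cvg; apply: nearW => n /=.
  rewrite [RHS]integral_mkcond; apply: eq_integral => x _.
  by rewrite restrict_EFin.
by move=> lim1; rewrite -(cvg_lim _ lim1)//; exact: cvg_lim lim0.
Qed.

(** Differentiation under the integral sign, dominated by [M]; integration by parts turns the result
    back into [K]. *)
Let is_derive_K (s : R) : is_derive s 1 K (- s * K s).
Proof.
pose f (t x : R) : R := cos (t * x) * gs x.
have df (t x : R) : is_derive t 1 (f ^~ x) (- (x * sin (t * x) * gs x)).
  have d := is_derive_cos_mul x t.
  rewrite (_ : f ^~ x = (gs x) \*: (fun y => cos (x * y))); last first.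
    by apply/funext => y; rewrite /f /= mulrC (mulrC x).
  rewrite (_ : - _ = gs x *: (- (x * sin (x * t)))); first exact: is_deriveZ.
  by rewrite /GRing.scale /= (mulrC t); ring.
have d1 (t x : R) : partial1of2 f t x = - (x * sin (t * x) * gs x).
  by rewrite partial1of2E; exact: (@derive_val _ _ _ _ _ _ _ (df t x)).
have Is : `]s - 1, s + 1[%classic s.
  by rewrite /= in_itv /=; apply/andP; split; lra.
pose M (x : R) : R := (1 + `|x|) * gs x.
have M0 (x : R) : 0 <= M x by rewrite mulr_ge0// ?ltW// addr_ge0.
have iM : leb.-integrable setT (EFin \o M).
  apply: integrable_dominated; last by move=> x; rewrite ger0_norm.
  by apply: measurable_funM => //; apply: measurable_funD => //; exact: measurableT_comp.
have Mub (t x : R) : `]s - 1, s + 1[%classic t -> [set: R] x -> `|partial1of2 f t x| <= M x.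
  move=> _ _; rewrite d1 normrN !normrM (gtr0_norm (gs0 x)) /M ler_wpM2r ?(ltW (gs0 x))//.
  by rewrite (@le_trans _ _ `|x|) ?lerDr// ler_piMr// norm_sin_le1.
have intf (t : R) : `]s - 1, s + 1[%classic t -> leb.-integrable setT (EFin \o f t).
  by move=> _; exact: integrable_K.
have derf (t x : R) : `]s - 1, s + 1[%classic t -> [set: R] x -> derivable (f ^~ x) t 1.
  by move=> _ _; exact: (@ex_derive _ _ _ _ _ _ _ (df t x)).
have D := derivable_under_integral measurableT Is intf derf M0 iM Mub.
have E := differentiation_under_integral measurableT Is intf derf M0 iM Mub.
apply: DeriveDef; first exact: D.
rewrite -derive1E; apply: etrans E _.
under eq_Rintegral do rewrite d1 -mulN1r.
by rewrite (RintegralZl _ measurableT (integrable_xsin s)) integral_by_parts mulrA mulN1r.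
Qed.

Let KE s : K s = K 0 * expR (- (s ^+ 2 / 2)).
Proof.
(* Both [K] and [gs] solve f' = - t f, so their quotient has derivative 0. *)
pose L (t : R) : R := K t * (gs t)^-1.
suff : L s = L 0.
  rewrite /L {2}/gs expr0n mul0r oppr0 expR0 invr1 mulr1 => <-.
  by rewrite divfK// gt_eqF.
apply: is_derive_0_is_cst => t.
have d2 : is_derive t 1 (fun y => (gs y)^-1) (t * (gs t)^-1).
  have H := is_deriveV (lt0r_neq0 (gs0 t)) (is_derive_gs t).
  rewrite (_ : t * _ = - (gs t) ^- 2 *: (- t * gs t)); first exact: H.
  by rewrite /GRing.scale /= expr2; field; rewrite gt_eqF.
have H := is_deriveM (is_derive_K t) d2.
rewrite (_ : 0 = K t *: (t * (gs t)^-1) + (gs t)^-1 *: (- t * K t)); first exact: H.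
by rewrite /GRing.scale /=; ring.
Qed.

Lemma normal_prob_density (f : R -> R) : measurable_fun setT f ->
  (normal_prob 0 1).-integrable setT (EFin \o f) ->
  (\int[normal_prob 0 1]_x (f x)%:E =
   \int[leb]_x ((f x)%:E * (normal_pdf 0 1 x)%:E))%E.
Proof.
move=> mf intf.
rewrite -(Radon_Nikodym_change_of_variables (normal_prob_dominates 0 1))//=.
apply: ae_eq_integral => //.
- apply: emeasurable_funM; first exact/measurable_EFinP.
  apply: (measurable_int leb); apply: Radon_Nikodym_integrable.
  exact: normal_prob_dominates.
- apply: emeasurable_funM; apply/measurable_EFinP => //; exact: measurable_normal_pdf.
- apply: ae_eqe_mul2l => /=.
  rewrite Radon_NikodymE//=; first exact: normal_prob_dominates.
  move=> dom; case: cid => /= g [g1 g2 g3].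
  apply: integral_ae_eq => //=.
  + by apply/measurable_EFinP; exact: measurable_normal_pdf.
  + by move=> E _ mE; rewrite -g3.
Qed.

Lemma normal_prob_cos (s : R) :
  \int[normal_prob 0 1]_x cos (s * x) = expR (- (s ^+ 2 / 2)).
Proof.
have peak t : \int[normal_prob 0 1]_x cos (t * x) = normal_peak (1 : R) * K t.
  have mc : measurable_fun setT (fun x => cos (t * x)).
    by apply: measurable_trig_mul; exact: continuous_cos.
  rewrite /Rintegral normal_prob_density//; last first.
    apply: bounded_measurable_integrable; split => //.
    by exists 1 => x; exact: norm_cos_le1.
  rewrite /K -(RintegralZl _ measurableT (integrable_K t)).
  congr fine; apply: eq_integral => x _; rewrite -EFinM normal_pdfE ?oner_neq0//.
  congr EFin; rewrite mulrCA; congr (_ * (_ * _)).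
  by rewrite /normal_fun /gs subr0 expr1n mulNr.
(* At 0 this says that [normal_peak 1 * K 0] is the total mass 1, so the Gaussian integral need not
   be evaluated. *)
have := peak 0.
under eq_Rintegral do rewrite mul0r cos0.
by rewrite mean_cst peak (KE s) mulrA => <-; rewrite mul1r.
Qed.

End gauss_fourier.

(** * Null sets and generators of products *)

Section probability_facts.
Context {R : realType}.

Lemma eq_probability d d' (X : measurableType d) (Y : measurableType d')
    (P : probability X R) (Q : probability Y R) A B :
  measurable A -> measurable B ->
  \int[P]_x \1_A x = \int[Q]_y \1_B y -> P A = Q B.
Proof.
move=> mA mB; rewrite !mean_indic// => h.
by rewrite -[LHS]fineK ?fin_num_measure// h fineK// fin_num_measure.
Qed.

Lemma ae_eq_indic d (X : measurableType d) (P : probability X R) (A B : set X) :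
  measurable A -> measurable B -> P (A `+` B) = 0%E ->
  {ae P, forall x, \1_A x = \1_B x :> R}.
Proof.
move=> mA mB AB0; exists (A `+` B); split => //.
  by apply: measurableU; exact: measurableD.
move=> x /= nAB; rewrite !indicE in nAB.
have [Ax|Ax] := pselect (A x); have [Bx|Bx] := pselect (B x).
- by exfalso; apply: nAB; rewrite !mem_set.
- by left.
- by right.
- by exfalso; apply: nAB; rewrite !memNset.
Qed.

Lemma ae_invariant_setY d (X : measurableType d) (P : probability X R) (A B : set X) :
  measurable A -> measurable B -> {ae P, forall x, A x <-> B x} ->
  P (A `+` B) = 0%E.
Proof.
move=> mA mB [N [mN N0 ABN]]; apply/eqP; rewrite -measure_le0 -N0.
apply: le_measure; rewrite ?inE//.
  by apply: measurableU; exact: measurableD.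
by move=> x [[Ax nBx]|[Bx nAx]]; apply: ABN => /= -[]; tauto.
Qed.

Lemma product_generated d d' (X : measurableType d) (Y : measurableType d')
    (S : set (set (X * Y))) : sigma_algebra setT S ->
  (forall A, measurable A -> S (fst @^-1` A)) ->
  (forall B, measurable B -> S (snd @^-1` B)) ->
  forall C, measurable C -> S C.
Proof.
move=> sS S1 S2 C mC.
apply: (smallest_sub sS) mC => D [] [A mA <-]; rewrite setTI; [exact: S1|exact: S2].
Qed.

Lemma sigma_algebra_preimage_in (X Y : Type) (f : X -> Y) (S : set (set X)) :
  sigma_algebra setT S -> sigma_algebra setT [set B | S (f @^-1` B)].
Proof.
move=> [S0 SC SU]; split.
- by rewrite /= preimage_set0.
- by move=> A /= /SC; rewrite !setTD preimage_setC.
- by move=> F SF /=; rewrite preimage_bigcup; exact: SU.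
Qed.

Lemma measure_preserving_product d d' (X : measurableType d) (Y : measurableType d')
    (P : probability X R) (Q : probability Y R) (f : X -> X) (g : Y -> Y) :
  measure_preserving P f -> measure_preserving Q g ->
  measure_preserving (P \x Q)%E (fun z => (f z.1, g z.2)).
Proof.
move=> [mf Pf] [mg Qg].
have mfg : measurable_fun setT (fun z : X * Y => (f z.1, g z.2)).
  apply: measurable_fun_pair; [exact: (measurableT_comp mf)|exact: (measurableT_comp mg)].
split => // A mA; apply: eq_probability => //.
  by rewrite -[_ @^-1` _]setTI; exact: mfg.
have bA := @bounded_measurable_indic _ _ R A mA.
have b1 := bounded_measurable_comp mfg bA.
rewrite !mean_fubini1//.
rewrite -(mean_comp mf Pf (bounded_measurable_fubini1 P Q bA)).
apply: eq_Rintegral => x _.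
apply: (mean_comp mg Qg (f := fun y => \1_A (f x, y))).
have [mA' [M AM]] := bA; split; last by exists M.
exact: (measurableT_comp mA').
Qed.

Lemma mean_eq0_ae d (X : measurableType d) (P : probability X R) (f : X -> R) :
  bounded_measurable f -> {ae P, forall x, 0 <= f x} -> \int[P]_x f x = 0 ->
  {ae P, forall x, f x = 0}.
Proof.
move=> bf f0 If0; have [mf _] := bf.
have : \int[P]_x `|f x| = 0.
  rewrite -If0; apply: ae_eq_mean => //; first exact: bounded_measurable_norm.
  by apply: filterS f0 => x ?; rewrite ger0_norm.
move=> h; have I0 : (\int[P]_x `|(f x)%:E| = 0)%E.
  rewrite -[LHS]fineK ?[fine _]h//; apply: integrable_fin_num => //.
  by apply: (bounded_measurable_integrable P); exact: bounded_measurable_norm.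
have := (ae_eq_integral_abs P measurableT ((measurable_EFinP _ _).2 mf)).1 I0.
by apply: filterS => x fx0; have [] := fx0 Logic.I.
Qed.

End probability_facts.

(** * Invariant functions and their correlations *)

Section ergodic_facts.
Context {R : realType} {G : groupType}.

(** A single level suffices, the mean [b]: if [F >= b] almost everywhere, or [F < b] almost
    everywhere, then [F - b] has constant sign and mean 0. *)
Lemma ergodic_ae_constant d (Y : measurableType d) (nu : probability Y R)
    (s : G -> Y -> Y) (F : Y -> R) :
  (forall g, measurable_fun setT (s g)) -> ergodic nu s ->
  bounded_measurable F -> (forall g, {ae nu, forall y, F (s g y) = F y}) ->
  {ae nu, forall y, F y = \int[nu]_y F y}.
Proof.
move=> ms es bF Fs; set b := \int[nu]_y F y; have [mF _] := bF.
pose L := [set y | F y < b].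
have mL : measurable L.
  rewrite (_ : L = F @^-1` `]-oo, b[%classic).
    by rewrite -[_ @^-1` _]setTI; apply: mF => //; exact: measurable_itv.
  by apply/seteqP; split => y; rewrite /L /= in_itv.
have bb : bounded_measurable (fun=> b : R) := bounded_measurable_cst b.
have [g|L0|L1] := es L mL.
- apply: ae_invariant_setY => //; first by rewrite -[_ @^-1` _]setTI; exact: ms.
  by apply: filterS (Fs g) => y /= Fy; rewrite /L /= Fy.
- have : {ae nu, forall y, F y - b = 0}.
    apply: mean_eq0_ae; first exact: bounded_measurableB.
      exists L; split => // y /= /negP; rewrite subr_ge0 -ltNge //.
    by rewrite meanB// mean_cst subrr.
  by apply: filterS => y /eqP; rewrite subr_eq0 => /eqP.
- have L1' : nu (~` L) = 0%E by rewrite probability_setC// L1 subee.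
  have : {ae nu, forall y, b - F y = 0}.
    apply: mean_eq0_ae; first exact: bounded_measurableB.
      exists (~` L); split => //; first exact: measurableC.
      by move=> y /= /negP; rewrite subr_ge0 -ltNge /L /= => by_ /(lt_trans by_); rewrite ltxx.
    by rewrite meanB// mean_cst subrr.
  by apply: filterS => y /eqP; rewrite subr_eq0 => /eqP.
Qed.

(** With [u = f - p], the two products differ by [u] times the translate of [f], [f] times the
    translate of [u], and [u] times its own translate. The first two cost at most the L1 norm of [u]
    each, the last its squared L2 norm, and [e ^+ 2 <= e] since [e <= 1]. *)
Lemma correlation_close d (X : measurableType d) (P : probability X R)
    (tau : X -> X) (f p : X -> R) (e : R) : measure_preserving P tau ->
  bounded_measurable f -> bounded_measurable p -> (forall x, `|f x| <= 1) ->
  {ae P, forall x, f (tau x) = f x} -> 0 <= e <= 1 ->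
  \int[P]_x (f x - p x) ^+ 2 <= e ^+ 2 ->
  `|\int[P]_x (p (tau x) * p x) - \int[P]_x f x ^+ 2| <= 3 * e.
Proof.
move=> [mt Pt] bf bp f1 ft /andP[e0 e1] fpe.
pose u x := f x - p x.
have bu : bounded_measurable u by exact: bounded_measurableB.
have bt h : bounded_measurable h -> bounded_measurable (h \o tau).
  exact: bounded_measurable_comp.
have bM := @bounded_measurableM _ X R.
have u2 : \int[P]_x u x ^+ 2 <= e ^+ 2 by [].
have u1 : \int[P]_x `|u x| <= e.
  rewrite -(@ler_pXn2r _ 2)// ?nnegrE//; last exact: mean_ge0.
  apply: le_trans (mean_sqr_le P (bounded_measurable_norm bu)) _.
  by under eq_Rintegral do rewrite real_normK ?num_real//.
have -> : \int[P]_x f x ^+ 2 = \int[P]_x (f (tau x) * f x).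
  apply: ae_eq_mean; [exact: bounded_measurableX|by apply: (bM (f \o tau)) => //; exact: bt|].
  by apply: filterS ft => x ->.
have b1 : bounded_measurable (fun x => p (tau x) * p x) by apply: (bM (p \o tau)) => //; exact: bt.
have b2 : bounded_measurable (fun x => f (tau x) * f x) by apply: (bM (f \o tau)) => //; exact: bt.
rewrite -meanB//.
have bn := @bounded_measurable_norm _ X R.
have but2 : bounded_measurable (fun x => u (tau x) ^+ 2).
  by apply: (bounded_measurableX 2 (f := u \o tau)); exact: bt.
have bu2 : bounded_measurable (fun x => u x ^+ 2) by exact: bounded_measurableX.
have bA : bounded_measurable (fun x => `|u x|) by exact: bn.
have bB : bounded_measurable (fun x => `|u (tau x)|).
  by apply: (bn (u \o tau)); exact: bt.
have bC : bounded_measurable (fun x => 2^-1 * u x ^+ 2) by exact: bounded_measurableZ.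
have bD : bounded_measurable (fun x => 2^-1 * u (tau x) ^+ 2).
  by apply: (bounded_measurableZ _ (f := fun x => u (tau x) ^+ 2)).
have bsum := bounded_measurableD (bounded_measurableD bA bB) (bounded_measurableD bC bD).
apply: le_trans (norm_mean_le P (bounded_measurableB b1 b2)) _.
apply: (@le_trans _ _ (\int[P]_x (`|u x| + `|u (tau x)| +
    (2^-1 * u x ^+ 2 + 2^-1 * u (tau x) ^+ 2)))).
  apply: le_mean => //; first by apply: bn; exact: bounded_measurableB.
  move=> x; have -> : p (tau x) * p x - f (tau x) * f x =
      - (f (tau x) * u x) - u (tau x) * f x + u (tau x) * u x by rewrite /u; ring.
  apply: le_trans (ler_normD _ _) _; apply: lerD.
    apply: le_trans (ler_normB _ _) _; rewrite normrN !normrM.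
    by apply: lerD; [rewrite ler_piMl|rewrite ler_piMr].
  rewrite ler_norml; have := sqr_ge0 (u x + u (tau x)); have := sqr_ge0 (u x - u (tau x)).
  by move=> ? ?; apply/andP; split; nra.
rewrite (meanD P (bounded_measurableD bA bB) (bounded_measurableD bC bD)).
rewrite (meanD P bA bB) (meanD P bC bD).
rewrite !meanZ// (mean_comp mt Pt (bn u bu)) (mean_comp mt Pt bu2).
have : e ^+ 2 <= e by rewrite expr2 ler_piMr.
lra.
Qed.

End ergodic_facts.

(** * Waves and their correlations *)

Section gaussian_waves.
Context {R : realType} {H : completeNormedModType R} (dot : {dot H for idfun}).
Context (normH : norm_from_dot dot).
Context {d : measure_display} {T : measurableType d} {mu : probability T R}.
Context (Z : H -> {RV mu >-> R}) (Z_gauss : gaussian_space Z).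

Lemma gauss_measurable x : measurable_fun setT (Z x).
Proof. by []. Qed.

Lemma gauss_lin k x y : {ae mu, forall w, Z (k *: x + y) w = k * Z x w + Z y w}.
Proof. exact: gaussian_linear. Qed.

Lemma gauss0 : {ae mu, forall w, Z 0 w = 0}.
Proof.
apply: filterS (gauss_lin 1 0 0) => w; rewrite scale1r addr0 mul1r => h.
by apply: (addrI (Z 0 w)); rewrite addr0 -h.
Qed.

Lemma gaussZ k x : {ae mu, forall w, Z (k *: x) w = k * Z x w}.
Proof.
apply: filterS2 (gauss_lin k x 0) gauss0 => w; rewrite addr0 => -> ->.
by rewrite addr0.
Qed.

Lemma gaussD x y : {ae mu, forall w, Z (x + y) w = Z x w + Z y w}.
Proof. by apply: filterS (gauss_lin 1 x y) => w; rewrite scale1r mul1r. Qed.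

Lemma gaussN x : {ae mu, forall w, Z (- x) w = - Z x w}.
Proof. by apply: filterS (gaussZ (-1) x) => w; rewrite scaleN1r mulN1r. Qed.

Lemma gaussB x y : {ae mu, forall w, Z (x - y) w = Z x w - Z y w}.
Proof. by apply: filterS2 (gaussD x (- y)) (gaussN y) => w -> ->. Qed.

Lemma mean_gauss_norm x y (f : R -> R) : bounded_measurable f ->
  `|x| = `|y| -> \int[mu]_w f (Z x w) = \int[mu]_w f (Z y w).
Proof.
move=> bf xy.
have h z : `|z| = `|y| -> \int[mu]_w f (Z z w) = \int[distribution mu (Z y)]_t f t.
  move=> zy; apply: (mean_comp (gauss_measurable z)) => // A mA.
  have := gaussian_law Z_gauss z mA; rewrite zy.
  by have := gaussian_law Z_gauss y mA => <-.
by rewrite !h.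
Qed.

Lemma mean_gauss_normal u (f : R -> R) : bounded_measurable f ->
  `|u| = 1 -> \int[mu]_w f (Z u w) = \int[normal_prob 0 1]_t f t.
Proof.
move=> bf u1.
have mu' : @measurable_fun _ _ T (measurableTypeR R) setT (Z u) by exact: (measurable_funPT (Z u)).
apply: (mean_comp mu' (Q := normal_prob 0 1)) => // A mA.
have := gaussian_law Z_gauss u mA.
by rewrite u1 expr1n /centered_gaussian oner_eq0 sqrtr1.
Qed.

Lemma bounded_measurable_trig (f : R -> R) (d' : measure_display) (X : measurableType d')
    (u : X -> R) : continuous f -> (forall x, `|f x| <= 1) ->
  measurable_fun setT u -> bounded_measurable (fun x => f (u x)).
Proof.
move=> cf f1 mu'; split; last by exists 1.
by apply: measurableT_comp => //; exact: continuous_measurable_fun.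
Qed.

(** The sine is odd, and [Z x] and [Z (- x)] have the same law because that law depends only on the
    norm. *)
Lemma mean_gauss_sin x : \int[mu]_w sin (Z x w) = 0.
Proof.
have bs (y : H) : bounded_measurable (fun w => sin (Z y w)).
  by apply: bounded_measurable_trig; [exact: continuous_sin|exact: norm_sin_le1|].
have bsin : bounded_measurable (@sin R).
  by apply: (bounded_measurable_trig (u := id)); [exact: continuous_sin|exact: norm_sin_le1|].
have := mean_gauss_norm bsin (esym (normrN x)).
rewrite [RHS](@ae_eq_mean _ _ _ _ _ (fun w => -1 * sin (Z x w))) //; last first.
- by apply: filterS (gaussN x) => w ->; rewrite sinN mulN1r.
- exact: bounded_measurableZ.
by rewrite meanZ//; lra.
Qed.

Lemma mean_gauss_cos x : \int[mu]_w cos (Z x w) = expR (- (`|x| ^+ 2 / 2)).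
Proof.
have bc (s : R) (y : H) : bounded_measurable (fun w => cos (s * Z y w)).
  apply: bounded_measurable_trig; [exact: continuous_cos|exact: norm_cos_le1|].
  exact: measurable_funM.
have bc1 (y : H) : bounded_measurable (fun w => cos (Z y w)).
  by apply: bounded_measurable_trig; [exact: continuous_cos|exact: norm_cos_le1|].
(* The zero vector cannot be rescaled to a unit vector, where the law is [normal_prob 0 1]. *)
have [->|x0] := eqVneq x 0.
  rewrite normr0 expr0n mul0r oppr0 expR0 -[RHS](mean_cst mu).
  apply: ae_eq_mean => //; first exact: bounded_measurable_cst.
  by apply: filterS gauss0 => w ->; rewrite cos0.
have xp : 0 < `|x| by rewrite normr_gt0.
pose u := `|x|^-1 *: x.
have u1 : `|u| = 1.
  by rewrite normrZ gtr0_norm ?invr_gt0// mulVf// gt_eqF.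
rewrite (@ae_eq_mean _ _ _ _ _ (fun w => cos (`|x| * Z u w)))//; last first.
  apply: filterS (gaussZ `|x| u) => w <-.
  by rewrite scalerA divff ?gt_eqF// scale1r.
rewrite (@mean_gauss_normal u (fun y => cos (`|x| * y)))//.
  exact: normal_prob_cos.
apply: bounded_measurable_trig; [exact: continuous_cos|exact: norm_cos_le1|].
exact: measurable_funM.
Qed.

Lemma mean_gauss_cosD x th :
  \int[mu]_w cos (Z x w + th) = expR (- (`|x| ^+ 2 / 2)) * cos th.
Proof.
have bs : bounded_measurable (fun w => sin (Z x w)).
  by apply: bounded_measurable_trig; [exact: continuous_sin|exact: norm_sin_le1|].
have bc : bounded_measurable (fun w => cos (Z x w)).
  by apply: bounded_measurable_trig; [exact: continuous_cos|exact: norm_cos_le1|].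
under eq_Rintegral do rewrite cosD mulrC (mulrC (sin _)).
rewrite meanB; [|exact: bounded_measurableZ..].
by rewrite !meanZ// mean_gauss_sin mulr0 subr0 mulrC mean_gauss_cos.
Qed.

Context (a : R) (a0 : 0 < a).

Local Notation X := (T * circle a)%type.
Local Notation muX := ((mu \x circle_prob a0)%E : probability X R).

(** A real form of the characters of the Gaussian space and the circle: the angle [th] provides
    sines as well as cosines, and [wave 0 0 0] is 1 almost everywhere. *)
Definition wave x k th (p : X) : R := cos (Z x p.1 + th + phase k p.2).

Lemma ae_circle_fst (q : T -> Prop) : {ae mu, forall w, q w} ->
  {ae muX, forall p, q p.1}.
Proof.
apply: ae_comp => // A mA; exact: product_fst.
Qed.

Lemma wave_bounded x k th : bounded_measurable (wave x k th).
Proof.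
apply: (bounded_measurable_trig (u := fun p : X => Z x p.1 + th + phase k p.2)).
- exact: continuous_cos.
- exact: norm_cos_le1.
- apply: measurable_funD; last exact: (measurableT_comp (measurable_phase a0 k)).
  apply: measurable_funD => //.
  exact: (measurableT_comp (gauss_measurable x)).
Qed.

Lemma mean_wave x k th : \int[muX]_p wave x k th p =
  if k == 0 then expR (- (`|x| ^+ 2 / 2)) * cos th else 0.
Proof.
rewrite mean_fubini1; last exact: wave_bounded.
rewrite /wave /=; under eq_Rintegral do rewrite mean_cos_phase.
by case: ifP => _; [exact: mean_gauss_cosD|exact: mean_cst].
Qed.

Lemma wave_mul x k th y l ph : {ae muX, forall p, wave x k th p * wave y l ph p =
  2^-1 * wave (x + y) (k + l) (th + ph) p +
  2^-1 * wave (x - y) (k - l) (th - ph) p}.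
Proof.
apply: filterS2 (ae_circle_fst (gaussD x y)) (ae_circle_fst (gaussB x y)).
move=> p hD hB; rewrite /wave hD hB !phaseD phaseN.
set u := Z x p.1 + th + phase k p.2; set v := Z y p.1 + ph + phase l p.2.
rewrite (_ : Z x p.1 + Z y p.1 + _ + _ = u + v); last by rewrite /u /v; ring.
rewrite (_ : Z x p.1 - Z y p.1 + _ + _ = u - v); last by rewrite /u /v; ring.
by rewrite cosD cosB; field.
Qed.

Lemma mean_wave_mul x k th y l ph : \int[muX]_p (wave x k th p * wave y l ph p) =
  2^-1 * (if k + l == 0 then expR (- (`|x + y| ^+ 2 / 2)) * cos (th + ph) else 0) +
  2^-1 * (if k - l == 0 then expR (- (`|x - y| ^+ 2 / 2)) * cos (th - ph) else 0).
Proof.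
have bZ z m t : bounded_measurable (fun p => 2^-1 * wave z m t p).
  by apply: bounded_measurableZ; exact: wave_bounded.
rewrite (ae_eq_mean _ _ (wave_mul x k th y l ph)).
- by rewrite meanD// !meanZ ?mean_wave//; exact: wave_bounded.
- by apply: bounded_measurableM; exact: wave_bounded.
- exact: bounded_measurableD.
Qed.

Context {G : groupType} (pi : G -> {linear H -> H}) (c : G -> H).
Context (opi : orthogonal_representation dot pi) (cc : cocycle pi c).
Context (pihat : G -> T -> T) (pihat_lift : gaussian_lift Z pi pihat).

Local Notation beta := (skew_product Z c pihat (a := a)).

Lemma pihat_preserving g : measure_preserving mu (pihat g).
Proof. by case: (pihat_lift g) => -[]. Qed.

Lemma gauss_pihat g x :
  {ae mu, forall w, Z x (pihat g w) = Z (pi g^-1%g x) w}.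
Proof.
have [_ /(_ (pi g^-1%g x))] := pihat_lift g.
by apply: filterS => w; rewrite (repVK opi).
Qed.

Lemma measurable_circle_translation (u : T -> R) : measurable_fun setT u ->
  measurable_fun setT (fun p : X => p.2 + circle_proj a (u p.1)).
Proof.
move=> mu'.
rewrite (_ : (fun p => _) = circle_proj a \o
    (fun p : X => (circle_section p.2 + u p.1 : measurableTypeR R))); last first.
  by apply/funext => p /=; rewrite circle_projD circle_sectionK.
apply: measurableT_comp; first exact: measurable_circle_proj.
apply: measurable_funD; last exact: (measurableT_comp mu').
exact: (measurableT_comp (measurable_circle_section a0)).
Qed.

Lemma mean_circle_translation (u : T -> R) (f : X -> R) : measurable_fun setT u ->
  bounded_measurable f ->
  \int[muX]_p f (p.1, p.2 + circle_proj a (u p.1)) = \int[muX]_p f p.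
Proof.
move=> mu' bf.
have mt : measurable_fun setT (fun p : X => (p.1, p.2 + circle_proj a (u p.1))).
  by apply: measurable_fun_pair => //; exact: measurable_circle_translation.
rewrite !mean_fubini1//; last exact: (bounded_measurable_comp mt bf).
apply: eq_Rintegral => w _ /=.
apply: (mean_comp (circle_rotation_measurable (u w)) (circle_prob_rotation a0 (u w))
  (f := fun t => f (w, t))).
have [mf [M fM]] := bf; split; last by exists M.
exact: (measurableT_comp mf).
Qed.

(** The map [beta g] is a rotation in each fibre of [fst], followed by the product of [pihat g] with
    the identity. *)
Lemma skew_product_preserving g : measure_preserving muX (beta g).
Proof.
have [mpi Ppi] := pihat_preserving g.
have mb : measurable_fun setT (beta g).
  apply: measurable_fun_pair; first exact: (measurableT_comp mpi).
  by apply: measurable_circle_translation; exact: gauss_measurable.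
split => // A mA; apply: eq_probability => //.
  by rewrite -[_ @^-1` _]setTI; exact: mb.
have bA := @bounded_measurable_indic _ _ R A mA.
have idp : measure_preserving (circle_prob a0) id by split => //; exact: measurable_id.
have [mpid Ppid] := measure_preserving_product (pihat_preserving g) idp.
rewrite -(mean_comp mpid Ppid bA).
have b2 := bounded_measurable_comp mpid bA.
by rewrite -(mean_circle_translation (gauss_measurable (c g^-1%g)) b2).
Qed.

Lemma wave_skew_product g x k th : {ae muX, forall p, wave x k th (beta g p) =
  wave ((2 * trigo.pi / a * k%:~R) *: c g^-1%g + pi g^-1%g x) k th p}.
Proof.
apply: filterS2 (ae_circle_fst (gauss_pihat g x)) (ae_circle_fst
  (gauss_lin (2 * trigo.pi / a * k%:~R) (c g^-1%g) (pi g^-1%g x))).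
move=> p h1 h2; rewrite /wave /= (cos_phase_rotation a0) h1 h2.
congr cos; ring.
Qed.

End gaussian_waves.

(** * Decay of wave correlations *)

Lemma norm_expR_sub1 {R : realType} (t : R) : `|t| <= 2^-1 -> `|expR t - 1| <= 2 * `|t|.
Proof.
move=> t2.
have h1 := expR_ge1Dx t; have h2 := expR_ge1Dx (- t).
have e0 := expR_gt0 t.
have h3 : expR t * (1 - t) <= 1 by rewrite -ler_pdivlMl// mulr1 -expRN.
move: t2; rewrite !ler_norml => /andP[t1 t2].
have [t0|t0] := leP 0 t.
  by rewrite ger0_norm//; apply/andP; split; nra.
by rewrite ltr0_norm//; apply/andP; split; nra.
Qed.

Lemma expR_small {R : realType} (e t : R) : 0 < e -> 1 + 2 / e <= t ->
  expR (- (t ^+ 2 / 2)) < e.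
Proof.
move=> e0 te; have e2 : 0 < 2 / e by rewrite divr_gt0.
have h := expR_ge1Dx (t ^+ 2 / 2).
rewrite expRN invf_plt ?posrE ?expR_gt0//; apply: lt_le_trans h.
have -> : e^-1 = (2 / e) / 2 by field; rewrite gt_eqF.
by nra.
Qed.

Section correlation.
Context {R : realType} {H : completeNormedModType R} (dot : {dot H for idfun}).
Context (normH : norm_from_dot dot).
Context {d : measure_display} {T : measurableType d} {mu : probability T R}.
Context (Z : H -> {RV mu >-> R}) (Z_gauss : gaussian_space Z).
Context (a : R) (a0 : 0 < a).
Context {G : groupType} (pi : G -> {linear H -> H}) (c : G -> H).
Context (opi : orthogonal_representation dot pi) (cc : cocycle pi c).
Context (pihat : G -> T -> T) (pihat_lift : gaussian_lift Z pi pihat).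

Local Notation X := (T * circle a)%type.
Local Notation muX := ((mu \x circle_prob a0)%E : probability X R).
Local Notation beta := (skew_product Z c pihat (a := a)).

Lemma cocycleV g : `|c g^-1%g| = `|c g|.
Proof.
have c1 : c 1%g = 0.
  by apply: (addrI (c 1%g)); rewrite addr0 -{3}(mulg1 1%g) cc (rep1 opi).
have : c g^-1%g + pi g^-1%g (c g) = 0 by rewrite -cc mulVg.
by move=> /eqP; rewrite addr_eq0 => /eqP ->; rewrite normrN (rep_norm normH opi).
Qed.

Lemma mean_wave_correlation g x k th y l ph :
  let x' := (2 * trigo.pi / a * k%:~R) *: c g^-1%g + pi g^-1%g x in
  \int[muX]_p (wave Z x k th (beta g p) * wave Z y l ph p) =
  2^-1 * (if k + l == 0 then expR (- (`|x' + y| ^+ 2 / 2)) * cos (th + ph) else 0) +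
  2^-1 * (if k - l == 0 then expR (- (`|x' - y| ^+ 2 / 2)) * cos (th - ph) else 0).
Proof.
move=> x'; rewrite -(mean_wave_mul Z_gauss a0).
have [mb Pb] := skew_product_preserving a0 c pihat_lift g.
apply: ae_eq_mean.
- apply: bounded_measurableM; last exact: (wave_bounded Z a0).
  exact: (bounded_measurable_comp mb (wave_bounded Z a0 x k th)).
- by apply: bounded_measurableM; exact: (wave_bounded Z a0).
- apply: filterS (wave_skew_product Z_gauss a0 c opi pihat_lift g x k th) => p -> //.
Qed.

(** If [k = 0], the cocycle drops out of [x'], and only the cross term [dot x' y], small for the
    chosen [g], separates the correlation from the product of the means. If [k] is nonzero, the
    product of the means vanishes, and the correlation is at most [e] because [x'] is far from both
    [y] and [- y]. *)
Lemma wave_correlation (s : seq (H * int * R)) e :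
  weakly_mixing_representation pi -> ~ coboundary pi c -> 0 < e ->
  exists g, forall p q, p \in s -> q \in s ->
    `|\int[muX]_x (wave Z p.1.1 p.1.2 p.2 (beta g x) * wave Z q.1.1 q.1.2 q.2 x) -
      (\int[muX]_x wave Z p.1.1 p.1.2 p.2 x) * (\int[muX]_x wave Z q.1.1 q.1.2 q.2 x)| <= e.
Proof.
move=> wm ncb e0.
pose C := \sum_(p <- s) `|p.1.1|.
have Cle p : p \in s -> `|p.1.1| <= C.
  move=> ps; rewrite /C (big_rem p)//= lerDl.
  by apply: sumr_ge0.
(* 1 / 2 is the range of [norm_expR_sub1], and [e / 2] pays for the factor 2 in its conclusion. *)
pose eta := Num.min 2^-1 (e / 2).
have eta0 : 0 < eta by rewrite lt_min invr_gt0 divr_gt0// ltr0n.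
have [eta1 eta2] : eta <= 2^-1 /\ eta <= e / 2 by rewrite /eta !ge_min !lexx orbT.
pose sc := 2 * trigo.pi / a : R.
have sc0 : 0 < sc by rewrite /sc divr_gt0// mulr_gt0// pi_gt0.
(* For |k| >= 1, |x' + z| >= sc |c g| - |x| - |z|, and the vectors have norm at most [C]; this size
   of [c g] therefore reaches the threshold [1 + 2 / e] of [expR_small]. *)
have [g [gsmall gc]] := weakly_mixing_small_unbounded normH opi cc
  [seq p.1.1 | p <- s] ((1 + 2 / e + 2 * C) / sc) wm ncb eta0.
exists g => -[[x k] th] [[y l] ph] ps qs /=.
rewrite mean_wave_correlation !(mean_wave Z_gauss a0) -/sc.
set x' := _ + pi g^-1%g x.
have [k0|k0] := eqVneq k 0.
  have x'E : x' = pi g^-1%g x by rewrite /x' k0 mulr0 scale0r add0r.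
  rewrite k0 add0r sub0r oppr_eq0.
  have [l0|l0] := eqVneq l 0; last by rewrite !mulr0 addr0 subrr normr0 ltW.
  have D : `|dot x' y| <= eta.
    rewrite x'E (rep_dotl opi) invgK dotC ltW//.
    by apply: gsmall; [exact: (map_f (fun p => p.1.1) qs)|exact: (map_f (fun p => p.1.1) ps)].
  have nx : `|x'| = `|x| by rewrite x'E (rep_norm normH opi).
  rewrite (normD_sqr normH) (normB_sqr normH) nx.
  set t := dot x' y in D *; set E1 := expR (- (`|x| ^+ 2 / 2)); set E2 := expR (- (`|y| ^+ 2 / 2)).
  rewrite (_ : expR (- ((`|x| ^+ 2 + 2 * t + _) / 2)) = E1 * E2 * expR (- t)); last first.
    by rewrite /E1 /E2 -!expRD; congr expR; field.
  rewrite (_ : expR (- ((`|x| ^+ 2 - 2 * t + _) / 2)) = E1 * E2 * expR t); last first.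
    by rewrite /E1 /E2 -!expRD; congr expR; field.
  have E1l : 0 <= E1 <= 1.
    by rewrite /E1 expR_ge0 -[leRHS]expR0 ler_expR oppr_le0 divr_ge0// sqr_ge0.
  have E2l : 0 <= E2 <= 1.
    by rewrite /E2 expR_ge0 -[leRHS]expR0 ler_expR oppr_le0 divr_ge0// sqr_ge0.
  have El : 0 <= E1 * E2 <= 1.
    by move: E1l E2l => /andP[? ?] /andP[? ?]; rewrite mulr_ge0//= mulr_ile1.
  (* The product of the means is E1 E2 cos th cos ph; the product formula for cosines distributes it
     over the two halves. *)
  rewrite (_ : _ - _ = E1 * E2 * (2^-1 * ((expR (- t) - 1) * cos (th + ph)) +
      2^-1 * ((expR t - 1) * cos (th - ph)))); last by rewrite cosD cosB; field.
  move: El => /andP[E0 El]; rewrite normrM (ger0_norm E0).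
  set r := `|_ + _|.
  have re : r <= e; last by rewrite (le_trans _ re)// ler_piMl// normr_ge0.
  rewrite /r (le_trans (ler_normD _ _))// !normrM !(ger0_norm (_ : 0 <= 2^-1))//.
  have n1 := norm_expR_sub1 (le_trans D eta1).
  have n2 : `|expR (- t) - 1| <= 2 * `|t|.
    by rewrite -(normrN t); apply: norm_expR_sub1; rewrite normrN (le_trans D).
  have c1 := norm_cos_le1 (th + ph); have c2 := norm_cos_le1 (th - ph).
  have m1 : `|expR (- t) - 1| * `|cos (th + ph)| <= 2 * `|t|.
    by rewrite -[leRHS]mulr1 ler_pM.
  have m2 : `|expR t - 1| * `|cos (th - ph)| <= 2 * `|t|.
    by rewrite -[leRHS]mulr1 ler_pM.
  lra.
rewrite mul0r subr0.
have far z : `|z| <= C -> 1 + 2 / e <= `|x' + z|.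
  move=> zC.
  have h1 : `|(sc * k%:~R) *: c g^-1%g| <= `|x' + z| + `|x| + `|z|.
    have -> : (sc * k%:~R) *: c g^-1%g = (x' + z) - (pi g^-1%g x + z).
      by rewrite opprD addrACA subrr addr0 /x' addrK.
    apply: le_trans (ler_normB _ _) _; rewrite -[leRHS]addrA lerD2l.
    by apply: le_trans (ler_normD _ _) _; rewrite (rep_norm normH opi).
  have k1 : 1 <= `|k%:~R : R|.
    rewrite -intr_norm -[leLHS]/(1%:~R) ler_int.
    by rewrite -gtz0_ge1 normr_gt0.
  have h2 : sc * `|c g| <= `|(sc * k%:~R) *: c g^-1%g|.
    rewrite normrZ normrM (gtr0_norm sc0) cocycleV -[leRHS]mulrA ler_pM2l//.
    by rewrite ler_peMl.
  move: gc; rewrite ltr_pdivrMr// mulrC => /ltW gc.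
  have := Cle _ ps; rewrite /= => xC; lra.
have bound (b : bool) z v : `|z| <= C ->
    `|(if b then expR (- (`|x' + z| ^+ 2 / 2)) * cos v else 0)| <= e.
  move=> zC; case: b; last by rewrite normr0 ltW.
  rewrite normrM (ger0_norm (expR_ge0 _)) -[leRHS]mulr1 ler_pM ?norm_cos_le1 ?expR_ge0//.
  by apply/ltW/expR_small => //; exact: far.
rewrite (le_trans (ler_normD _ _))// !normrM !(ger0_norm (_ : 0 <= 2^-1))//.
have b1 := bound (k + l == 0) y (th + ph) (Cle _ qs).
have b2 := bound (k - l == 0) (- y) (th - ph) _.
rewrite normrN in b2; have {}b2 := b2 (Cle _ qs).
lra.
Qed.

End correlation.

(** * Density of the waves *)

Section wave_sums.
Context {R : realType} {H : completeNormedModType R} (dot : {dot H for idfun}).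
Context (normH : norm_from_dot dot).
Context {d : measure_display} {T : measurableType d} {mu : probability T R}.
Context (Z : H -> {RV mu >-> R}) (Z_gauss : gaussian_space Z).
Context (a : R) (a0 : 0 < a).
Context {d' : measure_display} {Y : measurableType d'} (nu : probability Y R).

Local Notation X := (T * circle a)%type.
Local Notation muX := ((mu \x circle_prob a0)%E : probability X R).
Local Notation muXY := ((muX \x nu)%E : probability (X * Y)%type R).

(** A multiple of a wave times the indicator of a set in the second factor [Y]. The measurability
    proof is stored so that every list of terms denotes a bounded measurable function. *)
Record wave_term := WaveTerm {
  wave_coef : R; wave_vec : H; wave_freq : int; wave_angle : R;
  wave_base : set Y; wave_base_measurable : measurable wave_base }.

Definition wave_of (p : wave_term) : X -> R :=
  wave Z (wave_vec p) (wave_freq p) (wave_angle p).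

Definition wave_eval (p : wave_term) (z : X * Y) : R :=
  wave_coef p * (wave_of p z.1 * \1_(wave_base p) z.2).

Definition wave_sum (s : seq wave_term) (z : X * Y) := \sum_(p <- s) wave_eval p z.

Definition wave_sums : set (X * Y -> R) := range wave_sum.

Lemma wave_of_bounded p : bounded_measurable (wave_of p).
Proof. exact: (wave_bounded Z a0). Qed.

Lemma wave_base_bounded (p : wave_term) : bounded_measurable (\1_(wave_base p) : Y -> R).
Proof. exact: bounded_measurable_indic (wave_base_measurable p). Qed.

Lemma wave_eval_bounded p : bounded_measurable (wave_eval p).
Proof.
apply: bounded_measurableZ; apply: bounded_measurableM.
  exact: (bounded_measurable_comp measurable_fst (wave_of_bounded p)).
exact: (bounded_measurable_comp measurable_snd (wave_base_bounded p)).
Qed.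

Lemma wave_sum_bounded s : bounded_measurable (wave_sum s).
Proof.
elim: s => [|p s IH].
  rewrite (_ : wave_sum _ = fun=> 0); first exact: bounded_measurable_cst.
  by apply/funext => z; rewrite /wave_sum big_nil.
rewrite (_ : wave_sum _ = fun z => wave_eval p z + wave_sum s z).
  by apply: bounded_measurableD => //; exact: wave_eval_bounded.
by apply/funext => z; rewrite /wave_sum big_cons.
Qed.

Lemma ae_wave_fst (q : X -> Prop) : {ae muX, forall p, q p} ->
  {ae muXY, forall z, q z.1}.
Proof. by apply: ae_comp => // A mA; exact: product_fst. Qed.

Lemma wave_sums_cst k : exists2 h, wave_sums h & {ae muXY, forall z, k = h z}.
Proof.
pose p := WaveTerm k 0 0 0 (@measurableT _ Y).
exists (wave_sum [:: p]); first by exists [:: p].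
apply: filterS (ae_wave_fst (ae_circle_fst a0 (gauss0 Z_gauss))) => z h.
rewrite /wave_sum big_cons big_nil addr0 /wave_eval /wave_of /wave /= h phase0.
by rewrite !addr0 cos0 mul1r indicT /= mulr1.
Qed.

Lemma wave_sums_lin k f g : wave_sums f -> wave_sums g ->
  wave_sums (fun z => k * f z + g z).
Proof.
move=> [s _ <-] [t _ <-].
pose scale p := WaveTerm (k * wave_coef p) (wave_vec p) (wave_freq p) (wave_angle p)
  (wave_base_measurable p).
exists (map scale s ++ t) => //; apply/funext => z.
rewrite /wave_sum big_cat big_map mulr_sumr; congr (_ + _).
by apply: eq_bigr => p _; rewrite /wave_eval /wave_of /=; ring.
Qed.

Lemma wave_eval_mul p q : exists2 h, wave_sums h &
  {ae muXY, forall z, wave_eval p z * wave_eval q z = h z}.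
Proof.
have mB := measurableI _ _ (wave_base_measurable p) (wave_base_measurable q).
pose k := wave_coef p * wave_coef q / 2.
pose r1 := WaveTerm k (wave_vec p + wave_vec q) (wave_freq p + wave_freq q)
  (wave_angle p + wave_angle q) mB.
pose r2 := WaveTerm k (wave_vec p - wave_vec q) (wave_freq p - wave_freq q)
  (wave_angle p - wave_angle q) mB.
exists (wave_sum [:: r1; r2]); first by exists [:: r1; r2].
apply: filterS (ae_wave_fst (wave_mul Z_gauss a0 (wave_vec p) (wave_freq p)
  (wave_angle p) (wave_vec q) (wave_freq q) (wave_angle q))) => z h.
rewrite /wave_sum !big_cons big_nil addr0.
rewrite /wave_eval /= indicI /=.
rewrite (_ : _ * _ = wave_coef p * wave_coef q * (wave_of p z.1 * wave_of q z.1) *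
  (\1_(wave_base p) z.2 * \1_(wave_base q) z.2)); last by ring.
by rewrite h /k /wave_of /=; field.
Qed.

Lemma wave_sums_mul f g : wave_sums f -> wave_sums g ->
  exists2 h, wave_sums h & {ae muXY, forall z, f z * g z = h z}.
Proof.
have step (f1 f2 g1 : X * Y -> R) :
    (exists2 h, wave_sums h & {ae muXY, forall z, f1 z * g1 z = h z}) ->
    (exists2 h, wave_sums h & {ae muXY, forall z, f2 z * g1 z = h z}) ->
    exists2 h, wave_sums h & {ae muXY, forall z, (f1 z + f2 z) * g1 z = h z}.
  move=> [h1 Ah1 fh1] [h2 Ah2 fh2]; exists (fun z => 1 * h1 z + h2 z).
    exact: wave_sums_lin.
  by apply: filterS2 fh1 fh2 => z <- <-; rewrite mul1r mulrDl.
have nil_ (g1 : X * Y -> R) :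
    exists2 h, wave_sums h & {ae muXY, forall z, wave_sum [::] z * g1 z = h z}.
  exists (wave_sum [::]); first by exists [::].
  by apply: aeW => z; rewrite /wave_sum !big_nil mul0r.
move=> [s _ <-] [t _ <-].
elim: s => [|p s IH]; first exact: nil_.
rewrite (_ : wave_sum (p :: s) = fun z => wave_eval p z + wave_sum s z); last first.
  by apply/funext => z; rewrite /wave_sum big_cons.
apply: (step) => //; elim: t {IH} => [|q t IH].
  have [h Ah fh] := nil_ (wave_eval p); exists h => //.
  by apply: filterS fh => z; rewrite mulrC.
have [h Ah fh] : exists2 h, wave_sums h & {ae muXY, forall z,
    (wave_eval q z + wave_sum t z) * wave_eval p z = h z}.
  apply: (step) => //; first exact: wave_eval_mul.
  have [h1 Ah1 fh1] := IH; exists h1 => //.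
  by apply: filterS fh1 => z; rewrite mulrC.
exists h => //; apply: filterS fh => z; rewrite mulrC.
by rewrite /wave_sum big_cons.
Qed.

Local Notation approximable := (L2_approximable muXY wave_sums).
Local Notation approximable_set := (L2_approximable_set muXY wave_sums).

Lemma wave_sums_bounded f : wave_sums f -> bounded_measurable f.
Proof. by move=> [s _ <-]; exact: wave_sum_bounded. Qed.

Lemma wave_sigma_algebra : sigma_algebra setT approximable_set.
Proof.
exact: (L2_approximable_sigma_algebra wave_sums_bounded wave_sums_cst
  wave_sums_lin wave_sums_mul).
Qed.

Lemma approximable_set_ae A B : approximable_set B -> measurable A ->
  {ae muXY, forall z, A z <-> B z} -> approximable_set A.
Proof.
move=> [mB aB] mA AB; split => //.
apply: (L2_approximable_ae wave_sums_bounded _ aB).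
  exact: bounded_measurable_indic.
apply: filterS AB => z ABz; rewrite !indicE.
have [Bz|nBz] := pselect (B z); first by rewrite !mem_set// ABz.
by rewrite !memNset// ABz.
Qed.

Lemma approximable_wave_lt0 x k th :
  approximable_set [set z | wave Z x k th z.1 < 0].
Proof.
have mw : measurable_fun setT (fun z : X * Y => wave Z x k th z.1).
  by apply: (measurableT_comp (f := wave Z x k th)) => //; case: (wave_bounded Z a0 x k th).
split.
  rewrite (_ : [set z | _] = (fun z : X * Y => wave Z x k th z.1) @^-1` `]-oo, 0[%classic).
    by rewrite -[_ @^-1` _]setTI; apply: mw => //; exact: measurable_itv.
  by apply/seteqP; split => z; rewrite /= in_itv.
apply: (L2_approximable_lt0 wave_sums_bounded wave_sums_cst wave_sums_lin wave_sums_mul).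
pose p := WaveTerm 1 x k th (@measurableT _ Y).
apply: (L2_approximable_base _ wave_sums_bounded); exists [:: p] => //.
apply/funext => z; rewrite /wave_sum big_cons big_nil addr0 /wave_eval /wave_of /=.
by rewrite indicT /= mulr1 mul1r.
Qed.

Lemma approximable_snd D : measurable D -> approximable_set (snd @^-1` D).
Proof.
move=> mD; split; first by rewrite -[_ @^-1` _]setTI; exact: measurable_snd.
pose p := WaveTerm 1 0 0 0 mD.
apply: (L2_approximable_ae wave_sums_bounded (g := wave_sum [:: p])).
- by apply: bounded_measurable_indic; rewrite -[_ @^-1` _]setTI; exact: measurable_snd.
- by apply: (L2_approximable_base _ wave_sums_bounded); exists [:: p].
- apply: filterS (ae_wave_fst (ae_circle_fst a0 (gauss0 Z_gauss))) => z h.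
  rewrite /wave_sum big_cons big_nil addr0 /wave_eval /wave_of /wave /= h phase0.
  by rewrite !addr0 cos0 !mul1r !indicE.
Qed.

Lemma approximable_circle C : measurable C ->
  approximable_set ((fun z : X * Y => z.1.2) @^-1` C).
Proof.
move=> mC; have sS := sigma_algebra_preimage_in (fun z : X * Y => z.1.2) wave_sigma_algebra.
apply: (circle_generated a0 sS) mC => r /=.
have mf : measurable_fun setT (fun z : X * Y => z.1.2).
  exact: (measurableT_comp measurable_snd measurable_fst).
pose C0 := [set t : circle a | sin (2 * trigo.pi / a * (circle_section t - r)) < 0].
have mC0 : measurable C0.
  have ms : measurable_fun setT (fun t : circle a => sin (2 * trigo.pi / a * (circle_section t - r))).
    apply: (measurableT_comp (f := @sin R)).
      by apply: continuous_measurable_fun; exact: continuous_sin.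
    apply: measurable_funM => //; apply: measurable_funB => //.
    exact: (measurable_circle_section a0).
  rewrite (_ : C0 = (fun t : circle a => sin (2 * trigo.pi / a * (circle_section t - r))) @^-1` `]-oo, 0[%classic).
    by rewrite -[_ @^-1` _]setTI; apply: ms => //; exact: measurable_itv.
  by apply/seteqP; split => z; rewrite /C0 /= in_itv.
(* This wave is sin (2 pi (t - r) / a) almost everywhere: the vector 0 switches off the Gaussian
   part, and the angle - pi / 2 turns the cosine into a sine. *)
apply: (approximable_set_ae (approximable_wave_lt0 0 1 (- (2 * trigo.pi / a * r) - trigo.pi / 2))).
  by have := mf measurableT _ mC0; rewrite setTI.
apply: filterS (ae_wave_fst (ae_circle_fst a0 (gauss0 Z_gauss))) => z h.
rewrite /= /wave h /phase (_ : 0 + _ + _ =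
  2 * trigo.pi / a * (circle_section z.1.2 - r) - trigo.pi / 2); last by ring.
by rewrite cosBpihalf.
Qed.

(* t < r holds iff sin ((t - r) / n) < 0 for all large n. *)
Lemma approximable_gauss_lt x r :
  approximable_set [set z | Z x z.1.1 < r].
Proof.
have sS := wave_sigma_algebra; have [S0 SC SU] := sS.
have SCc A : approximable_set A -> approximable_set (~` A) by move=> /SC; rewrite setTD.
have mf : measurable_fun setT (fun z : X * Y => z.1.1).
  exact: (measurableT_comp measurable_fst measurable_fst).
pose V n : set (X * Y) := [set z | sin ((Z x z.1.1 - r) / n.+1%:R) < 0].
have aV n : approximable_set (V n).
  apply: (approximable_set_ae (approximable_wave_lt0 (n.+1%:R^-1 *: x) 0
    (- (r / n.+1%:R) - trigo.pi / 2))).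
    have ms : measurable_fun setT (fun z : X * Y => sin ((Z x z.1.1 - r) / n.+1%:R)).
      apply: (measurableT_comp (f := @sin R)).
        by apply: continuous_measurable_fun; exact: continuous_sin.
      apply: measurable_funM => //; apply: measurable_funB => //.
      exact: (measurableT_comp (gauss_measurable Z x)).
    rewrite (_ : V n = (fun z => sin ((Z x z.1.1 - r) / n.+1%:R)) @^-1` `]-oo, 0[%classic).
      by rewrite -[_ @^-1` _]setTI; apply: ms => //; exact: measurable_itv.
    by apply/seteqP; split => z; rewrite /V /= in_itv.
  apply: filterS (ae_wave_fst (ae_circle_fst a0 (gaussZ Z_gauss n.+1%:R^-1 x))) => z h.
  rewrite /V /= /wave h phase0 addr0 addrA cosBpihalf.
  by rewrite (_ : _ * Z x z.1.1 - _ = (Z x z.1.1 - r) / n.+1%:R)//; ring.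
have VU N : approximable_set (~` \bigcup_n ~` V (N + n)%N).
  by apply: (SCc _); apply: SU => n; apply: SCc.
(* A condition that holds eventually: a countable union of countable intersections, the latter
   written through complements. *)
rewrite (_ : [set z | _] = \bigcup_N ~` \bigcup_n ~` V (N + n)%N); first exact: SU.
have pi0 := trigo.pi_gt0 R.
(* Past [N] the argument lies in (- pi, pi), where the sine has the sign of its argument. *)
have bigN (t : R) : exists N : nat, forall n, (N <= n)%N -> `|t / n.+1%:R| < trigo.pi.
  have [N HN] : exists N : nat, `|t| / trigo.pi < N%:R.
    by exists (Num.trunc (`|t| / trigo.pi)).+1; exact: truncnS_gt.
  exists N => n Nn; rewrite normrM normfV (ger0_norm (ler0n _ n.+1)).
  rewrite ltr_pdivrMr//; move: HN; rewrite (ltr_pdivrMr _ _ pi0) => /lt_le_trans; apply.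
  by rewrite mulrC (ler_pM2l pi0) ler_nat leqW.
apply/seteqP; split => z /=.
  move=> zr; have [N HN] := bigN (Z x z.1.1 - r).
  exists N => //= -[n _]; apply; rewrite /V /=.
  have := HN (N + n)%N (leq_addr _ _); rewrite ltr_norml => /andP[h1 h2].
  have neg : (Z x z.1.1 - r) / (N + n).+1%:R < 0 by rewrite pmulr_llt0// subr_lt0.
  move: (_ / _) h1 h2 neg => t h1 h2 neg.
  by rewrite sin_lt0 ?h1 ?neg//; apply/andP; split; lra.
move=> [N _ NV]; rewrite ltNge; apply/negP => rz; apply: NV.
have [M HM] := bigN (Z x z.1.1 - r).
exists M => //; rewrite /V /=; apply/negP; rewrite -leNgt.
have := HM (N + M)%N (leq_addl _ _); rewrite ltr_norml => /andP[h1 h2].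
by rewrite sin_ge0_pi// divr_ge0 ?subr_ge0//= ltW.
Qed.

(** The Gaussian variables generate [A] only up to a null set, which approximability ignores. *)
Lemma approximable_gauss A : measurable A ->
  approximable_set ((fun z : X * Y => z.1.1) @^-1` A).
Proof.
move=> mA; have sS := sigma_algebra_preimage_in (fun z : X * Y => z.1.1) wave_sigma_algebra.
have mf : measurable_fun setT (fun z : X * Y => z.1.1).
  exact: (measurableT_comp measurable_fst measurable_fst).
have [B GB AB0] := gaussian_generated Z_gauss mA.
have aB : approximable_set ((fun z : X * Y => z.1.1) @^-1` B).
  apply: (smallest_sub sS) GB => _ [x _ [E mE <-]]; rewrite setTI /=.
  apply: (@borel_preimage_generated R _ approximable_set (fun z : X * Y => Z x z.1.1)) => //.
    exact: wave_sigma_algebra.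
  by move=> r; exact: approximable_gauss_lt.
apply: (approximable_set_ae aB).
  by rewrite -[_ @^-1` _]setTI; exact: mf.
have mB : measurable B.
  apply: (smallest_sub (sigma_algebra_measurable T)) GB => _ [x _ [E mE <-]].
  exact: gauss_measurable.
apply: (ae_wave_fst (q := fun p => A p.1 <-> B p.1)); apply: (ae_circle_fst a0 (q := fun w => A w <-> B w)).
exists (A `+` B); split => //; first by apply: measurableU; exact: measurableD.
move=> w /= nAB; have [Aw|Aw] := pselect (A w); have [Bw|Bw] := pselect (B w).
- by exfalso; apply: nAB.
- by left.
- by right.
- by exfalso; apply: nAB.
Qed.

Lemma approximable_measurable B : measurable B -> approximable (\1_B).
Proof.
move=> mB; suff [] : approximable_set B by [].
apply: (product_generated wave_sigma_algebra) mB => [|]; last exact: approximable_snd.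
move=> A mA; have sS := sigma_algebra_preimage_in (@fst X Y) wave_sigma_algebra.
apply: (product_generated sS) mA => /= E mE; rewrite -comp_preimage.
  exact: approximable_gauss.
exact: approximable_circle.
Qed.

End wave_sums.

(** * Weak mixing of the skew product *)

Section skew_product_weakly_mixing.
Context {R : realType} {H : completeNormedModType R} (dot : {dot H for idfun}).
Context (normH : norm_from_dot dot).
Context {d : measure_display} {T : measurableType d} {mu : probability T R}.
Context (Z : H -> {RV mu >-> R}) (Z_gauss : gaussian_space Z).
Context (a : R) (a0 : 0 < a).
Context {G : groupType} (pi : G -> {linear H -> H}) (c : G -> H).
Context (opi : orthogonal_representation dot pi) (cc : cocycle pi c).
Context (pihat : G -> T -> T) (pihat_lift : gaussian_lift Z pi pihat).

Local Notation X := (T * circle a)%type.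
Local Notation muX := ((mu \x circle_prob a0)%E : probability X R).
Local Notation beta := (skew_product Z c pihat (a := a)).

(** When both sides are expanded, the terms of index [i], [j] differ only in that the correlation of
    the two waves is replaced by the product of their means; the factors from [Y] are means of
    functions bounded by 1. *)
Lemma wave_sum_correlation d' (Y : measurableType d') (nu : probability Y R)
    (sigma : Y -> Y) g (s : seq (@wave_term R H d' Y)) e :
  measure_preserving nu sigma ->
  (forall p q, p \in [seq (wave_vec p, wave_freq p, wave_angle p) | p <- s] ->
    q \in [seq (wave_vec p, wave_freq p, wave_angle p) | p <- s] ->
    `|\int[muX]_x (wave Z p.1.1 p.1.2 p.2 (beta g x) * wave Z q.1.1 q.1.2 q.2 x) -
      (\int[muX]_x wave Z p.1.1 p.1.2 p.2 x) * (\int[muX]_x wave Z q.1.1 q.1.2 q.2 x)| <= e) ->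
  `|\int[(muX \x nu)%E]_z
      (wave_sum Z s (beta g z.1, sigma z.2) * wave_sum Z s z) -
    \int[nu]_y ((\int[muX]_x wave_sum Z s (x, sigma y)) *
      (\int[muX]_x wave_sum Z s (x, y)))|
  <= (\sum_(p <- s) `|wave_coef p|) ^+ 2 * e.
Proof.
move=> [msig Psig] corr.
pose P : X * Y -> R := wave_sum Z s.
pose M y := \int[muX]_x P (x, y).
rewrite -/P -/(M _).
pose n := size s; pose q (i : 'I_n) := tnth (in_tuple s) i.
have [mb Pb] := skew_product_preserving a0 c pihat_lift g.
pose w i : X -> R := wave_of Z (q i).
pose D i : Y -> R := \1_(wave_base (q i)).
pose k i := wave_coef (q i).
pose m i := \int[muX]_x w i x.
have bw i : bounded_measurable (w i) by exact: (wave_of_bounded Z a0).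
have bwb i : bounded_measurable (fun x => w i (beta g x)) by exact: (bounded_measurable_comp mb (bw i)).
have bD i : bounded_measurable (D i) by exact: wave_base_bounded.
have bDs i : bounded_measurable (fun y => D i (sigma y)) by exact: (bounded_measurable_comp msig (bD i)).
have PE z : P z = \sum_i k i * (w i z.1 * D i z.2).
  by rewrite /P /wave_sum big_tnth.
have ME y : M y = \sum_i k i * m i * D i y.
  rewrite /M; under eq_Rintegral do rewrite PE /=.
  have bkw i : bounded_measurable (fun x => k i * (w i x * D i y)).
    apply: bounded_measurableZ; apply: bounded_measurableM; first exact: bw.
    exact: bounded_measurable_cst.
  rewrite mean_sum//; apply: eq_bigr => i _.
  have bwD : bounded_measurable (fun x => w i x * D i y).
    by apply: bounded_measurableM; [exact: bw|exact: bounded_measurable_cst].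
  rewrite meanZ// -mulrA; congr (_ * _).
  under eq_Rintegral do rewrite mulrC.
  by rewrite meanZ// mulrC.
pose cor i j := \int[muX]_x (w i (beta g x) * w j x).
pose dd i j := \int[nu]_y (D i (sigma y) * D j y).
have bww i j : bounded_measurable (fun x => w i (beta g x) * w j x) by exact: bounded_measurableM.
have bDD i j : bounded_measurable (fun y => D i (sigma y) * D j y) by exact: bounded_measurableM.
have E1 : \int[(muX \x nu)%E]_z (P (beta g z.1, sigma z.2) * P z) =
    \sum_i \sum_j k i * k j * (cor i j * dd i j).
  under eq_Rintegral do rewrite !PE /= big_distrlr /=.
  have bt i j : bounded_measurable (fun z : X * Y =>
      (k i * (w i (beta g z.1) * D i (sigma z.2))) * (k j * (w j z.1 * D j z.2))).
    have b1 (f : X -> R) : bounded_measurable f -> bounded_measurable (fun z : X * Y => f z.1).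
      exact: (bounded_measurable_comp measurable_fst).
    have b2 (f : Y -> R) : bounded_measurable f -> bounded_measurable (fun z : X * Y => f z.2).
      exact: (bounded_measurable_comp measurable_snd).
    apply: bounded_measurableM; apply: bounded_measurableZ; apply: bounded_measurableM.
    - exact: (b1 _ (bwb i)).
    - exact: (b2 _ (bDs i)).
    - exact: (b1 _ (bw j)).
    - exact: (b2 _ (bD j)).
  rewrite mean_sum; last by move=> i; apply: bounded_measurable_sum => j; exact: bt.
  apply: eq_bigr => i _; rewrite mean_sum//; apply: eq_bigr => j _.
  rewrite /cor /dd -(mean_prod muX nu (bww i j) (bDD i j)) -meanZ.
    by apply: eq_Rintegral => z _; ring.
  apply: bounded_measurableM.
    exact: (bounded_measurable_comp measurable_fst (bww i j)).
  exact: (bounded_measurable_comp measurable_snd (bDD i j)).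
have E2 : \int[nu]_y (M (sigma y) * M y) =
    \sum_i \sum_j k i * k j * (m i * m j * dd i j).
  under eq_Rintegral do rewrite !ME big_distrlr /=.
  have bt i j : bounded_measurable (fun y => (k i * m i * D i (sigma y)) * (k j * m j * D j y)).
    by apply: bounded_measurableM; apply: bounded_measurableZ; [exact: bDs|exact: bD].
  rewrite mean_sum; last by move=> i; apply: bounded_measurable_sum => j; exact: bt.
  apply: eq_bigr => i _; rewrite mean_sum//; apply: eq_bigr => j _.
  rewrite /dd mulrA -meanZ//.
  by apply: eq_Rintegral => y _; ring.
rewrite E1 E2 -sumrB.
have -> : (\sum_(p <- s) `|wave_coef p|) ^+ 2 * e = \sum_i \sum_j `|k i| * `|k j| * e.
  rewrite big_tnth expr2 big_distrlr /= mulr_suml; apply: eq_bigr => i _.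
  by rewrite mulr_suml.
apply: le_trans (ler_norm_sum _ _ _) _; apply: ler_sum => i _.
rewrite -sumrB; apply: le_trans (ler_norm_sum _ _ _) _; apply: ler_sum => j _.
rewrite -mulrBr -mulrBl !normrM -[leRHS]mulr1 -!mulrA !ler_wpM2l//.
have mem_q l : (wave_vec (q l), wave_freq (q l), wave_angle (q l)) \in
    [seq (wave_vec p, wave_freq p, wave_angle p) | p <- s].
  apply/(nthP (0, 0, 0)); exists l; first by rewrite size_map.
  have qE : q l = nth (q l) s l by exact: (tnth_nth (q l) (in_tuple s) l).
  by rewrite (nth_map (q l))// -qE.
have D1 l y : `|D l y| <= 1.
  by rewrite /D indicE; case: (_ \in _); rewrite ?normr1 ?normr0.
apply: ler_pM => //; first exact: (corr _ _ (mem_q i) (mem_q j)).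
apply: norm_mean_le_cst => // y; rewrite normrM -[leRHS]mulr1.
by apply: ler_pM.
Qed.

Lemma skew_product_weakly_mixing :
  weakly_mixing_representation pi -> ~ coboundary pi c ->
  weakly_mixing_action muX beta.
Proof.
move=> wm ncb d' Y nu s' [sp _ _] es B mB Binv.
pose f : X * Y -> R := \1_B.
have bf : bounded_measurable f by exact: bounded_measurable_indic.
have f01 z : f z = 0 \/ f z = 1.
  by rewrite /f indicE; case: (_ \in _); [right|left].
have f1 z : `|f z| <= 1 by have [->|->] := f01 z; rewrite ?normr0 ?normr1.
have tp g : measure_preserving (muX \x nu)%E (diagonal_product beta s' g).
  by apply: measure_preserving_product; [exact: (skew_product_preserving a0 c pihat_lift)|].
have ft g : {ae (muX \x nu)%E, forall z, f (diagonal_product beta s' g z) = f z}.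
  have [mt _] := tp g.
  apply: ae_eq_indic (Binv g) => //.
  by rewrite -[_ @^-1` _]setTI; exact: mt.
pose F y := \int[muX]_x f (x, y).
have bF : bounded_measurable F by exact: bounded_measurable_fubini2.
have bslice (h : X * Y -> R) y : bounded_measurable h -> bounded_measurable (fun x => h (x, y)).
  move=> [mh [M hM]]; split; last by exists M.
  exact: (measurableT_comp mh).
have bft g : bounded_measurable (fun z => f (diagonal_product beta s' g z)).
  by have [mt _] := tp g; exact: (bounded_measurable_comp mt bf).
(* For almost every [y], the slice of [f] at [s' g y] composed with [beta g] equals the slice at [y]
   almost everywhere, and [beta g] preserves means. *)
have Fs g : {ae nu, forall y, F (s' g y) = F y}.
  pose h z := `|f (diagonal_product beta s' g z) - f z|.
  have bh : bounded_measurable h.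
    by apply: bounded_measurable_norm; exact: bounded_measurableB.
  have : {ae nu, forall y, \int[muX]_x h (x, y) = 0}.
    apply: mean_eq0_ae; first exact: bounded_measurable_fubini2.
      by apply: aeW => y; apply: mean_ge0 => x; exact: normr_ge0.
    rewrite -mean_fubini2// -(mean_cst (muX \x nu)%E 0); apply: ae_eq_mean => //.
      exact: bounded_measurable_cst.
    by apply: filterS (ft g) => z hz; rewrite /h hz subrr normr0.
  apply: filterS => y hy; apply/eqP; rewrite -subr_eq0 -normr_le0.
  have [mb Pb] := skew_product_preserving a0 c pihat_lift g.
  rewrite /F -(mean_comp mb Pb (bslice f (s' g y) bf)) -meanB; last exact: bslice.
    rewrite -hy; apply: norm_mean_le; apply: bounded_measurableB; last exact: bslice.
    exact: (bslice _ y (bft g)).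
  exact: (bslice _ y (bft g)).
pose b := \int[(muX \x nu)%E]_z f z.
have Fb : {ae nu, forall y, F y = b}.
  rewrite /b mean_fubini2//; apply: (ergodic_ae_constant _ es) => // g.
  by case: (sp g).
have b01 : 0 <= b <= 1.
  rewrite mean_ge0 => [|z]; last by have [->|->] := f01 z.
  by rewrite (le_trans (ler_norm _))// norm_mean_le_cst.
suff bb : b = b ^+ 2.
  have mBE : (muX \x nu)%E B = b%:E.
    by rewrite /b mean_indic// fineK// fin_num_measure.
  have /eqP : b * (1 - b) = 0 by move: bb; rewrite expr2; lra.
  rewrite mulf_eq0 subr_eq0 => /orP[/eqP b0|/eqP b1]; [left|right].
    by apply: etrans mBE _; rewrite b0.
  by apply: etrans mBE _; rewrite -b1.
apply/eqP; rewrite -subr_eq0 -normr_le0; apply/ler_addgt0Pr => e e0; rewrite add0r.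
(* The errors are 3 r from replacing [f] by [P], r from factoring the correlations of [P], and 3 r
   from replacing the slice mean [M] by [b]. *)
pose r := Num.min 1 (e / 7).
have r0 : 0 < r by rewrite lt_min ltr01 divr_gt0.
have [r1 re] : r <= 1 /\ r <= e / 7 by rewrite /r !ge_min !lexx orbT.
have r01 : 0 <= r <= 1 by rewrite ltW.
have [_ /(_ (r ^+ 2) (exprn_gt0 2 r0))[_ [s _ <-] fP]] :=
  approximable_measurable Z_gauss a0 nu mB.
pose K := \sum_(p <- s) `|wave_coef p|.
(* [K] may be 0; dividing [r] by [1 + K ^+ 2] keeps the total error below [r] in all cases. *)
have K0 : 0 < 1 + K ^+ 2 by rewrite ltr_wpDr// sqr_ge0.
have [g corr] := wave_correlation normH Z_gauss a0 opi cc pihat_lift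
  [seq (wave_vec p, wave_freq p, wave_angle p) | p <- s] wm ncb (divr_gt0 r0 K0).
have C3 := wave_sum_correlation (sp g) corr; rewrite /= in C3.
set P := wave_sum Z s in fP C3.
have bP : bounded_measurable P by exact: (wave_sum_bounded Z a0).
pose M y := \int[muX]_x P (x, y).
have bM : bounded_measurable M by exact: bounded_measurable_fubini2.
have C1 := correlation_close (tp g) bf bP f1 (ft g) r01 (ltW fP).
have Eb : \int[(muX \x nu)%E]_z f z ^+ 2 = b.
  by apply: eq_Rintegral => z _; have [->|->] := f01 z; rewrite ?expr0n ?expr1n.
have bfP : bounded_measurable (fun z => (f z - P z) ^+ 2).
  by apply: bounded_measurableX; exact: bounded_measurableB.
(* For almost every [y], [b - M y] is the mean of the slice of [f - P], so its square is at most the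
   mean of the squares. *)
have bcM : \int[nu]_y (b - M y) ^+ 2 <= r ^+ 2.
  apply: le_trans (ltW fP); rewrite mean_fubini2//.
  rewrite (@ae_eq_mean _ _ _ _ _ (fun y => (F y - M y) ^+ 2)); last first.
  - by apply: filterS Fb => y ->.
  - by apply: bounded_measurableX; exact: bounded_measurableB.
  - by apply: bounded_measurableX; apply: bounded_measurableB => //; exact: bounded_measurable_cst.
  apply: le_mean.
  - by apply: bounded_measurableX; exact: bounded_measurableB.
  - exact: (bounded_measurable_fubini2 muX nu bfP).
  - move=> y; rewrite /F /M -meanB; [|exact: bslice..].
    apply: (mean_sqr_le muX (f := fun x => f (x, y) - P (x, y))).
    by apply: bounded_measurableB; exact: bslice.
have C2 := @correlation_close _ _ _ nu (s' g) (fun=> b) M r (sp g) _ bM _ _ r01 bcM.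
have {}C2 : `|\int[nu]_y (M (s' g y) * M y) - b ^+ 2| <= 3 * r.
  rewrite -[X in _ - X](mean_cst nu); apply: C2; first exact: bounded_measurable_cst.
    by move=> _; rewrite ger0_norm; case/andP: b01.
  exact: aeW.
have {}C3 : `|\int[(muX \x nu)%E]_z (P (diagonal_product beta s' g z) * P z) -
    \int[nu]_y (M (s' g y) * M y)| <= r.
  apply: le_trans C3 _; rewrite mulrCA -[leRHS]mulr1 ler_wpM2l ?(ltW r0)//.
  by rewrite ler_pdivrMr// mul1r lerDr.
rewrite Eb in C1.
have : 7 * r <= e by rewrite mulrC -ler_pdivlMr.
move: C1 C2 C3; rewrite !ler_norml => /andP[? ?] /andP[? ?] /andP[? ?] ?.
by apply/andP; split; lra.
Qed.

End skew_product_weakly_mixing.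

(** * Consequences of ergodicity *)

(** Take the product with the action on a one-point space, which is ergodic. *)
Lemma weakly_mixing_action_ergodic {R : realType} {G : groupType} d (X : measurableType d)
    (P : probability X R) (s : G -> X -> X) :
  (forall g, measurable_fun setT (s g)) -> weakly_mixing_action P s -> ergodic P s.
Proof.
move=> ms wm A mA Ainv.
have set_unit (B : set unit) : B = set0 \/ B = setT.
  have [Btt|Btt] := pselect (B tt); [right|left]; apply/seteqP; split => // -[] //.
have es : ergodic (\d_tt : probability unit R) (fun (_ : G) y => y).
  move=> B mB _; have [->|->] := set_unit B; [left; exact: measure0|right].
  exact: probability_setT.
have ps : pmp_action (\d_tt : probability unit R) (fun (_ : G) y => y).
  split; [|exact: aeW|by move=> *; exact: aeW].
  by move=> g; split => //; exact: measurable_id.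
have mA1 : measurable (@fst X unit @^-1` A).
  by rewrite -[_ @^-1` _]setTI; exact: measurable_fst.
have [|h|h] := wm _ _ _ _ ps es _ mA1.
- move=> g; have mD : measurable ((s g @^-1` A) `+` A).
    by apply: measurableU; apply: measurableD => //;
      rewrite -[_ @^-1` _]setTI; exact: ms.
  apply: etrans (Ainv g).
  exact: (product_fst P (\d_tt : probability unit R) mD).
- by left; apply: etrans h; exact/esym/(product_fst P (\d_tt : probability unit R) mA).
- by right; apply: etrans h; exact/esym/(product_fst P (\d_tt : probability unit R) mA).
Qed.

Section ergodic_skew_product.
Context {R : realType} {H : completeNormedModType R} (dot : {dot H for idfun}).
Context (normH : norm_from_dot dot).
Context {d : measure_display} {T : measurableType d} {mu : probability T R}.
Context (Z : H -> {RV mu >-> R}) (Z_gauss : gaussian_space Z).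
Context (a : R) (a0 : 0 < a).
Context {G : groupType} (pi : G -> {linear H -> H}) (c : G -> H).
Context (opi : orthogonal_representation dot pi) (cc : cocycle pi c).
Context (pihat : G -> T -> T) (pihat_lift : gaussian_lift Z pi pihat).

Local Notation X := (T * circle a)%type.
Local Notation muX := ((mu \x circle_prob a0)%E : probability X R).
Local Notation beta := (skew_product Z c pihat (a := a)).

Lemma circle_prob_half :
  circle_prob a0 [set t | circle_section t < a / 2] = (2^-1)%:E.
Proof.
have mC : measurable [set t : circle a | circle_section t < a / 2].
  rewrite (_ : [set t | _] = (@circle_section R a) @^-1` `]-oo, (a / 2)[%classic).
    by rewrite -[_ @^-1` _]setTI; apply: (measurable_circle_section a0).
  by apply/seteqP; split => t; rewrite /= in_itv.
rewrite circle_probE// (_ : _ `&` _ = `[0, a / 2[%classic); last first.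
  apply/seteqP; split => x /=; rewrite !in_itv /=.
    by move=> [+ /andP[x1 x2]]; rewrite circle_section_id ?x1//= x1.
  move=> /andP[x1 x2]; have xa : 0 <= x < a by apply/andP; split; lra.
  by rewrite circle_section_id.
rewrite lebesgue_measure_itv /= lte_fin divr_gt0// sube0 -EFinM.
by congr EFin; field; rewrite gt_eqF.
Qed.

(** The map [F] is a rotation in each fibre, so its law is the measure of the circle; the preimage
    of a half-circle under it is an invariant set of measure 1 / 2. *)
Lemma ergodic_not_coboundary : ergodic muX beta -> ~ coboundary pi c.
Proof.
move=> erg [xi cE].
pose F (p : X) := p.2 + circle_proj a (Z xi p.1).
have mF : measurable_fun setT F.
  by apply: measurable_circle_translation => //; exact: gauss_measurable.
pose C := [set t : circle a | circle_section t < a / 2].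
have mC : measurable C.
  rewrite (_ : C = (@circle_section R a) @^-1` `]-oo, (a / 2)[%classic).
    by rewrite -[_ @^-1` _]setTI; apply: (measurable_circle_section a0).
  by apply/seteqP; split => t; rewrite /C /= in_itv.
have mA : measurable (F @^-1` C) by rewrite -[_ @^-1` _]setTI; exact: mF.
have A2 : muX (F @^-1` C) = (2^-1)%:E.
  rewrite -circle_prob_half; apply: eq_probability => //.
  have bC : bounded_measurable (fun p : X => \1_C p.2 : R).
    apply: (bounded_measurable_comp measurable_snd).
    exact: bounded_measurable_indic.
  have E : \int[muX]_p \1_C p.2 = \int[circle_prob a0]_t \1_C t :> R.
    by rewrite (mean_fubini1 mu (circle_prob a0) bC); exact: (mean_cst mu (\int[circle_prob a0]_t \1_C t)).
  rewrite -[RHS]E -(mean_circle_translation a0 (gauss_measurable Z xi) bC).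
  by apply: eq_Rintegral => p _; rewrite !indicE.
have [g|h|h] := erg _ mA.
- have [mb _] := skew_product_preserving a0 c pihat_lift g.
  apply: ae_invariant_setY => //.
    by rewrite -[_ @^-1` _]setTI; exact: mb.
  have h1 := ae_circle_fst a0 (gauss_pihat opi pihat_lift g xi).
  have h2 := ae_circle_fst a0 (gaussB Z_gauss xi (pi g^-1%g xi)).
  apply: filterS2 h1 h2 => p h1 h2.
  rewrite /= (_ : F (beta g p) = F p)//.
  rewrite /F /skew_product /= h1 cE h2 -addrA -circle_projD; congr (_ + circle_proj a _).
  by rewrite subrK.
- by move: h; rewrite A2 => /eqP; rewrite eqe invr_eq0 pnatr_eq0.
- by move: h; rewrite A2 => /eqP; rewrite eqe invr_eq1 (eqr_nat R 2 1).
Qed.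

(** The Gaussian density decreases on the positive half-line, so on (C, C + 1] it is at least its
    value [m] at [C + 1]. *)
Lemma gauss_unbounded u (C : R) : `|u| = 1 -> 0 <= C ->
  mu [set w | C < Z u w] <> 0%E.
Proof.
move=> u1 C0.
have mi : @measurable _ (measurableTypeR R) `]C, +oo[%classic by exact: measurable_itv.
have -> : [set w | C < Z u w] = Z u @^-1` `]C, +oo[%classic.
  by apply/seteqP; split => w; rewrite /= in_itv /= andbT.
have := gaussian_law Z_gauss u mi.
rewrite /distribution /pushforward u1 expr1n /centered_gaussian oner_eq0 sqrtr1 => -> N0.
pose m : R := normal_peak 1 * expR (- (C + 1) ^+ 2 / (1 ^+ 2 *+ 2)).
have m0 : 0 < m by rewrite mulr_gt0 ?expR_gt0// normal_peak_gt0// oner_neq0.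
pose I : set (measurableTypeR R) := `]C, C + 1]%classic.
have : (m%:E <= normal_prob 0 1 I)%E.
  rewrite (_ : m%:E = \int[lebesgue_measure]_(x in I) m%:E)%E; last first.
    have LI : lebesgue_measure I = 1%E.
      by rewrite /I lebesgue_measure_itv /= lte_fin ltrDl ltr01 -EFinB addrAC subrr add0r.
    rewrite integral_cst; last exact: measurable_itv.
    by rewrite [X in (_ * X)%E]LI mule1.
  rewrite /normal_prob; apply: ge0_le_integral => //=.
  - exact: measurable_itv.
  - by move=> x _; rewrite lee_fin ltW.
  - by apply/measurable_EFinP; apply: measurable_funTS; exact: measurable_normal_pdf.
  - move=> x; rewrite /I /= in_itv /= => /andP[x1 x2]; rewrite lee_fin normal_pdfE ?oner_neq0//.
    rewrite ler_pM2l ?normal_peak_gt0 ?oner_neq0// ler_expR subr0.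
    rewrite !mulNr lerN2 ler_pM2r ?invr_gt0//.
    by rewrite ler_pXn2r// ?nnegrE; lra.
have : (normal_prob 0 1 I <= normal_prob 0 1 `]C, +oo[%classic)%E.
  apply: le_measure; rewrite ?inE//; first exact: measurable_itv.
  by move=> x /=; rewrite !in_itv /= andbT => /andP[].
move=> /[swap] /le_trans h /h; rewrite N0 lee_fin leNgt m0; exact.
Qed.

Lemma gauss_sum n (k : nat -> R) (e : nat -> H) :
  {ae mu, forall w, Z (\sum_(i < n) k i *: e i) w = \sum_(i < n) k i * Z (e i) w}.
Proof.
elim: n => [|n IH].
  by apply: filterS (gauss0 Z_gauss) => w; rewrite !big_ord0.
have h := gauss_lin Z_gauss (k n) (e n) (\sum_(i < n) k i *: e i).
by apply: filterS2 IH h => w h1 h2; rewrite !big_ord_recr /= addrC h2 h1 addrC.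
Qed.

(** The sets where the sum of squares [Q] is at most a natural number are invariant and exhaust the
    space, so one of them has full measure. This would bound the Gaussian variable of a unit vector
    almost everywhere. *)
Lemma ergodic_weakly_mixing_representation :
  ergodic muX beta -> weakly_mixing_representation pi.
Proof.
move=> erg V [V0 VD Vpi] [N [v VE]]; apply: contrapT => Vn0.
have sV : subspace V by split.
have [x Vx xn0] : exists2 x, V x & x != 0.
  apply: contrapT => nx; apply: Vn0; apply/seteqP; split => [x Vx /=|_ ->//].
  by apply: contrapT => /eqP x0; apply: nx; exists x.
pose v' i := oapp v 0 (insub i : option 'I_N).
have [y Vy y0|n [e [one Ve ex]]] := @orthonormal_basis R H dot normH N v' V sV.
  move: (Vy); rewrite VE => -[k yk].
  apply: (dot_eq0 normH); rewrite {1}yk dot_suml big1// => i _.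
  rewrite dotZl dotC (_ : v i = v' i); first by rewrite y0// mulr0.
  by rewrite /v' valK.
have n0 : (0 < n)%N.
  rewrite lt0n; apply/eqP => n0; move: xn0.
  by rewrite (ex x Vx) /expansion n0 big_ord0 eqxx.
have e1 : `|e 0%N| = 1.
  by apply/eqP; rewrite -(@eqrXn2 _ 2)// normH one// expr1n eqxx.
pose Q w' := \sum_(i < n) Z (e i) w' ^+ 2.
have mQ : measurable_fun setT Q.
  rewrite /Q; apply: measurable_sum => i; apply: measurable_funX.
  exact: gauss_measurable.
have Qg g : {ae mu, forall w, Q (pihat g w) = Q w}.
  have h1 : {ae mu, forall w, forall i : nat, Z (e i) (pihat g w) = Z (pi g^-1%g (e i)) w}.
    by apply/ae_foralln => i; exact: (gauss_pihat opi pihat_lift).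
  have h2 : {ae mu, forall w, forall i : nat,
      Z (expansion dot n e (pi g^-1%g (e i))) w =
      \sum_(j < n) dot (pi g^-1%g (e i)) (e j) * Z (e j) w}.
    apply/ae_foralln => i.
    exact: (gauss_sum n (fun j => dot (pi g^-1%g (e i)) (e j)) e).
  apply: filterS2 h1 h2 => w h1 h2.
  (* The Gaussian coordinates of [w] are treated as those of a vector of [V]: [Q w] is |z|^2 and
     [Q (pihat g w)] is |pi g z|^2. *)
  pose z := \sum_(j < n) Z (e j) w *: e j.
  have Vz : V z by apply: (subspace_sum (fun j => Z (e j) w) sV) => k /Ve.
  have ze (i : 'I_n) : dot (pi g z) (e i) = Z (e i) (pihat g w).
    rewrite h1 (ex (pi g^-1%g (e i)) (Vpi _ _ (Ve _ (ltn_ord i)))) h2.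
    rewrite (rep_dotl opi) dotC.
    rewrite [LHS](_ : _ = \sum_(j < n) dot (pi g^-1%g (e i)) (e j) * Z (e j) w)//.
    rewrite dotC /z dot_suml; apply: eq_bigr => j _.
    by rewrite dotZl mulrC (dotC dot (e j)).
  have zz (i : 'I_n) : dot z (e i) = Z (e i) w.
    rewrite /z dot_suml (bigD1 i)//= dotZl one// eqxx mulr1 big1 ?addr0// => j ij.
    by rewrite dotZl one// -[_ == _ :> nat]/(j == i) (negbTE ij) mulr0.
  have : `|pi g z| ^+ 2 = `|z| ^+ 2 by rewrite (rep_norm normH opi).
  rewrite !normH (dot_parseval (pi g z) (ex _ (Vpi g z Vz))) (dot_parseval z (ex _ Vz)).
  under eq_bigr do rewrite ze -expr2.
  by under [in X in _ = X -> _]eq_bigr do rewrite zz -expr2.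
pose A (r : nat) := [set w | Q w <= r%:R].
have mA r : measurable (A r).
  rewrite (_ : A r = Q @^-1` `]-oo, r%:R]%classic).
    by rewrite -[_ @^-1` _]setTI; apply: mQ => //; exact: measurable_itv.
  by apply/seteqP; split => w'; rewrite /A /= in_itv.
have mA1 r : measurable (@fst T (circle a) @^-1` A r).
  by rewrite -[_ @^-1` _]setTI; exact: measurable_fst.
have A01 r : mu (A r) = 0%E \/ mu (A r) = 1%E.
  have [g|h|h] := erg _ (mA1 r).
  - have [mb _] := skew_product_preserving a0 c pihat_lift g.
    apply: ae_invariant_setY => //; first by rewrite -[_ @^-1` _]setTI; exact: mb.
    by apply: filterS (ae_circle_fst a0 (Qg g)) => p h; rewrite /A /= h.
  - by left; apply: etrans h; exact/esym/(product_fst mu (circle_prob a0) (mA r)).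
  - by right; apply: etrans h; exact/esym/(product_fst mu (circle_prob a0) (mA r)).
have [r Ar] : exists r, mu (A r) = 1%E.
  apply: contrapT => nA.
  have An r : mu.-negligible (A r).
    by apply/negligibleP => //; have [//|h] := A01 r; exfalso; apply: nA; exists r.
  have := negligible_bigcup An; rewrite (_ : \bigcup_k A k = setT); last first.
    apply/seteqP; split => // w' _; exists (Num.trunc (Q w')).+1 => //.
    by rewrite /A /=; apply: ltW; exact: truncnS_gt.
  move=> /negligibleP => /(_ measurableT) /(etrans (esym (probability_setT mu))) /eqP.
  by rewrite onee_eq0.
(* The square of r + 1 exceeds r for every r >= 0. *)
apply: (@gauss_unbounded (e 0%N) (r%:R + 1) e1); first by rewrite addr_ge0.
have mB : measurable [set w | r%:R + 1 < Z (e 0%N) w].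
  rewrite (_ : [set w | _] = Z (e 0%N) @^-1` `]r%:R + 1, +oo[%classic).
    by rewrite -[_ @^-1` _]setTI; apply: gauss_measurable => //; exact: measurable_itv.
  by apply/seteqP; split => w'; rewrite /= in_itv /= andbT.
have A0 : mu (~` A r) = 0%E by rewrite probability_setC// Ar subee.
apply/eqP; rewrite -measure_le0 -A0; apply: le_measure; rewrite ?inE//.
  exact: measurableC.
move=> w' /= rZ; rewrite /A /= => QA.
have : Z (e 0%N) w' ^+ 2 <= r%:R.
  apply: le_trans QA; rewrite /Q (bigD1 (Ordinal n0))//= lerDl sumr_ge0// => i _.
  exact: sqr_ge0.
have : 0 <= r%:R :> R by [].
move: (r%:R) rZ => q; nra.
Qed.

End ergodic_skew_product.

Theorem proposition9p7 (R : realType)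
    (G : groupType) (countableG : countable [set: G])
    (H : completeNormedModType R) (dot : {dot H for idfun})
    (normH : norm_from_dot dot) (separableH : separable H)
    (pi : G -> {linear H -> H}) (c : G -> H)
    (alpha_affine : affine_isometric_action dot pi c)
    (d : measure_display) (T : measurableType d) (mu : probability T R)
    (Z : H -> {RV mu >-> R}) (Z_gauss : gaussian_space Z)
    (pihat : G -> T -> T) (pihat_lift : gaussian_lift Z pi pihat)
    (a : R) (a_gt0 : 0 < a) :
  let beta' : G -> T * circle a -> T * circle a :=
    skew_product Z c pihat (a := a) in
  let muT : probability (T * circle a)%type R :=
    (mu \x circle_prob a_gt0)%E in
  (weakly_mixing_action muT beta' <-> ergodic muT beta') /\
  (ergodic muT beta' <->
     weakly_mixing_representation pi /\ ~ coboundary pi c).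
Proof.
move=> beta' muT; have [opi cc] := alpha_affine.
have e_of_wm : weakly_mixing_action muT beta' -> ergodic muT beta'.
  apply: weakly_mixing_action_ergodic => g.
  by case: (skew_product_preserving a_gt0 c pihat_lift g).
have wm_of_rep : weakly_mixing_representation pi /\ ~ coboundary pi c ->
    weakly_mixing_action muT beta'.
  move=> [wm ncb]; exact: (skew_product_weakly_mixing normH Z_gauss opi cc pihat_lift).
have rep_of_e : ergodic muT beta' ->
    weakly_mixing_representation pi /\ ~ coboundary pi c.
  move=> erg; split.
    exact: (ergodic_weakly_mixing_representation normH Z_gauss opi pihat_lift erg).
  exact: (ergodic_not_coboundary Z_gauss opi pihat_lift erg).
by split; split => // ?; [apply/wm_of_rep/rep_of_e|apply/e_of_wm/wm_of_rep].
Qed.
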